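(* Let the type be ${\tt A}_n$, ${\tt B}_n$ or ${\tt C}_n$ and let $\lambda=\sum_{i=1}^na_i\omega_i$ be a dominant coweight. The bijection $\gamma\leftrightarrow\mathcal T_\gamma$ between the galleries of the same type as $\gamma_{\underline\lambda}$ and the Young tableaux of shape $p_{\underline\lambda}$ and type ${\tt A}_n$, respectively ${\tt B}_n$ or ${\tt C}_n$, induces a bijection between the positively folded galleries and the semistandard tableaux.
   Context: **Coordinates.** $G$ is a connected complex semisimple group with roots $\Phi$, positive roots $\Phi^+$, coroots $\Phi^\vee$, Weyl group $W$ (Bruhat order), $\mathbb A=X^\vee\otimes\mathbb R$ ($X^\vee$ cocharacters of a maximal torus), origin $\mathfrak o$. Fundamental coweights $\omega_1,\dots,\omega_n\in\mathbb A$ are dual to the simple roots, in Bourbaki enumeration. Type ${\tt A}_n,{\tt B}_n,{\tt C}_n$ means that the coweights are realized as the weights of the root system of that type (i.e. $\Phi^\vee$ has this type): $\omega_i=\epsilon_1+\dots+\epsilon_i$ for $1\le i\le n$ (modulo $\epsilon_1+\cdots+\epsilon_{n+1}$ in type ${\tt A}_n$), except $\omega_n=\frac12(\epsilon_1+\dots+\epsilon_n)$ in type ${\tt B}_n$. Put $\epsilon_{\bar i}=-\epsilon_i$. $\omega_i$ is minuscule iff: $i$ arbitrary in type ${\tt A}_n$, $i=n$ in type ${\tt B}_n$, $i=1$ in type ${\tt C}_n$. **Galleries.** Walls are $H_{\alpha,m}=\{x\in\mathbb A:\langle\alpha,x\rangle+m=0\}$, $\alpha\in\Phi,m\in\mathbb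 Z$, with reflections $s_{\alpha,m}$; $W^{\mathfrak a}$ is generated by these; faces are the closed faces of this arrangement ($F^o$ the open face), vertices and edges those of dimension $0$, $1$; the type of a face is the unique $W^{\mathfrak a}$-conjugate face of the fundamental alcove $\{0\le\langle\alpha,x\rangle\le1\ \forall\alpha\in\Phi^+\}$. A vertex is special if every root has a wall $H_{\alpha,m}$ through it. A (combinatorial one-skeleton) gallery is a sequence $(V_0\subset E_0\supset V_1\subset\dots\subset E_r\supset V_{r+1})$ of vertices $V_i$ and edges $E_i$ in $\mathbb A$ with $V_0,V_{r+1}$ special; its type is the sequence of types of its faces; all galleries here start in $V_0=\mathfrak o$. Concatenation $*$ is after translation of the second gallery to the target of the first. $\gamma_{\omega_i}$ is the gallery of consecutive vertices and edges on the segment from $\mathfrak o$ to $\omega_i$, and $\gamma_{\underline\lambda}=\gamma_{\omega_1}*\cdots*\gamma_{\omega_1}*\cdots*\gamma_{\omega_n}*\cdots*\gamma_{\omega_n}$ with $\gamma_{\omega_i}$ occurring $a_i$ times. If $\omega_i$ is minuscule, the galleries of the same type as $\gamma_{\omega_i}$ are the $(\mathfrak o\subset\sigma(E)\supset\sigma(\omega_i))$, $\sigma\in W/W_{\omega_i}$, $E=\{t\omega_i:t\in[0,1]\}$. If $\omega_i$ is not minuscule, they are of the form $(\mathfrak o\subset\tau(E_1)\supset\frac{\tau(\omega_i)}2\subset\tau\sigma(E_1)+\frac12\tau(\omega_i)\supset\frac{\tau(\omega_i)+\tau\sigma(\omega_i)}2)$, $E_1=\{t\omega_i:t\in[0,\frac12]\}$,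 $\tau\in W$, $\sigma$ in the subgroup of $W$ generated by the reflections in the roots $\alpha$ with $\langle\alpha,\frac12\omega_i\rangle\in\mathbb Z$; such a gallery is determined by the pair $(\tau(\omega_i),\tau\sigma(\omega_i))$. **Positively folded.** $C^+$ is the closed dominant Weyl chamber, $C^-=-C^+$. A sector with vertex $V$ is $\mathfrak s=V+\tau(C^+)$, $\tau\in W$; $-\mathfrak s=V-\tau(C^+)$; its class is given by $\tau$, classes being ordered by the Bruhat order. A wall separates $\Omega$ from a face $F$ if $\Omega$ lies in a closed half-space and $F^o$ in the opposite open half-space. $(E\supset V\subset F)$ is minimal if there is a sector $\mathfrak s$ with vertex $V$, $E\subset\mathfrak s$, $F\subset-\mathfrak s$. $(E\supset V\subset F')$ is obtained from $(E\supset V\subset F)$ by a positive folding if there is $(\beta,m)$ with $V\in H_{\beta,m}$, $F'=s_{\beta,m}(F)$ and $H_{\beta,m}$ separates $F\cup(V+C^-)$ from $F'$. $(E\supset V\subset F)$ is positively folded if it is minimal or obtained from a minimal $(E\supset V\subset F_0)$ by finitely many positive foldings. A gallery is positively folded if all $(E_{i-1}\supset V_i\subset E_i)$ are positively folded and there are sectors $\mathfrak s_i$ with vertex $V_i$, $E_i\subset\mathfrak s_i$ ($0\le i\le r$), with classes $\underline{\mathfrak s}_0\ge\cdots\ge\underline{\mathfrak s}_r$. **Tableaux.** The Young diagram of shape $p=(p_1,\dots,p_n)$ has left-justified rows of lengths $p_1,p_2,\dots$ from top to bottom; columns $C_1,C_2,\dots$ are numbered from right to left. Let $\mathfrak N=\{1<2<\dots<n<\bar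 n<\dots<\bar2<\bar1\}$, $\bar{\bar i}=i$. - Type ${\tt A}_n$: $p_{\underline\lambda}$ has $p_i=a_i+\dots+a_n$. A Young tableau of shape $p_{\underline\lambda}$ is a filling with positive integers $\le n+1$, strictly increasing down the columns. - Type ${\tt B}_n$: $p_i=2a_i+\dots+2a_{n-1}+a_n$. A Young tableau of shape $p_{\underline\lambda}$ is a filling with elements of $\mathfrak N$, strictly increasing down columns, $i$ and $\bar i$ never in the same column, and for each pair $(C_{2j-1},C_{2j})$, $j=1,\dots,a_1+\dots+a_{n-1}$, either $C_{2j-1}=C_{2j}$ or $C_{2j}$ is obtained from $C_{2j-1}$ by exchanging some entries $k$ by $\bar k$ (and reordering). - Type ${\tt C}_n$: $p_1=a_1+\sum_{j\ge2}2a_j$, $p_i=2a_i+\dots+2a_n$ for $i\ge2$. A Young tableau of shape $p_{\underline\lambda}$ is a filling with elements of $\mathfrak N$, strictly increasing down columns, $i$ and $\bar i$ never in the same column, and for each pair $(C_{a_1+2j-1},C_{a_1+2j})$, $j=1,\dots,a_2+\dots+a_n$, either the two columns are equal or $C_{a_1+2j}$ is obtained from $C_{a_1+2j-1}$ by exchanging an even number of entries $k$ by $\bar k$ (and reordering). In each type a tableau is semistandard if in addition the entries are weakly increasing along the rows from left to right. **The correspondence.** A weight $\epsilon_{j_1}+\dots+\epsilon_{j_i}$ (or $\frac12(\epsilon_{j_1}+\dots+\epsilon_{j_n})$ for $\omega_n$ in type ${\tt B}_n$) in the $W$-orbit of a fundamental coweight, $j_1<\dots<j_i$, is encoded by the column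 with entries $j_1,\dots,j_i$ from top to bottom. A gallery of the same type as $\gamma_{\underline\lambda}$ is $\gamma=\gamma_1*\cdots*\gamma_N$, $N=\sum a_i$, where each $\gamma_k$ is of the same type as the corresponding $\gamma_{\omega_j}$. To $\gamma_k$ attach the one-column tableau of $\sigma(\omega_j)$ if $\omega_j$ is minuscule, and otherwise the two-column tableau with first (right) column that of $\tau(\omega_j)$ and second (left) column that of $\tau\sigma(\omega_j)$. $\mathcal T_\gamma$ is obtained by starting with the tableau of $\gamma_1$ and successively adding those of $\gamma_2,\dots,\gamma_N$ to the left; $\gamma\mapsto\mathcal T_\gamma$ is a bijection onto the Young tableaux of shape $p_{\underline\lambda}$ of the given type. *)

(* Defs.v *)
From Stdlib Require Export Relation_Operators.
From mathcomp Require Export all_boot all_order all_algebra.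
From mathcomp Require Export boolp classical_sets functions reals.
Import Order.TTheory GRing.Theory Num.Theory.
Local Open Scope classical_set_scope.
Local Open Scope ring_scope.

(* The type is that of the coroot system, so that the fundamental coweights
   below are the fundamental weights of the root system of this type. *)
Inductive cartan_type := TypeA | TypeB | TypeC.

Definition is_typeB (t : cartan_type) : bool :=
  if t is TypeB then true else false.

(* Number of coordinates of the ambient space containing the apartment. *)
Definition ambient (t : cartan_type) (n : nat) : nat :=
  if t is TypeA then n.+1 else n.

Section Apartment.

Variables (R : realType) (t : cartan_type) (n : nat).

Local Notation V := 'rV[R]_(ambient t n).

(* In type A, the quotient of R^(n+1) by the line of eps_1 + ... + eps_(n+1) is
   realized as the hyperplane of coordinate sum 0. *)
Definition apartment : set V :=
  [set x | if t is TypeA then \sum_i x 0 i = 0 else True].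

(* eps k for a letter k, where the barred letter of i is the integer - i;
   coordinates are numbered from 1.  In type A this is the image of the
   standard basis vector under the projection onto the apartment. *)
Definition eps (k : int) : V :=
  (sgz k)%:~R *: \row_i ((i.+1 == `|k|%N)%:R -
                         (if t is TypeA then n.+1%:R^-1 else 0)).

Definition dot (x y : V) : R := \sum_i x 0 i * y 0 i.

(* The roots, as linear forms x |-> dot alpha x.  They form the dual of the
   system of the given type: there are long roots 2 eps_i in type B and short
   roots eps_i in type C. *)
Definition pos_roots : set V := [set alpha |
  exists i j : nat, (0 < i)%N /\
  [\/ [/\ (i < j)%N, (j <= ambient t n)%N & alpha = eps i - eps j],
      [/\ t <> TypeA, (i < j)%N, (j <= n)%N & alpha = eps i + eps j],
      [/\ t = TypeB, (i <= n)%N & alpha = 2%:R *: eps i] |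
      [/\ t = TypeC, (i <= n)%N & alpha = eps i]]].

Definition roots : set V := [set alpha | pos_roots alpha \/ pos_roots (- alpha)].

Definition simple_root (i : nat) : V :=
  if (i < n)%N then eps i - eps i.+1 else
  match t with
  | TypeA => eps n - eps n.+1
  | TypeB => 2%:R *: eps n
  | TypeC => eps n
  end.

Definition weight_scale (i : nat) : R :=
  if is_typeB t && (i == n) then 2%:R^-1 else 1.

Definition omega (i : nat) : V :=
  weight_scale i *: \sum_(1 <= j < i.+1) eps j.

Definition minuscule (i : nat) : Prop :=
  forall alpha, roots alpha -> `|dot alpha (omega i)| <= 1.

(* The reflection s_(alpha, m) in the wall dot alpha x + m = 0. *)
Definition refl (alpha : V) (m : int) (x : V) : V :=
  x - (dot alpha x + m%:~R) *: ((2%:R / dot alpha alpha) *: alpha).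

Definition wall (alpha : V) (m : int) : set V :=
  [set x | apartment x /\ dot alpha x + m%:~R = 0].

(* The monoid generated by S; it is the generated group whenever S is closed
   under inverses, in particular for a set S of reflections. *)
Inductive generated (S : set (V -> V)) : set (V -> V) :=
| generated_id : generated S id
| generated_comp f g : S f -> generated S g -> generated S (f \o g).

Definition weyl : set (V -> V) :=
  generated [set s | exists2 alpha, roots alpha & s = refl alpha 0].

Definition affine_weyl : set (V -> V) :=
  generated [set s | exists alpha m, roots alpha /\ s = refl alpha m].

(* Generated by the reflections in the roots that are integral on v. *)
Definition weyl_integral (v : V) : set (V -> V) :=
  generated [set s | exists alpha (m : int),
    [/\ roots alpha, dot alpha v = m%:~R & s = refl alpha 0]].

Inductive simple_word : nat -> (V -> V) -> Prop :=
| simple_word_id : simple_word 0 id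
| simple_word_comp k i w : (0 < i <= n)%N -> simple_word k w ->
    simple_word k.+1 (refl (simple_root i) 0 \o w).

(* The length of u is smaller than the length of w. *)
Definition length_lt (u w : V -> V) : Prop :=
  exists2 k, simple_word k u & forall l, simple_word l w -> (k < l)%N.

Definition bruhat_step (u w : V -> V) : Prop :=
  exists alpha, [/\ roots alpha, w = u \o refl alpha 0 & length_lt u w].

Definition bruhat_le : (V -> V) -> (V -> V) -> Prop :=
  clos_refl_trans (V -> V) bruhat_step.

(* The smallest closed face containing x: the intersection of all closed
   half-spaces bounded by walls that contain x.  Both half-spaces of a wall are
   covered, since roots are closed under negation. *)
Definition carrier (x : V) : set V := [set y | apartment y /\
  forall alpha (m : int), roots alpha ->
    0 <= dot alpha x + m%:~R -> 0 <= dot alpha y + m%:~R].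

Definition face (F : set V) : Prop := exists2 x, apartment x & F = carrier x.

Definition open_face (F : set V) : set V := [set x | F x /\ carrier x = F].

(* Dimension of the affine span: U is the least subspace containing all
   differences of points of F. *)
Definition has_dim (F : set V) (d : nat) : Prop :=
  exists U : {vspace V},
    [/\ \dim U = d,
        forall x y, F x -> F y -> y - x \in U &
        forall U' : {vspace V},
          (forall x y, F x -> F y -> y - x \in U') -> (U <= U')%VS].

Definition is_vertex (v : V) : Prop := face [set v] /\ has_dim [set v] 0.
Definition is_edge (E : set V) : Prop := face E /\ has_dim E 1.

Definition special (v : V) : Prop :=
  is_vertex v /\ forall alpha, roots alpha -> exists m, wall alpha m v.

Definition fundamental_alcove : set V := [set x | apartment x /\
  forall alpha, pos_roots alpha -> 0 <= dot alpha x <= 1].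

(* D is the type of the face F. *)
Definition face_type (F D : set V) : Prop :=
  [/\ face D, D `<=` fundamental_alcove &
      exists2 w, affine_weyl w & D = w @` F].

(* Source V_0 and the successive pairs (E_i, V_(i+1)). *)
Record gallery := Gallery { source : V; steps : seq (set V * V) }.

Definition target (g : gallery) : V := last (source g) (unzip2 (steps g)).

Definition vertex_at (g : gallery) (k : nat) : V :=
  nth 0 (source g :: unzip2 (steps g)) k.

Definition edge_at (g : gallery) (k : nat) : set V :=
  nth set0 (unzip1 (steps g)) k.

(* The gallery reduced to the vertex 0 is allowed: it is gamma_lambda for
   lambda = 0. *)
Definition is_gallery (g : gallery) : Prop :=
  [/\ source g = 0, special (source g), special (target g),
      (forall k, (k <= size (steps g))%N -> is_vertex (vertex_at g k)) &
      forall k, (k < size (steps g))%N ->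
        [/\ is_edge (edge_at g k), edge_at g k (vertex_at g k) &
            edge_at g k (vertex_at g k.+1)]].

Definition same_type (g h : gallery) : Prop :=
  [/\ size (steps g) = size (steps h),
      (forall k, (k <= size (steps g))%N -> exists D,
        face_type [set vertex_at g k] D /\ face_type [set vertex_at h k] D) &
      forall k, (k < size (steps g))%N -> exists D,
        face_type (edge_at g k) D /\ face_type (edge_at h k) D].

Definition trivial_gallery : gallery := Gallery 0 [::].

Definition concat (g h : gallery) : gallery :=
  let u := target g - source h in
  Gallery (source g)
    (steps g ++ [seq ((fun x => u + x) @` p.1, u + p.2) | p <- steps h]).

Definition segment (x y : V) : set V :=
  [set (1 - s) *: x + s *: y | s in [set s : R | 0 <= s <= 1]].

(* Consecutive vertices and edges on the segment from 0 to omega_i; breaks k is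
   the parameter of the k-th vertex. *)
Definition is_gamma_omega (i : nat) (g : gallery) : Prop :=
  is_gallery g /\
  exists breaks : nat -> R,
    [/\ breaks 0%N = 0, breaks (size (steps g)) = 1,
        (forall k, (k < size (steps g))%N -> breaks k < breaks k.+1),
        (forall k, (k <= size (steps g))%N ->
           vertex_at g k = breaks k *: omega i) &
        (forall k, (k < size (steps g))%N ->
           edge_at g k =
           segment (breaks k *: omega i) (breaks k.+1 *: omega i))].

Fixpoint is_gamma_word (w : seq nat) (g : gallery) : Prop :=
  if w is i :: w' then
    exists g1 g2, [/\ is_gamma_omega i g1, is_gamma_word w' g2 &
                      g = concat g1 g2]
  else g = trivial_gallery.

(* 1 repeated a 1 times, ..., n repeated a n times. *)
Definition lambda_word (a : nat -> nat) : seq nat :=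
  flatten [seq nseq (a i) i | i <- iota 1 n].

Definition is_gamma_lambda (a : nat -> nat) : gallery -> Prop :=
  is_gamma_word (lambda_word a).

Definition galleries (a : nat -> nat) : set gallery := [set g |
  is_gallery g /\ exists2 g0, is_gamma_lambda a g0 & same_type g g0].

Definition dominant_chamber : set V := [set x | apartment x /\
  forall alpha, pos_roots alpha -> 0 <= dot alpha x].

Definition sector (v : V) (tau : V -> V) : set V :=
  [set v + tau c | c in dominant_chamber].

Definition opp_sector (v : V) (tau : V -> V) : set V :=
  [set v - tau c | c in dominant_chamber].

Definition minimal_at (E : set V) (v : V) (F : set V) : Prop :=
  exists2 tau, weyl tau & E `<=` sector v tau /\ F `<=` opp_sector v tau.

Definition separates (alpha : V) (m : int) (Omega F : set V) : Prop :=
  ((forall x, Omega x -> dot alpha x + m%:~R <= 0) /\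
   (forall x, open_face F x -> 0 < dot alpha x + m%:~R)) \/
  ((forall x, Omega x -> 0 <= dot alpha x + m%:~R) /\
   (forall x, open_face F x -> dot alpha x + m%:~R < 0)).

Definition positive_folding (v : V) (F F' : set V) : Prop :=
  exists beta m, [/\ roots beta, wall beta m v, F' = refl beta m @` F &
    separates beta m (F `|` opp_sector v id) F'].

Definition positively_folded_at (E : set V) (v : V) (F : set V) : Prop :=
  exists F0, [/\ is_edge F0, F0 v, minimal_at E v F0 &
    clos_refl_trans (set V) (positive_folding v) F0 F].

Definition positively_folded (g : gallery) : Prop :=
  (forall k, (k.+1 < size (steps g))%N ->
     positively_folded_at (edge_at g k) (vertex_at g k.+1) (edge_at g k.+1)) /\
  exists tau : nat -> V -> V,
    [/\ (forall k, (k < size (steps g))%N -> weyl (tau k)),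
        (forall k, (k < size (steps g))%N ->
           edge_at g k `<=` sector (vertex_at g k) (tau k)) &
        forall k, (k.+1 < size (steps g))%N -> bruhat_le (tau k.+1) (tau k)].

(* 0 < x holds for unbarred letters, x < 0 for barred ones. *)
Definition letter_lt (x y : int) : bool :=
  if (0 < x) == (0 < y) then x < y else 0 < x.

Definition letter_le (x y : int) : bool := (x == y) || letter_lt x y.

Definition letter (x : int) : bool :=
  if t is TypeA then 1 <= x <= n.+1%:Z else (1 <= `|x|%N <= n)%N.

(* A filling of a Young diagram is given by its columns C_1, C_2, ..., from
   right to left; each column is listed from top to bottom. *)
Definition tableau := seq (seq int).

(* The length of the i-th row, for 1 <= i <= n. *)
Definition row_length (a : nat -> nat) (i : nat) : nat :=
  match t with
  | TypeA => \sum_(i <= j < n.+1) a j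
  | TypeB => \sum_(i <= j < n) 2 * a j + a n
  | TypeC => if i == 1%N then a 1%N + \sum_(2 <= j < n.+1) 2 * a j
             else \sum_(i <= j < n.+1) 2 * a j
  end%N.

(* The j-th column from the right is the (p_1 + 1 - j)-th one from the left; it
   meets the rows of length at least p_1 + 1 - j. *)
Definition has_shape (p : nat -> nat) (T : tableau) : Prop :=
  size T = p 1%N /\
  forall j, (1 <= j <= p 1%N)%N ->
    size (nth [::] T j.-1) = count (fun i => p 1%N + 1 - j <= p i)%N (iota 1 n).

(* C' is obtained from C by barring/unbarring the entries selected by S. *)
Definition exchange (S : pred int) (C C' : seq int) : Prop :=
  perm_eq C' [seq if S k then - k else k | k <- C].

Definition pair_condition (a : nat -> nat) (T : tableau) : Prop :=
  let C j := nth [::] T j.-1 in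
  match t with
  | TypeA => True
  | TypeB => forall j, (1 <= j <= \sum_(1 <= i < n) a i)%N ->
      exists S, exchange S (C (2 * j - 1)%N) (C (2 * j)%N)
  | TypeC => forall j, (1 <= j <= \sum_(2 <= i < n.+1) a i)%N ->
      exists2 S, ~~ odd (count S (C (a 1 + 2 * j - 1)%N)) &
        exchange S (C (a 1 + 2 * j - 1)%N) (C (a 1 + 2 * j)%N)
  end.

Definition young_tableaux (a : nat -> nat) : set tableau := [set T |
  [/\ has_shape (row_length a) T,
      (forall C, C \in T -> all letter C && sorted letter_lt C),
      (forall C k, C \in T -> k \in C -> - k \notin C) &
      pair_condition a T]].

Definition semistandard (T : tableau) : Prop :=
  forall j i, (j.+1 < size T)%N ->
    (i < size (nth [::] T j))%N -> (i < size (nth [::] T j.+1))%N ->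
    letter_le (nth 0 (nth [::] T j.+1) i) (nth 0 (nth [::] T j) i).

(* This is used only for v in the Weyl group orbit of omega_i, which rules out
   columns containing both k and - k. *)
Definition encodes (i : nat) (C : seq int) (v : V) : Prop :=
  [/\ size C = i, all letter C, sorted letter_lt C &
      v = weight_scale i *: \sum_(k <- C) eps k].

(* The gallery g of the same type as gamma_(omega_i), with its tableau T. *)
Definition block (i : nat) (g : gallery) (T : tableau) : Prop :=
  let w := omega i in
  let h := 2%:R^-1 *: w in
  (minuscule i /\ exists sigma C,
     [/\ weyl sigma, g = Gallery 0 [:: (sigma @` segment 0 w, sigma w)],
         T = [:: C] & encodes i C (sigma w)]) \/
  (~ minuscule i /\ exists tau sigma C C',
     [/\ weyl tau /\ weyl_integral h sigma,
         g = Gallery 0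
           [:: (tau @` segment 0 h, 2%:R^-1 *: tau w);
               ([set tau (sigma x) + 2%:R^-1 *: tau w | x in segment 0 h],
                2%:R^-1 *: (tau w + tau (sigma w)))],
         T = [:: C; C'] & encodes i C (tau w) /\ encodes i C' (tau (sigma w))]).

Fixpoint tableau_of_word (w : seq nat) (g : gallery) (T : tableau) : Prop :=
  if w is i :: w' then
    exists g1 T1 g2 T2, [/\ block i g1 T1, tableau_of_word w' g2 T2,
                            g = concat g1 g2 & T = T1 ++ T2]
  else g = trivial_gallery /\ T = [::].

Definition tableau_of (a : nat -> nat) : gallery -> tableau -> Prop :=
  tableau_of_word (lambda_word a).

End Apartment.

(* Main.v *)
Require Import Defs.
From mathcomp Require Import zify ring lra.

(** Every root is a positive multiple of a difference eps p - eps q of two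
    distinct letters, where eps (- p) = - eps p, and it is positive exactly when
    p precedes q in the order 1 < ... < n < - n < ... < - 1 ([pos_rootsP]).  So a
    reflection swaps two letters, and an element of the Weyl group is a
    permutation s of the letters that commutes with the sign ([acts]).

    Galleries and tableaux.  A gallery of the given type makes one step for each
    minuscule coweight and two half steps, through a vertex that need not be
    special, for each of the others.  The two ends of an edge of such a gallery
    have different types, because their difference lies outside of the coroot
    lattice ([omega_step_not_QV], [cell_noconj]).  An edge of the same type as
    a reference edge is therefore the image of that edge under an element of the
    affine Weyl group that matches the ends in the right order ([cell_match]).
    Hence each step is a Weyl image of the reference step, that is, a column, and
    the gallery is the path with these steps ([gallery_word_tableau]).  The two
    columns of a block of two half steps satisfy one condition: half the
    difference of their weights is in the coroot lattice ([linked]).  Comparing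
    coordinates, this means that the second column arises from the first by
    changing signs of entries, of an even number of them in type C ([linkedP]).
    The paths along these tableaux are also the galleries that the encoding by
    tau and tau sigma describes ([tableau_of_wordP]), and the tableaux are the
    Young tableaux of the given shape ([young_word_tableau]).

    Positively folded implies semistandard.  A sector of class tau contains the
    step of a column of length k exactly when the entries of the column are the
    images of 1, ..., k under tau ([sector_column], [lifts_step]).  Going up in the Bruhat
    order, the images of 1, ..., k move up: for every z, the number of images
    that are at most z decreases weakly ([bruhat_le_count]).  Applied to the
    sectors of two consecutive edges this compares the two columns entry by
    entry, and gives the weak increase along the rows.

    Semistandard implies positively folded.  Conversely, if the images of
    1, ..., k under u increase and are bounded by the entries of a column of
    length k, then some w above u in the Bruhat order maps 1, ..., k to the
    entries ([bruhat_lift]).  Lifting the columns one after the other, from the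
    leftmost to the rightmost, gives the decreasing chain of sectors
    ([lift_chain]).  At a special vertex between two steps, a Bruhat chain from
    u to w turns into a chain of positive foldings, from the minimal
    continuation in the direction of w to the actual edge ([bruhat_foldings]).
    At the middle vertex of a block fewer walls are available: the reflections in
    them transfer a bar from one entry to another, or remove one bar (type B) or
    two bars (type C).  The row condition says that among the entries of absolute
    value at most z the second column has at most as many bars as the first one,
    and this suffices to reach it by moves that are all positive
    ([sign_foldings]). *)

Import Order.TTheory GRing.Theory Num.Theory.
Local Open Scope classical_set_scope.
Local Open Scope ring_scope.
Set Implicit Arguments.
Unset Strict Implicit.
Unset Printing Implicit Defensive.

(** * Letters *)

Lemma letter_ltE (p q : int) : letter_lt p q =
  [|| (0 < p) && ((q <= 0) || (p < q)) | [&& p <= 0, q <= 0 & p < q]].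
Proof. by rewrite /letter_lt; case: eqP; lia. Qed.

(** The permutation of the letters given by the reflection that exchanges eps p
    and eps q. It exchanges eps (- p) and eps (- q) as well, and for q = - p it
    is a sign change. *)
Definition swap (p q k : int) : int :=
  if k == p then q else if k == q then p else
  if k == - p then - q else if k == - q then - p else k.

Lemma swapN (p q k : int) : p != 0 -> q != 0 -> swap p q (- k) = - swap p q k.
Proof. by rewrite /swap => p0 q0; repeat (case: ifP => ?); lia. Qed.

Lemma swapK (p q : int) : p != 0 -> q != 0 -> involutive (swap p q).
Proof.
move=> p0 q0 k; rewrite {2}/swap.
by repeat (case: ifP => ?); rewrite /swap; repeat (case: ifP => ?); lia.
Qed.

Lemma letter_neq0 t n p : letter t n p -> p != 0.
Proof. by case: t => /=; lia. Qed.

Lemma letterN t n p : t <> TypeA -> letter t n (- p) = letter t n p.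
Proof. by case: t => //=; lia. Qed.

Lemma letter_pos n p : letter TypeA n p -> 0 < p.
Proof. by rewrite /=; lia. Qed.

Lemma letter_swap t n p q k : letter t n p -> letter t n q ->
  letter t n (swap p q k) = letter t n k.
Proof. by case: t => /= lp lq; rewrite /swap; repeat (case: ifP => ?); lia. Qed.

Lemma typeA_dec t : t = TypeA \/ t <> TypeA.
Proof. by case: t; [left|right|right]. Qed.

Lemma typeBC t : t <> TypeA -> t = TypeB \/ t = TypeC.
Proof. by case: t => //; [left|right]. Qed.

Lemma sub_in_count (T : eqType) (a1 a2 : pred T) (s : seq T) :
  {in s, subpred a1 a2} -> (count a1 s <= count a2 s)%N.
Proof.
elim: s => //= x s IH H; apply: leq_add.
  by case a1x: (a1 x) => //; rewrite (H x) ?mem_head.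
by apply: IH => y ys; apply: H; rewrite inE ys orbT.
Qed.

Section Vectors.

Variables (R : realType) (t : cartan_type) (n : nat).
Local Notation V := 'rV[R]_(ambient t n).
Local Notation eps := (eps R t n).
Local Notation dot := (dot R t n).
Local Notation apartment := (apartment R t n).
Local Notation letter := (letter t n).
Local Notation refl := (refl R t n).
Local Notation pos_roots := (pos_roots R t n).
Local Notation roots := (roots R t n).
Implicit Types (p q r : int).

(** * The apartment and its scalar product *)

Lemma dotC x y : dot x y = dot y x.
Proof. by apply: eq_bigr => i _; rewrite mulrC. Qed.

Lemma dotDl x y z : dot (x + y) z = dot x z + dot y z.
Proof. by rewrite /dot -big_split; apply: eq_bigr => i _; rewrite mxE mulrDl. Qed.

Lemma dotZl a x y : dot (a *: x) y = a * dot x y.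
Proof. by rewrite /dot mulr_sumr; apply: eq_bigr => i _; rewrite mxE mulrA. Qed.

Lemma dotDr x y z : dot x (y + z) = dot x y + dot x z.
Proof. by rewrite dotC dotDl !(dotC x). Qed.

Lemma dotZr a x y : dot x (a *: y) = a * dot x y.
Proof. by rewrite dotC dotZl dotC. Qed.

Lemma dotNl x y : dot (- x) y = - dot x y.
Proof. by rewrite -scaleN1r dotZl mulN1r. Qed.

Lemma dotNr x y : dot x (- y) = - dot x y.
Proof. by rewrite dotC dotNl dotC. Qed.

Lemma dotBl x y z : dot (x - y) z = dot x z - dot y z.
Proof. by rewrite dotDl dotNl. Qed.

Lemma dotBr x y z : dot x (y - z) = dot x y - dot x z.
Proof. by rewrite dotDr dotNr. Qed.

Lemma dot0r x : dot x 0 = 0.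
Proof. by rewrite -(subrr x) dotBr subrr. Qed.

Lemma dot_sumr x (I : Type) (s : seq I) (P : pred I) (F : I -> V) :
  dot x (\sum_(i <- s | P i) F i) = \sum_(i <- s | P i) dot x (F i).
Proof. by apply: (big_morph (dot x)) => [y z|]; rewrite ?dotDr ?dot0r. Qed.

Definition dotE := (dotDl, dotDr, dotNl, dotNr, dotZl, dotZr).

Lemma apartment0 : apartment 0.
Proof. by rewrite /apartment /=; case: t => //; rewrite big1 // => i _; rewrite mxE. Qed.

Lemma apartmentD x y : apartment x -> apartment y -> apartment (x + y).
Proof.
rewrite /apartment /=; case: t x y => // x y sx sy.
rewrite (eq_bigr (fun i => x 0 i + y 0 i)) => [|i _]; last by rewrite mxE.
by rewrite big_split /= sx sy addr0.
Qed.

Lemma apartmentZ a x : apartment x -> apartment (a *: x).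
Proof.
rewrite /apartment /=; case: t x => // x sx.
rewrite (eq_bigr (fun i => a * x 0 i)) => [|i _]; last by rewrite mxE.
by rewrite -mulr_sumr sx mulr0.
Qed.

Lemma apartmentN x : apartment x -> apartment (- x).
Proof. by move=> ax; rewrite -scaleN1r; apply: apartmentZ. Qed.

Lemma apartmentB x y : apartment x -> apartment y -> apartment (x - y).
Proof. by move=> ax ay; apply/apartmentD/apartmentN. Qed.

Lemma apartment_sum (I : eqType) (s : seq I) (F : I -> V) :
  (forall i, i \in s -> apartment (F i)) -> apartment (\sum_(i <- s) F i).
Proof.
move=> H; rewrite big_seq; apply: (big_ind apartment) => //.
- exact: apartment0.
- exact: apartmentD.
Qed.

Lemma epsN p : eps (- p) = - eps p.
Proof. by rewrite /eps abszN sgzN rmorphN scaleNr. Qed.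

Lemma letter_ord p : letter p ->
  exists2 j : 'I_(ambient t n), `|p|%N = j.+1 & (t = TypeA -> sgz p = 1).
Proof.
move=> lp; have lt_p : (`|p|%N.-1 < ambient t n)%N by move: lp; case: (t) => /=; lia.
exists (Ordinal lt_p) => /=; first by move: lp; case: (t) => /=; lia.
by move=> tA; move: lp; rewrite tA => /letter_pos /gtr0_sgz.
Qed.

Lemma letter_of_ord (j : 'I_(ambient t n)) : letter j.+1%:Z.
Proof. by case: j; case: (t) => m /=; lia. Qed.

(** In type A the shift of the coordinates of eps p is invisible on the
    apartment, where the coordinates sum to 0. *)
Lemma dot_eps_ord p (j : 'I_(ambient t n)) x : apartment x -> `|p|%N = j.+1 ->
  dot (eps p) x = (sgz p)%:~R * x 0 j.
Proof.
move=> ax pj; rewrite /eps dotZl; congr (_ * _).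
rewrite /dot (eq_bigr (fun i => (i == j)%:R * x 0 i -
   (if t is TypeA then n.+1%:R^-1 else 0) * x 0 i)) => [|i _]; last first.
  by rewrite mxE pj eqSS mulrBl.
rewrite sumrB -[X in _ - X]mulr_sumr (bigD1 j) //= eqxx mul1r big1 => [|i /negPf ne].
  rewrite addr0; move: ax; rewrite /apartment /=.
  move: (\sum_(i < _) x 0 i) (x 0 j) => S c; case: (t); rewrite ?mul0r ?subr0 //.
  by move=> ->; rewrite mulr0 subr0.
by rewrite [i == j]ne mul0r.
Qed.

Lemma apartment_eps p : letter p -> apartment (eps p).
Proof.
move=> lp; have [j pj sp] := letter_ord lp.
rewrite /apartment /=; move: j pj sp lp; rewrite /eps.
case: (t) => //= j pj /(_ erefl) -> _.
rewrite (eq_bigr (fun i : 'I_n.+1 => (i == j)%:R - n.+1%:R^-1)) => [|i _]; last first.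
  by rewrite !mxE mul1r pj eqSS.
rewrite sumrB (bigD1 j) //= eqxx big1 => [|i /negPf -> //].
rewrite sumr_const card_ord addr0 -(mulr_natr n.+1%:R^-1) mulVf ?subrr //.
by rewrite pnatr_eq0.
Qed.

(** * Roots as differences of letters *)

(** For q = - p the difference of the two vectors is 2 eps p; this is a root in
    type B, whereas its half is the root in type C. *)
Definition root_scale p q : R := if t is TypeC then
  if q == - p then 2%:R^-1 else 1 else 1.
Definition coroot_scale p q : R := if t is TypeC then 1 else
  if q == - p then 2%:R^-1 else 1.
Definition root_of p q : V := root_scale p q *: (eps p - eps q).
Definition coroot_of p q : V := coroot_scale p q *: (eps p - eps q).

Lemma sgz_mulE p r : p != 0 -> r != 0 ->
  (sgz p)%:~R * ((sgz r)%:~R * (`|r|%N == `|p|%N)%:R) =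
  (p == r)%:R - (p == - r)%:R :> R.
Proof.
move=> p0 r0; have [->|npr] := eqVneq p r.
  have -> : (r == - r) = false by lia.
  rewrite eqxx mulr1 subr0 -intrM -sgzM.
  by have /gtr0_sgz-> : 0 < r * r by nia.
have [->|npr'] := eqVneq p (- r).
  rewrite abszN eqxx mulr1 sgzN -intrM mulNr -sgzM.
  have /gtr0_sgz-> : 0 < r * r by nia.
  by rewrite sub0r.
have -> : (`|r|%N == `|p|%N) = false by lia.
by rewrite !mulr0 subrr.
Qed.

Lemma dot_epsB p q r : letter p -> letter q -> letter r ->
  dot (eps p - eps q) (eps r) =
  (p == r)%:R - (p == - r)%:R - ((q == r)%:R - (q == - r)%:R).
Proof.
move=> lp lq lr.
have [i pi sp] := letter_ord lp; have [j qj sq] := letter_ord lq.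
have ar := apartment_eps lr.
rewrite dotBl (dot_eps_ord ar pi) (dot_eps_ord ar qj) /eps !mxE -pi -qj.
rewrite -!sgz_mulE ?(letter_neq0 lp) ?(letter_neq0 lq) ?(letter_neq0 lr) //.
rewrite ![`|r|%N == _]eq_sym; move: sp sq; case: (t) => [|_ _|_ _]; rewrite ?subr0 //.
by move=> -> // -> //; ring.
Qed.

Lemma root_ofN p q : root_of q p = - root_of p q.
Proof.
rewrite /root_of /root_scale; have -> : (p == - q) = (q == - p) by lia.
by rewrite -[eps q - eps p]opprB scalerN.
Qed.

Lemma coroot_ofN p q : coroot_of q p = - coroot_of p q.
Proof.
rewrite /coroot_of /coroot_scale; have -> : (p == - q) = (q == - p) by lia.
by rewrite -[eps q - eps p]opprB scalerN.
Qed.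

Lemma root_of_opp p q : root_of (- q) (- p) = root_of p q.
Proof.
rewrite /root_of /root_scale; have -> : (- p == - - q) = (q == - p) by lia.
by rewrite !epsN opprK addrC.
Qed.

Lemma root_scale_gt0 p q : 0 < root_scale p q.
Proof. by rewrite /root_scale; case: (t) => //; case: ifP => // _; rewrite invr_gt0. Qed.

Lemma root_scale1 p q : q != - p -> root_scale p q = 1.
Proof. by move=> /negPf qp; rewrite /root_scale qp; case: (t). Qed.

Lemma root_scaleB p q : t = TypeB -> root_scale p q = 1.
Proof. by rewrite /root_scale => ->. Qed.

Lemma root_of_neg p : t <> TypeA ->
  root_of p (- p) = (if is_typeB t then 2%:R else 1) *: eps p.
Proof.
move=> tA; rewrite /root_of epsN opprK -[eps p + _]/(eps p *+ 2) -(scaler_nat 2) scalerA.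
congr (_ *: _); rewrite /root_scale eqxx; case: (t) tA => //= _; first by rewrite mul1r.
by rewrite mulVf // pnatr_eq0.
Qed.

(** The pairs of letters (i, j), (i, - j) and (i, - i) with 0 < i < j give the
    differences, the sums and the multiples of a single eps i. Up to the
    symmetry that sends (p, q) to (- q, - p) and fixes the root, these are all
    pairs of letters in increasing order. *)
Lemma pos_rootsP x : pos_roots x <->
  exists p q, [/\ letter p, letter q, letter_lt p q & x = root_of p q].
Proof.
split=> [[i [j [i0 H]]]|[p [q [lp lq]]]].
- case: H => [[ij jn ->]|[tA ij jn ->]|[tB jn ->]|[tC jn ->]].
  + exists i%:Z, j%:Z; split.
    * by move: jn; case: (t) => /=; lia.
    * by move: jn; case: (t) => /=; lia.
    * by rewrite letter_ltE; lia.
    * rewrite /root_of /root_scale.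
      have -> : (j%:Z == - i%:Z) = false by lia.
      by case: (t); rewrite scale1r.
  + exists i%:Z, (- j%:Z); split.
    * by move: tA jn; case: (t) => //=; lia.
    * by move: tA jn; case: (t) => //=; lia.
    * by rewrite letter_ltE; lia.
    * rewrite /root_of /root_scale.
      have -> : (- j%:Z == - i%:Z) = false by lia.
      by rewrite epsN opprK; case: (t); rewrite scale1r.
  + exists i%:Z, (- i%:Z); split.
    * by rewrite tB /=; lia.
    * by rewrite tB /=; lia.
    * by rewrite letter_ltE; lia.
    * by rewrite root_of_neg; rewrite tB.
  + exists i%:Z, (- i%:Z); split.
    * by rewrite tC /=; lia.
    * by rewrite tC /=; lia.
    * by rewrite letter_ltE; lia.
    * by rewrite root_of_neg; rewrite tC // scale1r.
- have p0 := letter_neq0 lp; have q0 := letter_neq0 lq.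
  wlog p_pos : p q lp lq p0 q0 / 0 < p.
    move=> W pq xE; have [p_pos|p_neg] := ltP 0 p; first exact: (W p q).
    have tA : t <> TypeA by move=> tA; move: lp; rewrite tA => /letter_pos; lia.
    apply: (W (- q) (- p)); rewrite ?letterN ?oppr_eq0 ?root_of_opp //.
      by move: pq; rewrite letter_ltE; lia.
    by move: pq; rewrite !letter_ltE; lia.
  rewrite letter_ltE => pq ->; have [q_pos|q_neg] := ltP 0 q.
    exists `|p|%N, `|q|%N; split; first lia.
    constructor 1; split; first lia.
      by move: lq; case: (t) => /=; lia.
    rewrite /root_of /root_scale !gez0_abs; try lia.
    have -> : (q == - p) = false by lia.
    by case: (t); rewrite scale1r.
  have tA : t <> TypeA by move=> tA; move: lq; rewrite tA => /letter_pos; lia.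
  have pn : (`|p| <= n)%N by move: lp tA; case: (t) => //= [|]; lia.
  have qn : (`|q| <= n)%N by move: lq tA; case: (t) => //= [|]; lia.
  have [qp|qp] := eqVneq q (- p).
    exists `|p|%N, 1%N; split; first lia.
    rewrite qp root_of_neg // gez0_abs; last lia.
    case: (typeBC tA) => tE; [constructor 3|constructor 4]; split=> //; rewrite [in is_typeB _]tE ?scale1r //.
  have r_pq : root_of p q = eps `|p|%N + eps `|q|%N.
    rewrite /root_of /root_scale (negPf qp) -epsN gez0_abs; last lia.
    rewrite lez0_abs; last lia.
    by case: (t); rewrite scale1r.
  have [lt_pq|le_qp] := ltnP `|p| `|q|.
    by exists `|p|%N, `|q|%N; split; [lia|constructor 2].
  exists `|q|%N, `|p|%N; split; [lia|constructor 2]; split=> //; first lia.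
  by rewrite addrC.
Qed.

Lemma letter_lt_total p q : p != q -> letter_lt p q || letter_lt q p.
Proof. by rewrite !letter_ltE; lia. Qed.

Lemma rootsP x : roots x <->
  exists p q, [/\ letter p, letter q, p != q & x = root_of p q].
Proof.
split=> [[] /pos_rootsP [p [q [lp lq pq xE]]]|[p [q [lp lq pq ->]]]].
- by exists p, q; split=> //; move: pq; rewrite letter_ltE; lia.
- exists q, p; split=> //; first by move: pq; rewrite letter_ltE; lia.
  by rewrite root_ofN -xE opprK.
- have [lt_pq|lt_qp] := orP (letter_lt_total pq); [left|right].
    by apply/pos_rootsP; exists p, q.
  by apply/pos_rootsP; exists q, p; split; rewrite // [RHS]root_ofN.
Qed.

Lemma dot_epsB2 p q : letter p -> letter q -> p != q ->
  dot (eps p - eps q) (eps p - eps q) = if q == - p then 4%:R else 2%:R.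
Proof.
move=> lp lq pq; rewrite dotBr !dot_epsB //.
have p0 := letter_neq0 lp; have q0 := letter_neq0 lq.
rewrite !eqxx (negPf pq) [q == p]eq_sym (negPf pq).
have -> : (p == - p) = false by lia.
have -> : (q == - q) = false by lia.
have -> : (p == - q) = (q == - p) by lia.
by case: (q == - p); rewrite /=; ring.
Qed.

Lemma reflE p q m x : letter p -> letter q -> p != q ->
  refl (root_of p q) m x = x - (dot (root_of p q) x + m%:~R) *: coroot_of p q.
Proof.
move=> lp lq pq; rewrite /refl; congr (_ - _ *: _).
rewrite {1 2}/root_of dotZl dotZr dot_epsB2 // /root_of scalerA; congr (_ *: _).
by rewrite /root_scale /coroot_scale; case: (t); case: (q == - p); field.
Qed.

Lemma dot_root_coroot p q : letter p -> letter q -> p != q ->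
  dot (root_of p q) (coroot_of p q) = 2%:R.
Proof.
move=> lp lq pq; rewrite dotZl dotZr dot_epsB2 //.
by rewrite /root_scale /coroot_scale; case: (t); case: (q == - p); field.
Qed.

Lemma refl_eps p q r : letter p -> letter q -> p != q -> letter r ->
  refl (root_of p q) 0 (eps r) = eps (swap p q r).
Proof.
move=> lp lq pq lr; rewrite reflE // addr0 dotZl dot_epsB // /coroot_of.
have p0 := letter_neq0 lp; have q0 := letter_neq0 lq; have r0 := letter_neq0 lr.
have -> : swap p q r = if p == r then q else if q == r then p else
  if p == - r then - q else if q == - r then - p else r.
  by rewrite /swap; repeat (case: ifP => ?); lia.
have sc : root_scale p q * coroot_scale p q = if q == - p then 2%:R^-1 else 1.
  by rewrite /root_scale /coroot_scale; case: (t); case: ifP; rewrite ?mulr1 ?mul1r.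
rewrite scalerA mulrAC sc.
have [pr|npr] := eqVneq p r; last have [qr|nqr] := eqVneq q r;
  last have [pr|npr'] := eqVneq p (- r); last have [qr|nqr'] := eqVneq q (- r);
  last by rewrite !subr0 mulr0 scale0r subr0.
- have -> : (p == - r) = false by lia.
  have -> : (q == r) = false by lia.
  rewrite -pr; case: eqVneq => [->|_]; rewrite ?epsN; move: (eps p) (eps q) => u v.
    by apply/rowP => j; rewrite !mxE /=; field.
  by apply/rowP => j; rewrite !mxE /=; field.
- have -> : (q == - r) = false by lia.
  have -> : (p == - r) = (r == - p) by lia.
  rewrite -qr; case: eqVneq => [->|_]; rewrite ?epsN; move: (eps p) (eps q) => u v.
    by apply/rowP => j; rewrite !mxE /=; field.
  by apply/rowP => j; rewrite !mxE /=; field.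
- have -> : (q == - p) = (q == r) by lia.
  have -> : (q == - r) = false by lia.
  have -> : r = - p by lia.
  rewrite (_ : q == - p = false); last by lia.
  rewrite !epsN; move: (eps p) (eps q) => u v.
  by apply/rowP => j; rewrite !mxE /=; field.
- have -> : (q == - p) = false by lia.
  have -> : r = - q by lia.
  rewrite !epsN; move: (eps p) (eps q) => u v.
  by apply/rowP => j; rewrite !mxE /=; field.
Qed.

(** * The Weyl group as a group of signed permutations of the letters *)

Local Notation weyl := (weyl R t n).
Local Notation rf p q := (refl (root_of p q) 0).

Lemma generated_trans (S : set (V -> V)) f g :
  generated R t n S f -> generated R t n S g -> generated R t n S (f \o g).
Proof.
by move=> Sf Sg; elim: Sf => // h k Sh _ IH; apply: (generated_comp _ _ _ _ h (k \o g)).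
Qed.

Lemma generated1 (S : set (V -> V)) f : S f -> generated R t n S f.
Proof. by move=> Sf; apply: (generated_comp _ _ _ _ f id) => //; constructor. Qed.

(** The linear map w permutes the vectors of the letters by s. Having s defined
    on all integers spares the composition side conditions; on the letters s is
    determined by w, see [acts_uniq]. *)
Record acts (w : V -> V) (s : int -> int) : Prop := Acts {
  acts_lin : forall a x y, w (a *: x + y) = a *: w x + w y;
  acts_dot : forall x y, dot (w x) (w y) = dot x y;
  acts_apartment : forall x, apartment x -> apartment (w x);
  acts_eps : forall p, letter p -> w (eps p) = eps (s p);
  acts_opp : forall p, p != 0 -> s (- p) = - s p;
  acts_letter : forall p, letter (s p) = letter p;
  acts_inj : injective s
}.

Lemma refl_root0 p q x : letter p -> letter q -> p != q ->
  rf p q x = x - dot (root_of p q) x *: coroot_of p q.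
Proof. by move=> lp lq pq; rewrite reflE // addr0. Qed.

Lemma acts_id : acts id id.
Proof. by split. Qed.

Lemma acts_comp w1 w2 s1 s2 : acts w1 s1 -> acts w2 s2 -> acts (w1 \o w2) (s1 \o s2).
Proof.
move=> A1 A2; split=> /=.
- by move=> a x y; rewrite (acts_lin A2) (acts_lin A1).
- by move=> x y; rewrite (acts_dot A1) (acts_dot A2).
- by move=> x ax; apply: (acts_apartment A1); apply: (acts_apartment A2).
- by move=> p lp; rewrite (acts_eps A2) // (acts_eps A1) // (acts_letter A2).
- move=> p p0; rewrite (acts_opp A2) // (acts_opp A1) //.
  apply/eqP => s0; have : s2 p = s2 (- p) by rewrite (acts_opp A2) // s0 oppr0.
  by move/(acts_inj A2); lia.
- by move=> p; rewrite (acts_letter A1) (acts_letter A2).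
- by move=> p q /(acts_inj A1) /(acts_inj A2).
Qed.

Lemma acts_refl p q : letter p -> letter q -> p != q -> acts (rf p q) (swap p q).
Proof.
move=> lp lq pq; have p0 := letter_neq0 lp; have q0 := letter_neq0 lq; split.
- by move=> a x y; rewrite !refl_root0 // !dotE; apply/rowP => j; rewrite !mxE; ring.
- move=> x y; rewrite !refl_root0 //.
  have := dot_root_coroot lp lq pq; rewrite /root_of /coroot_of.
  move: (eps p - eps q) (root_scale p q) (coroot_scale p q) => d k k'.
  rewrite !dotE (dotC x d) => E.
  transitivity (dot x y + (k * (k' * dot d d) - 2%:R) * k * k' * (dot d x * dot d y)); first by ring.
  by rewrite E subrr !mul0r addr0.
- move=> x ax; rewrite refl_root0 //; apply: apartmentB => //.
  by do 2 apply: apartmentZ; apply: apartmentB; apply: apartment_eps.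
- by move=> r lr; rewrite refl_eps.
- by move=> r _; rewrite swapN.
- by move=> r; rewrite letter_swap.
- exact: inv_inj (swapK p0 q0).
Qed.

Lemma acts0 w s : acts w s -> w 0 = 0.
Proof. by move=> A; have := acts_lin A (-1) 0 0; rewrite scaler0 addr0 scaleN1r addNr. Qed.

Lemma actsD w s x y : acts w s -> w (x + y) = w x + w y.
Proof. by move=> A; have := acts_lin A 1 x y; rewrite !scale1r. Qed.

Lemma actsZ w s a x : acts w s -> w (a *: x) = a *: w x.
Proof. by move=> A; have := acts_lin A a x 0; rewrite (acts0 A) !addr0. Qed.

Lemma actsN w s x : acts w s -> w (- x) = - w x.
Proof. by move=> A; rewrite -scaleN1r (actsZ _ _ A) scaleN1r. Qed.

Lemma actsB w s x y : acts w s -> w (x - y) = w x - w y.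
Proof. by move=> A; rewrite (actsD _ _ A) (actsN _ A). Qed.

Lemma acts_neq0 w s p : acts w s -> p != 0 -> s p != 0.
Proof.
move=> A p0; apply/eqP => s0; have : s p = s (- p) by rewrite (acts_opp A) // s0 oppr0.
by move/(acts_inj A); lia.
Qed.

Lemma acts_root w s p q : acts w s -> letter p -> letter q ->
  w (root_of p q) = root_of (s p) (s q).
Proof.
move=> A lp lq; rewrite /root_of (actsZ _ _ A) (actsB _ _ A) !(acts_eps A) //.
congr (_ *: _); rewrite /root_scale -(acts_opp A) ?(letter_neq0 lp) //.
by rewrite (inj_eq (acts_inj A)).
Qed.

Lemma acts_coroot w s p q : acts w s -> letter p -> letter q ->
  w (coroot_of p q) = coroot_of (s p) (s q).
Proof.
move=> A lp lq; rewrite /coroot_of (actsZ _ _ A) (actsB _ _ A) !(acts_eps A) //.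
congr (_ *: _); rewrite /coroot_scale -(acts_opp A) ?(letter_neq0 lp) //.
by rewrite (inj_eq (acts_inj A)).
Qed.

(** The reflection in w alpha is the conjugate of the reflection in alpha; here
    alpha is the root of p and q. *)
Lemma acts_conj w s p q : acts w s -> letter p -> letter q -> p != q ->
  w \o rf p q = rf (s p) (s q) \o w.
Proof.
move=> A lp lq pq; apply/funext => x /=.
rewrite !refl_root0 ?(acts_letter A) ?(inj_eq (acts_inj A)) //.
by rewrite (actsB _ _ A) (actsZ _ _ A) -(acts_root A) // (acts_dot A) (acts_coroot A).
Qed.

Lemma refl_invol p q : letter p -> letter q -> p != q -> rf p q \o rf p q = id.
Proof.
move=> lp lq pq; apply/funext => x /=; rewrite !refl_root0 //.
rewrite dotBr dotZr dot_root_coroot //.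
by move: (dot _ x) (coroot_of p q) => a u; apply/rowP => j; rewrite !mxE; ring.
Qed.

Lemma weyl_refl p q : letter p -> letter q -> p != q -> weyl (rf p q).
Proof.
move=> lp lq pq; apply: generated1; exists (root_of p q) => //.
by apply/rootsP; exists p, q.
Qed.

Lemma weyl_comp f g : weyl f -> weyl g -> weyl (f \o g).
Proof. exact: generated_trans. Qed.

Lemma weyl_acts w : weyl w -> exists s, acts w s.
Proof.
elim=> [|f g [alpha /rootsP [p [q [lp lq pq ->]]] ->] _ [s A]].
  by exists id; apply: acts_id.
by exists (swap p q \o s); apply: acts_comp => //; apply: acts_refl.
Qed.

Lemma weyl_inv w : weyl w -> exists w', [/\ weyl w', cancel w w' & cancel w' w].
Proof.
elim=> [|f g [alpha /rootsP [p [q [lp lq pq ->]]] ->] _ [g' [Wg' gK g'K]]].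
  by exists id; split=> //; constructor.
have rK x : rf p q (rf p q x) = x by have := congr1 (@^~ x) (refl_invol lp lq pq).
exists (g' \o rf p q); split=> [|x|x] /=; first by apply/weyl_comp/weyl_refl.
  by rewrite rK gK.
by rewrite g'K rK.
Qed.

Lemma eps_inj p q : letter p -> letter q -> eps p = eps q -> p = q.
Proof.
move=> lp lq pq; apply/eqP/negPn/negP => npq; have := dot_epsB lp lq lp.
have p0 := letter_neq0 lp.
rewrite pq subrr dotC dot0r eqxx [q == p]eq_sym (negPf npq).
have -> : (p == - p) = false by lia.
by rewrite subr0 sub0r opprK; apply/eqP; rewrite lt_eqF // ltr_wpDr ?ler0n ?ltr01.
Qed.

Lemma root_of_gen p q : q != - p -> root_of p q = eps p - eps q.
Proof. by move=> qp; rewrite /root_of root_scale1 // scale1r. Qed.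

Lemma reflK p q : letter p -> letter q -> p != q -> involutive (rf p q).
Proof. by move=> lp lq pq x; have := congr1 (@^~ x) (refl_invol lp lq pq). Qed.

(** * Words in the simple reflections and the Bruhat order *)

#[local] Opaque Defs.refl Defs.eps Defs.dot root_of coroot_of.

Local Notation simple_root := (simple_root R t n).
Local Notation simple_word := (simple_word R t n).
Local Notation length_lt := (length_lt R t n).
Local Notation bruhat_step := (bruhat_step R t n).
Local Notation bruhat_le := (bruhat_le R t n).

Lemma letter_lt_irr p : letter_lt p p = false.
Proof. by rewrite letter_ltE; lia. Qed.

Lemma letter_lt_neq p q : letter_lt p q -> p != q.
Proof. by rewrite letter_ltE; lia. Qed.

Lemma letter_lt_trans : transitive letter_lt.
Proof. by move=> p q r; rewrite !letter_ltE; lia. Qed.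

Lemma letter_lt_asym p q : letter_lt p q -> letter_lt q p = false.
Proof. by rewrite !letter_ltE; lia. Qed.

Lemma letter_ltN p q : p != 0 -> q != 0 -> letter_lt (- q) (- p) = letter_lt p q.
Proof. by rewrite !letter_ltE; lia. Qed.

Lemma acts_uniq w s1 s2 p : acts w s1 -> acts w s2 -> letter p -> s1 p = s2 p.
Proof.
move=> A1 A2 lp; apply: eps_inj; rewrite ?(acts_letter A1) ?(acts_letter A2) //.
by rewrite -(acts_eps A1) // (acts_eps A2).
Qed.

Lemma acts_letter_ltP w s p q : acts w s -> p != q ->
  letter_lt (s q) (s p) = ~~ letter_lt (s p) (s q).
Proof.
move=> A pq; have : s p != s q by rewrite (inj_eq (acts_inj A)).
by rewrite !letter_ltE; lia.
Qed.

(** The successor of i in the order of the letters: n is followed by n + 1 in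
    type A and by - n in types B and C. *)
Definition simple_next (i : nat) : int :=
  if (i < n)%N then i.+1%:Z else if t is TypeA then n.+1%:Z else - n%:Z.

Lemma simple_rootE i : (0 < i <= n)%N ->
  [/\ letter i, letter (simple_next i), letter_lt i (simple_next i) &
      simple_root i = root_of i (simple_next i)].
Proof.
move=> /andP[i0 le_in]; rewrite /simple_root /simple_next.
have li : letter i by case: (t) => /=; lia.
have [lt_in|ge_in] := ltnP i n.
  split=> //; first by case: (t) => /=; lia.
    by rewrite letter_ltE; lia.
  by rewrite root_of_gen //; lia.
have -> : i = n by lia.
have [tA|tA] := typeA_dec t.
  have mE (T : Type) (a b c : T) :
    match t with TypeA => a | TypeB => b | TypeC => c end = a by rewrite tA.
  rewrite !mE; split; [by rewrite tA /=; lia|by rewrite tA /=; lia|by rewrite letter_ltE; lia|].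
  by rewrite root_of_gen //; lia.
have mE (T : Type) (a b : T) :
  match t with TypeA => a | TypeB => b | TypeC => b end = b by case: (t) tA.
rewrite !mE root_of_neg //; split; [by move: tA; case: (t) => //=; lia| |by rewrite letter_ltE; lia|].
  by move: tA; case: (t) => //=; lia.
have mC (T : Type) (a b c : T) : match t with TypeA => a | TypeB => b | TypeC => c end =
  if is_typeB t then b else c by case: (t) tA.
by rewrite mC; case: (is_typeB t); rewrite ?scale1r.
Qed.

(** The pairs of letters that a simple reflection reverses are the one that it
    exchanges and the opposite one. *)
Lemma swap_simple i (x y : int) : (0 < i <= n)%N -> letter x -> letter y -> letter_lt x y ->
  letter_lt (swap i (simple_next i) y) (swap i (simple_next i) x) ->
  rf x y = rf i (simple_next i).
Proof.
move=> /andP[i0 le_in] lx ly xy.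
have : simple_next i = i.+1%:Z \/ [/\ i = n, t <> TypeA & simple_next i = - n%:Z].
  rewrite /simple_next; case: ltnP => [_|ge_in]; first by left.
  have -> : i = n by lia.
  by case: (t) => //=; [left|right|right].
case=> [->|[iE tA ->]] H.
  have [[-> ->//]|[-> ->]] : x = i /\ y = i.+1 \/ x = - (i.+1%:Z) /\ y = - i%:Z.
    by move: xy H; rewrite /swap !letter_ltE; repeat (case: ifP => ?); lia.
  by rewrite root_of_opp.
have xn : (0 < `|x| <= n)%N by move: lx tA; case: (t).
have yn : (0 < `|y| <= n)%N by move: ly tA; case: (t).
suff [-> ->] : x = i /\ y = - n%:Z by [].
by move: xy H; rewrite /swap !letter_ltE; repeat (case: ifP => ?); lia.
Qed.

Lemma simple_weyl k w : simple_word k w -> weyl w.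
Proof.
elim=> [|{}k i {}w /simple_rootE [lp lq pq ->] _ Ww]; first by constructor.
by apply: weyl_comp => //; apply: weyl_refl => //; apply: letter_lt_neq.
Qed.

(** The strong exchange condition. The simple reflections of a word for w are
    applied one after the other to the letters p < q; one of them is the first
    to reverse the images of p and q. By [swap_simple] it is the reflection that
    exchanges these images, hence conjugate to that in p and q, and it can be
    left out of the word. *)
Lemma exchange_word k w s p q : simple_word k w -> acts w s ->
  letter p -> letter q -> letter_lt p q -> letter_lt (s q) (s p) ->
  exists2 l, (l < k)%N & simple_word l (w \o rf p q).
Proof.
move=> word; elim: word s => [|{}k i {}w i_n word IH] s A lp lq pq.
  by rewrite -!(acts_uniq acts_id A) // letter_lt_asym.
have [s' A'] := weyl_acts (simple_weyl word).
have [li ln' lin iE] := simple_rootE i_n.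
rewrite iE in A *.
have A2 := acts_comp (acts_refl li ln' (letter_lt_neq lin)) A'.
rewrite !(acts_uniq A A2) //=.
have [lt_s|] := boolP (letter_lt (s' q) (s' p)).
  have [l lk wl] := IH _ A' lp lq pq lt_s => _.
  by exists l.+1; rewrite // -iE; apply: (simple_word_comp _ _ _ _ _ (w \o rf p q)).
rewrite (acts_letter_ltP A') ?(letter_lt_neq pq) // negbK => lt_s H.
exists k => //.
have := swap_simple i_n _ _ lt_s H; rewrite !(acts_letter A') => /(_ lp lq) rE.
have lsp : letter (s' p) by rewrite (acts_letter A').
have lsq : letter (s' q) by rewrite (acts_letter A').
rewrite -rE -compA (acts_conj A' lp lq (letter_lt_neq pq)) compA.
by rewrite (refl_invol lsp lsq (letter_lt_neq lt_s)).
Qed.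

Lemma simple_comp k l f g : simple_word k f -> simple_word l g ->
  exists m, simple_word m (f \o g).
Proof.
move=> wf wg; elim: wf => [|{}k i {}f i_n _ [m IH]]; first by exists l.
by exists m.+1; apply: (simple_word_comp _ _ _ _ _ (f \o g)).
Qed.

Definition has_word w := exists k, simple_word k w.

Lemma has_word_comp f g : has_word f -> has_word g -> has_word (f \o g).
Proof. by move=> [k wf] [l wg]; apply: simple_comp wf wg. Qed.

Lemma has_word_simple i : (0 < i <= n)%N -> has_word (rf i (simple_next i)).
Proof.
move=> i_n; have [_ _ _ <-] := simple_rootE i_n; exists 1%N.
by apply: (simple_word_comp _ _ _ _ _ id) => //; constructor.
Qed.

Lemma rf_conj p q (x y : int) : letter p -> letter q -> p != q -> letter x -> letter y -> x != y ->
  rf (swap p q x) (swap p q y) = rf p q \o rf x y \o rf p q.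
Proof.
move=> lp lq pq lx ly xy.
apply/funext => z; have /= E := congr1 (@^~ (rf p q z)) (acts_conj (acts_refl lp lq pq) lx ly xy).
by rewrite /= E (reflK lp lq pq).
Qed.

Lemma has_word_conj p q (x y : int) : letter p -> letter q -> p != q -> letter x -> letter y -> x != y ->
  has_word (rf p q) -> has_word (rf x y) -> has_word (rf (swap p q x) (swap p q y)).
Proof. by move=> lp lq pq lx ly xy Hp Hx; rewrite (rf_conj lp lq pq lx ly xy); exact: has_word_comp (has_word_comp Hp Hx) Hp. Qed.

Lemma refl_root_sym p q : letter p -> letter q -> p != q -> rf q p = rf p q.
Proof.
move=> lp lq pq; have qp : q != p by rewrite eq_sym.
apply/funext => x; rewrite (refl_root0 _ lp lq pq) (refl_root0 _ lq lp qp).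
by rewrite root_ofN coroot_ofN dotNl scaleNr scalerN opprK.
Qed.

Lemma has_word_pos (i j : nat) : (0 < i < j)%N -> letter j -> has_word (rf i j).
Proof.
move=> /andP[i0]; elim: j => // j IH; rewrite ltnS leq_eqVlt => /orP[/eqP <-|ij] lj.
  have i_n : (0 < i <= n)%N by move: lj; case: (t) => /=; lia.
  suff <- : simple_next i = i.+1%:Z by apply: has_word_simple.
  rewrite /simple_next; case: ltnP => // ge_in.
  by move: lj; case: (t) => /=; lia.
have lj' : letter j by move: lj; case: (t) => /=; lia.
have li : letter i by move: lj; case: (t) => /=; lia.
have j_n : (0 < j <= n)%N by move: lj; case: (t) => /=; lia.
have nj : simple_next j = j.+1%:Z.
  rewrite /simple_next; case: ltnP => // ge_in.
  by move: lj; case: (t) => /=; lia.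
have := @has_word_conj j j.+1%:Z i j lj' lj _ li lj' _ _ (IH ij lj').
have -> : swap j j.+1%:Z i = i by rewrite /swap; repeat (case: ifP => ?); lia.
have -> : swap j j.+1%:Z j = j.+1%:Z by rewrite /swap; repeat (case: ifP => ?); lia.
by apply; [lia|lia|rewrite -nj; apply: has_word_simple].
Qed.

Lemma has_word_neg (i : nat) : t <> TypeA -> letter i -> has_word (rf i (- i%:Z)).
Proof.
move=> tA li; have i_n : (0 < i <= n)%N by move: li tA; case: (t).
have ln : letter n by move: li tA; case: (t) => //=; lia.
have Hn : has_word (rf n (- n%:Z)).
  have <- : simple_next n = - n%:Z by rewrite /simple_next ltnn; case: (t) tA.
  by apply: has_word_simple; lia.
have [->//|in_] := eqVneq i n.
have iltn : (0 < i < n)%N by lia.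
have Hin := has_word_pos iltn ln.
have := @has_word_conj i n n (- n%:Z) li ln _ ln _ _ Hin Hn.
have -> : swap i n n = i by rewrite /swap; repeat (case: ifP => ?); lia.
have -> : swap i n (- n%:Z) = - i%:Z by rewrite /swap; repeat (case: ifP => ?); lia.
by apply; rewrite ?letterN //; lia.
Qed.

Lemma has_word_refl p q : letter p -> letter q -> p != q -> has_word (rf p q).
Proof.
wlog lt_pq : p q / letter_lt p q.
  move=> W lp lq pq; case/orP: (letter_lt_total pq) => lt_pq; first exact: W.
  have qp : q != p by rewrite eq_sym.
  by rewrite (refl_root_sym lq lp qp); exact: W.
wlog p0 : p q lt_pq / 0 < p.
  move=> W lp lq pq; have [|p0] := ltP 0 p; first by move=> p0; apply: W.
  have tA : t <> TypeA by move=> tA; move: lp; rewrite tA => /letter_pos; lia.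
  rewrite -root_of_opp; apply: W; rewrite ?letterN ?letter_ltN ?letter_neq0 //.
  - exact: letter_neq0 lp.
  - exact: letter_neq0 lq.
  - by move: lt_pq; rewrite letter_ltE; have := letter_neq0 lq; lia.
  - by move: pq; lia.
move=> lp lq pq; have [q0|q0] := ltP 0 q.
  have pE : p = `|p|%N by lia.
  have qE : q = `|q|%N by lia.
  rewrite pE qE; apply: has_word_pos; last by rewrite -qE.
  by move: lt_pq; rewrite letter_ltE; lia.
have tA : t <> TypeA by move=> tA; move: lq; rewrite tA => /letter_pos; lia.
have [qp|qp] := eqVneq q (- p).
  have pE : p = `|p|%N by lia.
  by rewrite qp pE; apply: has_word_neg => //; rewrite -pE.
have lq' : letter (- q) by rewrite letterN.
have q00 := letter_neq0 lq.
have HP : has_word (rf p (- q)).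
  have pE : p = `|p|%N by lia.
  have qE : - q = `|- q|%N by lia.
  have [lt|] := ltnP `|p| `|- q|.
    by rewrite pE qE; apply: has_word_pos; rewrite -?qE //; lia.
  move=> ge; rewrite -refl_root_sym //; last by move: qp; lia.
  by rewrite pE qE; apply: has_word_pos; rewrite -?pE //; move: qp; lia.
have HN : has_word (rf (- q) (- - q)).
  have qE : - q = `|- q|%N by lia.
  by rewrite qE; apply: has_word_neg; rewrite -?qE.
have := @has_word_conj (- q) (- - q) p (- q) lq' _ _ lp lq' _ HN HP.
have -> : swap (- q) (- - q) p = p by rewrite /swap; repeat (case: ifP => ?); lia.
have -> : swap (- q) (- - q) (- q) = q by rewrite /swap; repeat (case: ifP => ?); lia.
by apply; rewrite ?opprK //; lia.
Qed.

(** Lengths are compared by means of words, so that an element without a word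
    would count as longer than any other. Words for all reflections are obtained
    from the simple ones by conjugation. *)
Lemma weyl_has_word w : weyl w -> has_word w.
Proof.
elim=> [|f g [alpha /rootsP [p [q [lp lq pq ->]]] ->] _ Hg].
  by exists 0%N; constructor.
by apply: has_word_comp Hg; apply: has_word_refl.
Qed.

(** The exchange condition cuts any word for the product down to a shorter word
    for u. *)
Lemma bruhat_step_up u s p q : weyl u -> acts u s -> letter p -> letter q ->
  letter_lt p q -> letter_lt (s p) (s q) -> bruhat_step u (u \o rf p q).
Proof.
move=> Wu Au lp lq pq spq; have npq := letter_lt_neq pq.
exists (root_of p q); split; [by apply/rootsP; exists p, q|exact: erefl|].
have [k [wk k_min]] : exists k, simple_word k u /\ forall l, simple_word l u -> (k <= l)%N.
  have ex : exists k, `[< simple_word k u >].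
    by have [k wk] := weyl_has_word Wu; exists k; apply/asboolP.
  exists (ex_minn ex); case: ex_minnP => k /asboolP wk k_min; split=> // l wl.
  by apply: k_min; apply/asboolP.
exists k => // l wl.
have A := acts_comp Au (acts_refl lp lq npq).
have [|m ml wm] := exchange_word wl A lp lq pq.
  have p0 := letter_neq0 lp; have q0 := letter_neq0 lq.
  by rewrite /= /swap !eqxx eq_sym (negPf npq).
apply: leq_ltn_trans ml; apply: k_min.
suff <- : (u \o rf p q) \o rf p q = u by [].
by apply/funext => x /=; rewrite (reflK lp lq npq).
Qed.

Lemma bruhat_step_down u w s p q : weyl u -> acts u s -> letter p -> letter q ->
  letter_lt p q -> w = u \o rf p q -> length_lt u w -> letter_lt (s p) (s q).
Proof.
move=> Wu Au lp lq pq wE [k wk kl]; rewrite -[letter_lt _ _]negbK.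
rewrite -(acts_letter_ltP Au) ?letter_lt_neq //; apply/negP => H.
have [l lk wl] := exchange_word wk Au lp lq pq H.
have := kl l; rewrite wE => /(_ wl); lia.
Qed.

(** By the exchange condition the comparison of lengths amounts to the
    comparison of the images of the two letters. *)
Lemma bruhat_stepP u w s : weyl u -> acts u s -> bruhat_step u w ->
  exists p q, [/\ letter p, letter q, letter_lt p q, letter_lt (s p) (s q) & w = u \o rf p q].
Proof.
move=> Wu Au [alpha [/rootsP [p [q [lp lq npq ->]]] wE lt_uw]].
have [pq|qp] := orP (letter_lt_total npq).
  by exists p, q; split=> //; apply: (bruhat_step_down Wu Au lp lq pq wE).
move: wE; rewrite -(refl_root_sym lp lq npq) => wE.
by exists q, p; split=> //; apply: (bruhat_step_down Wu Au lq lp qp wE).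
Qed.

(** * What the Bruhat order says about initial segments *)

Definition images (s : int -> int) (k : nat) : seq int := [seq s j%:Z | j <- iota 1 k].

Lemma letter_nat (j k : nat) : j \in iota 1 k -> (k <= n)%N -> letter j.
Proof. by rewrite mem_iota; case: (t) => /=; lia. Qed.

Lemma images_eq w s1 s2 k : acts w s1 -> acts w s2 -> (k <= n)%N -> images s1 k = images s2 k.
Proof.
by move=> A1 A2 kn; apply/eq_in_map => j /letter_nat /(_ kn); apply: acts_uniq A1 A2.
Qed.

Lemma perm_swap_iota p q (k : nat) : 0 < p <= k%:Z -> 0 < q <= k%:Z ->
  perm_eq [seq swap p q j%:Z | j <- iota 1 k] [seq j%:Z | j <- iota 1 k].
Proof.
move=> pk qk; have p0 : p != 0 by lia.
have q0 : q != 0 by lia.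
have inj : injective (fun j : nat => swap p q j%:Z).
  by move=> i j /(inv_inj (swapK p0 q0)) [].
have mem j : (j \in iota 1 k) = (0 < j <= k)%N by rewrite mem_iota; lia.
apply: uniq_perm.
- by rewrite (map_inj_uniq inj) iota_uniq.
- by rewrite map_inj_uniq ?iota_uniq // => i j [].
have sub : {subset [seq swap p q j%:Z | j <- iota 1 k] <= [seq j%:Z | j <- iota 1 k]}.
  move=> x /mapP [j]; rewrite mem => jk ->; apply/mapP; exists `|swap p q j%:Z|%N.
    by rewrite mem /swap; repeat (case: ifP => ?); lia.
  by rewrite /swap; repeat (case: ifP => ?); lia.
move=> x; apply/idP/idP => [/sub //|/mapP [j jk ->]].
have /sub/mapP [i ik iE] : swap p q j%:Z \in [seq swap p q j%:Z | j <- iota 1 k] by apply: map_f.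
by apply/mapP; exists i; rewrite // -iE swapK.
Qed.

Lemma letter_le_trans : transitive letter_le.
Proof. by move=> p q r; rewrite /letter_le !letter_ltE; lia. Qed.

(** The reflection in the letters p < q gives p the larger one of their two
    images. If 1, ..., k contain both letters, or both opposite ones, the set of
    the images of 1, ..., k does not change; otherwise each image stays or
    grows. *)
Lemma bruhat_step_count u w s s' k (z : int) : weyl u -> acts u s -> acts w s' ->
  bruhat_step u w -> (k <= n)%N ->
  (count (letter_le^~ z) (images s' k) <= count (letter_le^~ z) (images s k))%N.
Proof.
move=> Wu Au Aw /(bruhat_stepP Wu Au) [p [q [lp lq pq spq wE]]] kn.
have p0 := letter_neq0 lp; have q0 := letter_neq0 lq.
have npq := letter_lt_neq pq.
have A' := acts_comp Au (acts_refl lp lq npq); rewrite -wE in A'.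
rewrite (images_eq Aw A' kn).
have both (x y : int) : 0 < x <= k%:Z -> 0 < y <= k%:Z ->
    count (letter_le^~ z) (images (s \o swap x y) k) = count (letter_le^~ z) (images s k).
  move=> xk yk; rewrite /images (map_comp s (fun j : nat => j%:Z)).
  rewrite (eq_map (g := s \o (fun j : nat => swap x y j%:Z))) // (map_comp s (fun j : nat => swap x y j%:Z)).
  by apply/permP/perm_map/perm_swap_iota.
have [/andP[pk qk]|nboth] := boolP ((0 < p <= k%:Z) && (0 < q <= k%:Z)).
  by rewrite both.
have [/andP[pk qk]|nboth'] := boolP ((0 < - p <= k%:Z) && (0 < - q <= k%:Z)).
  rewrite -(both (- p) (- q) pk qk) /images leq_eqVlt; apply/orP; left; apply/eqP.
  congr (count _ _); apply: eq_map => j /=.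
  by congr s; rewrite /swap !opprK; repeat (case: ifP => ?); lia.
rewrite /images !count_map; apply: sub_in_count => j jk /=.
rewrite mem_iota in jk.
apply: letter_le_trans.
have spN := acts_opp Au p0; have sqN := acts_opp Au q0.
have sp0 := acts_neq0 Au p0; have sq0 := acts_neq0 Au q0.
move: spq; rewrite /letter_le !letter_ltE.
have [jp|jp] := eqVneq j%:Z p.
  by rewrite jp /swap eqxx; lia.
have [jp'|jp'] := eqVneq j%:Z (- p).
  have -> : swap p q j = - q by rewrite /swap; repeat (case: ifP => ?); lia.
  by move: pq; rewrite letter_ltE jp' spN sqN; lia.
have [jq|jq] := eqVneq j%:Z q.
  by move: pq; rewrite letter_ltE; lia.
have [jq'|jq'] := eqVneq j%:Z (- q).
  have -> : swap p q j = - p by rewrite /swap; repeat (case: ifP => ?); lia.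
  by rewrite jq' spN sqN; lia.
have -> : swap p q j = j by rewrite /swap; repeat (case: ifP => ?); lia.
by lia.
Qed.

Lemma bruhat_step_weyl u w : weyl u -> bruhat_step u w -> weyl w.
Proof.
move=> Wu [alpha [ra -> _]]; apply: weyl_comp => //.
by apply: generated1; exists alpha.
Qed.

(** The necessary half of the tableau criterion for the Bruhat order. *)
Lemma bruhat_le_count u w : weyl u -> bruhat_le u w ->
  weyl w /\ forall s s' k (z : int), acts u s -> acts w s' -> (k <= n)%N ->
  (count (letter_le^~ z) (images s' k) <= count (letter_le^~ z) (images s k))%N.
Proof.
move=> Wu le_uw; elim: le_uw Wu => {u w}[u w uw|u|u v w _ IH1 _ IH2] Wu.
- split; first exact: bruhat_step_weyl uw.
  by move=> s s' k z Au Aw kn; apply: bruhat_step_count uw kn.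
- by split=> // s s' k z A1 A2 kn; rewrite (images_eq A1 A2).
- have [Wv H1] := IH1 Wu; have [Ww H2] := IH2 Wv; split=> //.
  have [sv Av] := weyl_acts Wv.
  by move=> s s' k z As As' kn; apply: leq_trans (H2 sv s' k z Av As' kn) (H1 s sv k z As Av kn).
Qed.

(** * Lifting a column in the Bruhat order *)

(** The value x is taken by s at a letter b. Since x lies strictly between the
    values at i and at i + 1, ..., k, while those at 1, ..., i - 1 are below s
    i, this letter comes after i and is none of 1, ..., k. So swapping i and b
    goes up in the Bruhat order. *)
Lemma move_letter u s k i (x : int) : weyl u -> acts u s -> (k <= n)%N ->
  (0 < i <= k)%N -> letter x -> letter_lt (s i) x ->
  (forall j : nat, (0 < j < i)%N -> letter_lt (s j) (s i)) ->
  (forall j : nat, (i < j <= k)%N -> letter_lt x (s j)) ->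
  exists w s', [/\ bruhat_step u w, weyl w, acts w s' &
    forall j : nat, (0 < j <= k)%N ->
      s' j = if j == i then x else if s j == - x then - s i else s j].
Proof.
move=> Wu Au kn ik lx ltx below above.
have [u' [Wu' uK u'K]] := weyl_inv Wu; have [r Ar] := weyl_acts Wu'.
have srK (y : int) : letter y -> s (r y) = y.
  have A := acts_comp Au Ar; have E : u \o u' = id by apply/funext => v /=; rewrite u'K.
  by rewrite E in A => ly; rewrite -[RHS](acts_uniq A acts_id ly).
set b := r x; have sb : s b = x by apply: srK.
have lb : letter b by rewrite /b (acts_letter Ar).
have li : letter i by apply: (letter_nat (k := k)); rewrite // mem_iota; lia.
have i0 := letter_neq0 li; have b0 := letter_neq0 lb.
have nb (j : nat) : (0 < j <= k)%N -> b != j%:Z.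
  move=> jk; apply/eqP => bj; have := sb; rewrite bj => sjx.
  have [ij|ji|ij] := ltngtP i j.
  - have ijk : (i < j <= k)%N by lia.
    by have := above j ijk; rewrite sjx letter_lt_irr.
  - have j0i : (0 < j < i)%N by lia.
    by have := below j j0i; rewrite sjx (letter_lt_asym ltx).
  - by move: ltx; rewrite ij sjx letter_lt_irr.
have ib : letter_lt i b.
  rewrite letter_ltE; have := nb `|b|%N; lia.
have nib := letter_lt_neq ib.
exists (u \o rf i b), (s \o swap i b); split.
- by apply: (bruhat_step_up Wu Au li lb ib); rewrite sb.
- by apply: weyl_comp => //; apply: weyl_refl.
- by apply: acts_comp => //; apply: acts_refl.
- move=> j jk /=; have [->|ji] := eqVneq j i; first by rewrite /swap eqxx.
  have -> : (s j == - x) = (j%:Z == - b).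
    by rewrite -sb -(acts_opp Au) // (inj_eq (acts_inj Au)).
  rewrite -(acts_opp Au) //; have := nb j jk => bj; case: ifP => jb.
    have -> // : swap i b j = - i%:Z by rewrite /swap; repeat (case: ifP => ?); lia.
  have -> // : swap i b j = j by rewrite /swap; repeat (case: ifP => ?); lia.
Qed.

(** The values of s after the swap in [move_letter]: a row that held - x
    receives - s i. *)
Definition moved (s : nat -> int) (i : nat) (x : int) (j : nat) : int :=
  if j == i then x else if s j == - x then - s i else s j.

Definition column_below (k : nat) (s c : nat -> int) :=
  (forall i j, (0 < i)%N -> (i < j <= k)%N -> letter_lt (s i) (s j)) /\
  (forall i, (0 < i <= k)%N -> letter_le (s i) (c i)).

Lemma simple_move k (s c : nat -> int) i (x : int) :
  (forall i j, (0 < i)%N -> (i < j <= k)%N -> letter_lt (c i) (c j)) ->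
  column_below k s c -> (0 < i <= k)%N ->
  (forall j, (i < j <= k)%N -> s j = c j) ->
  letter_lt (s i) x -> letter_le x (c i) ->
  (forall j, (0 < j <= k)%N -> j != i -> s j != - x) ->
  column_below k (moved s i x) c.
Proof.
move=> Hc [Hs le_sc] ik tail sx xc simple.
have mE j : (0 < j <= k)%N -> moved s i x j = if j == i then x else s j.
  move=> jk; rewrite /moved; case: eqP => // /eqP ji.
  by rewrite (negPf (simple j jk ji)).
split=> [a b a0 ab|j jk].
  rewrite !mE; [|lia|lia].
  have [ai|ai] := eqVneq a i; have [bi|bi] := eqVneq b i.
  - lia.
  - subst a; rewrite tail //; have := Hc i b a0 ab.
    by move: xc; rewrite /letter_le !letter_ltE; lia.
  - by subst b; apply: letter_lt_trans sx; apply: Hs.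
  - exact: Hs.
by rewrite mE //; case: eqP => [->//|_]; apply: le_sc.
Qed.

(** The entry s i, in the last row that is not yet correct, can be raised to
    some x. The choice x = c i works, unless some row j < i holds - c i, which
    would become - s i. In this case c i is barred. If s i is not barred, x =
    - s i works, as it changes no other row. Otherwise any m strictly between
    - c i and - s i that is not an entry gives x = - m; and if all of these are
    entries, x = s i + 1 works, which turns the entry - s i - 1 into - s i. *)
Lemma move_exists k (s c : nat -> int) i :
  (forall i j, (0 < i)%N -> (i < j <= k)%N -> letter_lt (c i) (c j)) ->
  (forall i j, (0 < i <= k)%N -> (0 < j <= k)%N -> c i != - c j) ->
  (forall i, (0 < i <= k)%N -> letter (c i) && letter (s i)) ->
  (forall i j, (0 < i <= k)%N -> (0 < j <= k)%N -> s i != - s j) ->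
  column_below k s c -> (0 < i <= k)%N ->
  (forall j, (i < j <= k)%N -> s j = c j) -> s i != c i ->
  exists x : int, [/\ letter x, letter_lt (s i) x, letter_le x (c i) &
                column_below k (moved s i x) c].
Proof.
move=> Hc nc lett ns below ik tail neq; have [Hs le_sc] := below.
have lt_ic : letter_lt (s i) (c i).
  by move: (le_sc i ik); rewrite /letter_le (negPf neq).
have smv := simple_move Hc below ik tail.
have /andP[lci lsi] := lett i ik.
have [/existsP [jo /andP[/andP[j0 ji] /eqP sj]]|/existsPn no] := boolP [exists j : 'I_k.+1,
    (0 < j)%N && (nat_of_ord j != i) && (s j == - c i)]; last first.
  exists (c i); split; rewrite // /letter_le ?eqxx //; apply: smv; rewrite // /letter_le ?eqxx //.
  move=> j jk ji; apply/eqP => sj; have jk' : (j < k.+1)%N by lia.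
  by have := no (Ordinal jk'); rewrite /= ji sj eqxx; lia.
have jk : (0 < jo <= k)%N by case: jo j0 {ji sj} => /=; lia.
move: (nat_of_ord jo) jk ji sj => {jo j0} jb jk ji sj.
have jlt : (jb < i)%N.
  case: (ltngtP jb i) ji => // ij _; have ijk : (i < jb <= k)%N by lia.
  by have := nc jb i jk ik; rewrite -(tail jb ijk) sj eqxx.
have ltj : letter_lt (s jb) (s i) by apply: Hs; lia.
have cneg : c i < 0 by move: ltj lt_ic; rewrite sj !letter_ltE; lia.
have tA : t <> TypeA by move=> tA; move: lci; rewrite tA => /letter_pos; lia.
have lettN m : letter m -> letter (- m) by rewrite letterN.
have si0 := letter_neq0 lsi.
have [q0|q0] := ltP 0 (s i).
  exists (- s i); split; rewrite ?lettN //.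
  - by rewrite letter_ltE; lia.
  - by move: ltj lt_ic; rewrite sj /letter_le !letter_ltE; lia.
  apply: smv; first by rewrite letter_ltE; lia.
    by move: ltj lt_ic; rewrite sj /letter_le !letter_ltE; lia.
  move=> j jk' ji'; rewrite opprK; apply/eqP => E.
  have [ij|ij|ij] := ltngtP i j; last by move: ji'; lia.
    by have := Hs i j; rewrite E letter_lt_irr; move=> /(_ ltac:(lia) ltac:(lia)).
  by have := Hs j i; rewrite E letter_lt_irr; move=> /(_ ltac:(lia) ltac:(lia)).
have lett_le (m : int) : 0 < m <= - s i -> letter m.
  by move: lsi tA; case: (t) => //= H _; lia.
have [[m [pm mr nm]]|all_m] : (exists m : int, [/\ - c i < m, m < - s i &
    forall j, (0 < j <= k)%N -> s j != m]) \/
   (forall m : int, - c i < m -> m < - s i -> exists2 j, (0 < j <= k)%N & s j = m).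
  case: (pselect (exists m : int, [/\ - c i < m, m < - s i &
    forall j, (0 < j <= k)%N -> s j != m])) => [|no]; [by left|right=> m m1 m2].
  case: (pselect (exists2 j, (0 < j <= k)%N & s j = m)) => // nj.
  case: no; exists m; split=> // j jk'; apply/eqP => E; apply: nj; by exists j.
  exists (- m); split.
  - by apply/lettN/lett_le; lia.
  - by rewrite letter_ltE; lia.
  - by rewrite /letter_le letter_ltE; lia.
  apply: smv; [by rewrite letter_ltE; lia|by rewrite /letter_le letter_ltE; lia|].
  by move=> j jk' _; rewrite opprK; apply: nm.
(* All of - c i, ..., - s i - 1 are values of s.  Going up along them shows that
   the row holding - s i - 1 has room for - s i. *)
have pr : - c i < - s i by move: lt_ic; rewrite letter_ltE; lia.
have up (d : nat) (m : int) j : m = - c i + d%:Z -> m < - s i -> (0 < j <= k)%N ->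
    s j = m -> letter_lt m (c j).
  elim: d m j => [|d IH] m j mE mlt jk' sjm.
    have := le_sc j jk'; rewrite sjm /letter_le => /orP[/eqP cj|//].
    by have := nc j i jk' ik; rewrite -cj mE addr0 eqxx.
  have [j' jk'' sj'] : exists2 j', (0 < j' <= k)%N & s j' = m - 1.
    have [d0|d0] := posnP d; first by exists jb => //; rewrite sj; lia.
    by apply: all_m; lia.
  have jj' : (j' < j)%N.
    case: (ltngtP j j') => // [lt|E]; last by move: sjm; rewrite E sj'; lia.
    by have := Hs j j'; rewrite sjm sj' letter_ltE => /(_ ltac:(lia) ltac:(lia)); lia.
  have := IH (m - 1) j' _ _ jk'' sj'; have := Hc j' j; rewrite !letter_ltE.
  by move=> /(_ ltac:(lia) ltac:(lia)) + /(_ ltac:(lia) ltac:(lia)); lia.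
have [j0 j0k sj0] : exists2 j, (0 < j <= k)%N & s j = - s i - 1.
  have [E|NE] := eqVneq (- s i - 1) (- c i); first by exists jb; rewrite // E.
  by apply: all_m; lia.
have up0 : letter_lt (- s i - 1) (c j0).
  have [d dE] : exists d : nat, - s i - 1 = - c i + d%:Z.
    by exists `|(c i - s i - 1)%R|%N; lia.
  by apply: (up d _ j0 dE _ j0k sj0); lia.
have j0i : (j0 < i)%N.
  case: (ltngtP j0 i) => // [lt|E]; last by move: sj0; rewrite E; lia.
  by have := Hs i j0; rewrite sj0 letter_ltE => /(_ ltac:(lia) ltac:(lia)); lia.
exists (s i + 1); split.
- by rewrite -[s i + 1]opprK; apply/lettN/lett_le; lia.
- by rewrite letter_ltE; lia.
- by rewrite /letter_le letter_ltE; lia.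
have mE j : (0 < j <= k)%N -> moved s i (s i + 1) j =
    if j == i then s i + 1 else if j == j0 then - s i else s j.
  move=> jk'; rewrite /moved; case: (j == i) => //.
  have -> : (s j == - (s i + 1)) = (j == j0).
    apply/eqP/eqP => [E|->]; last by rewrite sj0; lia.
    case: (ltngtP j j0) => // lt.
      by have := Hs j j0; rewrite sj0 E letter_ltE => /(_ ltac:(lia) ltac:(lia)); lia.
    by have := Hs j0 j; rewrite sj0 E letter_ltE => /(_ ltac:(lia) ltac:(lia)); lia.
  by [].
split=> [a b a0 ab|j jk'].
  rewrite !mE; [|lia|lia].
  have Hab := Hs a b a0 ab; have nsa := ns a i _ ik; have nsb := ns b i _ ik.
  have {}nsa := nsa ltac:(lia); have {}nsb := nsb ltac:(lia).
  have [ai|ai] := eqVneq a i; have [bi|bi] := eqVneq b i.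
  - lia.
  - subst a; have -> : (b == j0) = false by lia.
    have := tail b ab; have := Hc i b a0 ab; rewrite !letter_ltE; move: Hab; rewrite !letter_ltE; lia.
  - subst b; case: eqP => [E|_].
      by rewrite letter_ltE; lia.
    by move: Hab; rewrite !letter_ltE; lia.
  - have [aj|aj] := eqVneq a j0; have [bj|bj] := eqVneq b j0.
    + lia.
    + by subst a; move: Hab; rewrite sj0 !letter_ltE; lia.
    + by subst b; move: Hab; rewrite sj0 !letter_ltE; lia.
    + exact: Hab.
rewrite mE //; case: eqP => [->|_]; first by rewrite /letter_le letter_ltE; lia.
case: eqP => [->|_]; last exact: le_sc.
by move: up0; rewrite /letter_le !letter_ltE; lia.
Qed.

(** A numbering of the letters in increasing order, with gaps between the two
    kinds of letters. *)
Definition rank (p : int) : nat := if 0 < p then `|p|%N else (2 * n + 4 - `|p|)%N.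

Lemma rank_lt p q : letter p -> letter q -> letter_lt p q -> (rank p < rank q < 2 * n + 4)%N.
Proof.
by rewrite letter_ltE /rank; case: (t) => /=; case: (ltP 0 p); case: (ltP 0 q); lia.
Qed.

(** The rows are corrected from the last one upwards, by steps that go up in the
    Bruhat order and raise the values of s; the ranks of the values bound the
    number of steps. *)
Lemma bruhat_lift u s k (c : nat -> int) : weyl u -> acts u s -> (k <= n)%N ->
  (forall i j, (0 < i)%N -> (i < j <= k)%N -> letter_lt (c i) (c j)) ->
  (forall i j, (0 < i <= k)%N -> (0 < j <= k)%N -> c i != - c j) ->
  (forall i, (0 < i <= k)%N -> letter (c i)) ->
  column_below k (fun j : nat => s j) c ->
  exists w s', [/\ weyl w, acts w s', bruhat_le u w &
    forall j : nat, (0 < j <= k)%N -> s' j = c j].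
Proof.
move=> Wu Au kn Hc nc lc.
have [m] := ubnP (\sum_(j <- iota 1 k) (2 * n + 4 - rank (s j%:Z)))%N.
elim: m => // m IH in u s Wu Au *; rewrite ltnS => le_m below.
have lj (j : nat) : (0 < j <= k)%N -> letter j.
  by move=> jk; apply: (letter_nat (k := k)); rewrite // mem_iota; lia.
case: (pselect (forall j : nat, (0 < j <= k)%N -> s j = c j)) => [E|ne].
  by exists u, s; split=> //; apply: rt_refl.
have ex : exists i, (0 < i <= k)%N && (s i%:Z != c i).
  case: (pselect (exists i : nat, (0 < i <= k)%N && (s i%:Z != c i))) => // no.
  case: ne => j jk; apply/eqP/negPn/negP => sj; apply: no; exists j.
  by rewrite jk sj.
have bound i : (0 < i <= k)%N && (s i%:Z != c i) -> (i <= k)%N by lia.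
case: (ex_maxnP ex bound) => i /andP[ik si] imax.
have tail j : (i < j <= k)%N -> s j%:Z = c j.
  move=> ijk; apply/eqP/negPn/negP => sj; have := imax j; rewrite sj andbT.
  by move=> /(_ ltac:(lia)); lia.
have ls (j : nat) : (0 < j <= k)%N -> letter (s j) by move=> jk; rewrite (acts_letter Au) lj.
have [x [lx sx xc below']] : exists x : int, [/\ letter x, letter_lt (s i) x, letter_le x (c i) &
    column_below k (moved (fun j : nat => s j) i x) c].
  apply: move_exists => //.
  - by move=> j jk; rewrite lc // ls.
  - move=> a b ak bk; rewrite -(acts_opp Au) ?(inj_eq (acts_inj Au)); lia.
have [w [s' [uw Ww Aw s'E]]] : exists w s', [/\ bruhat_step u w, weyl w, acts w s' &
    forall j : nat, (0 < j <= k)%N -> s' j = moved (fun j : nat => s j) i x j].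
  apply: (move_letter (k := k)) => //.
  - by move=> j ji; apply: (proj1 below); lia.
  - move=> j ji; rewrite tail //; have := Hc i j ltac:(lia) ji.
    by move: xc; rewrite /letter_le !letter_ltE; lia.
have [||v [sv [Wv Av wv svE]]] := IH w s' Ww Aw.
- apply: leq_trans le_m.
  have up (j : nat) : (0 < j <= k)%N -> letter_le (s j) (s' j).
    move=> jk; rewrite s'E // /moved; case: eqP => [->|_]; first by rewrite /letter_le sx orbT.
    case: eqP => [E|_]; last by rewrite /letter_le eqxx.
    by rewrite E /letter_le letter_ltN ?sx ?orbT ?(letter_neq0 lx) // (letter_neq0 (ls i ik)).
  have ile : (i \in iota 1 k) by rewrite mem_iota; lia.
  rewrite (big_rem i ile) [X in (_ < X)%N](big_rem i ile) /= -addSn.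
  have mem j : j \in iota 1 k -> (0 < j <= k)%N by rewrite mem_iota; lia.
  have ls' (j : nat) : (0 < j <= k)%N -> letter (s' j) by move=> jk; rewrite (acts_letter Aw) lj.
  apply: leq_add.
    rewrite s'E // /moved eqxx; have := rank_lt (ls i ik) lx sx; lia.
  rewrite !big_seq; apply: leq_sum => j /mem_rem /mem jk.
  have /orP[/eqP ->//|lt] := up j jk.
  by have := rank_lt (ls j jk) (ls' j jk) lt; lia.
- split=> [a b a0 ab|j jk].
    by rewrite !s'E; [apply: (proj1 below')|lia|lia].
  by rewrite s'E //; apply: (proj2 below').
- exists v, sv; split=> //; apply: rt_trans wv; exact: rt_step.
Qed.

(** * Columns and their weights *)

#[local] Transparent Defs.refl Defs.eps Defs.dot root_of coroot_of.

Definition is_column (k : nat) (C : seq int) : Prop :=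
  [/\ size C = k, all letter C, sorted letter_lt C & forall p, p \in C -> - p \notin C].

Definition cvec (C : seq int) : V := \sum_(p <- C) eps p.

(** The coefficient of eps p in the weight of the column C, with the letters p
    and - p taken together. *)
Definition mult (p : int) (C : seq int) : R := (p \in C)%:R - (- p \in C)%:R.

Lemma sorted_letter_uniq C : sorted letter_lt C -> uniq C.
Proof. by apply: sorted_uniq; [apply: letter_lt_trans|apply: letter_lt_irr]. Qed.

Lemma column_uniq k C : is_column k C -> uniq C.
Proof. by case=> _ _ + _; apply: sorted_letter_uniq. Qed.

Lemma apartment_cvec C : all letter C -> apartment (cvec C).
Proof. by move=> /allP lC; apply: apartment_sum => p /lC; apply: apartment_eps. Qed.

Lemma sum_eq_mem (C : seq int) p : uniq C -> \sum_(r <- C) (p == r)%:R = (p \in C)%:R :> R.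
Proof.
elim: C => [|x C IH] /=; first by rewrite big_nil.
move=> /andP[xC uC]; rewrite big_cons IH // inE; case: eqVneq => [->|_] /=; last by rewrite add0r.
by rewrite (negPf xC) addr0.
Qed.

Lemma sum_mult C p : uniq C ->
  \sum_(r <- C) ((p == r)%:R - (p == - r)%:R) = mult p C :> R.
Proof.
move=> uC; rewrite sumrB sum_eq_mem //.
rewrite (eq_bigr (fun r => (- p == r)%:R)) ?sum_eq_mem // => r _.
by congr _%:R; lia.
Qed.

Lemma dot_root_cvec C p q : letter p -> letter q -> uniq C -> all letter C ->
  dot (root_of p q) (cvec C) = root_scale p q * (mult p C - mult q C).
Proof.
move=> lp lq uC /allP lC; rewrite /root_of dotZl dot_sumr; congr (_ * _).
rewrite -!sum_mult // -sumrB !big_seq; apply: eq_bigr => r rC.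
exact: dot_epsB lp lq (lC r rC).
Qed.

Definition shift_const : R := if t is TypeA then n.+1%:R^-1 else 0.

Lemma dot_eps p q : letter p -> letter q ->
  dot (eps p) (eps q) = (p == q)%:R - (p == - q)%:R - shift_const.
Proof.
move=> lp lq; have [i pi sp] := letter_ord lp.
have [j qj sq] := letter_ord lq.
rewrite (dot_eps_ord (apartment_eps lq) pi) mxE mxE -pi.
rewrite -sgz_mulE ?(letter_neq0 lp) ?(letter_neq0 lq) //.
rewrite [`|q|%N == _]eq_sym /shift_const.
move: sp sq; case: (t) => [|_ _|_ _]; rewrite ?subr0 //.
by move=> -> // -> //; ring.
Qed.

Lemma dot_eps_cvec C p : letter p -> uniq C -> all letter C ->
  dot (eps p) (cvec C) = mult p C - shift_const * (size C)%:R.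
Proof.
move=> lp uC /allP lC; rewrite dot_sumr -sum_mult //.
have -> : shift_const * (size C)%:R = \sum_(r <- C) shift_const.
  by rewrite big_const_seq count_predT iter_addr addr0 mulr_natr.
rewrite -sumrB !big_seq; apply: eq_bigr => r /lC lr; exact: dot_eps.
Qed.

Lemma mult_column k C p : is_column k C -> p \in C -> mult p C = 1.
Proof. by move=> [_ _ _ nC] pC; rewrite /mult pC (negPf (nC p pC)) subr0. Qed.

Lemma sorted_letter_eq C C' : sorted letter_lt C -> sorted letter_lt C' -> perm_eq C C' -> C = C'.
Proof.
move=> sC sC' /perm_mem eqCC'.
exact: (irr_sorted_eq letter_lt_trans letter_lt_irr).
Qed.

(** In type A the vectors of the letters are linearly dependent, but columns of
    equal size have the same correction term. *)
Lemma cvec_inj k C C' : is_column k C -> size C' = k -> all letter C' -> sorted letter_lt C' ->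
  cvec C' = cvec C -> C' = C.
Proof.
move=> col sC' lC' soC' E; have [sC lC soC nC] := col.
apply: sorted_letter_eq => //; rewrite perm_sym.
have uC := sorted_letter_uniq soC; have uC' := sorted_letter_uniq soC'.
apply: uniq_perm => //; apply: (uniq_min_size uC _ _).2; last by rewrite sC sC'.
move=> p pC; have lp := allP lC p pC.
have := dot_eps_cvec lp uC lC; rewrite -E dot_eps_cvec // sC sC' => /(addIr _).
rewrite (mult_column col pC) /mult; case: (p \in C') => // /eqP.
by rewrite sub0r lt_eqF // (le_lt_trans _ ltr01) // oppr_le0 ler0n.
Qed.

Lemma letter_le_total : total letter_le.
Proof. by move=> p q; rewrite /letter_le !letter_ltE; lia. Qed.

Lemma sort_letter_sorted C : uniq C -> sorted letter_lt (sort letter_le C).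
Proof.
move=> uC; have := sort_sorted letter_le_total C.
rewrite !sorted_pairwise; [|exact: letter_lt_trans|exact: letter_le_trans].
have : pairwise (fun x y : int => x != y) (sort letter_le C) by rewrite -uniq_pairwise sort_uniq.
move=> uP leP; have := pairwise_relI (fun x y : int => x != y) letter_le (sort letter_le C).
rewrite uP leP => /=; apply: sub_pairwise => p q /= /andP[pq].
by rewrite /letter_le (negPf pq).
Qed.

Lemma images_column w s k : acts w s -> (k <= n)%N ->
  is_column k (sort letter_le (images s k)).
Proof.
move=> A kn; split.
- by rewrite size_sort size_map size_iota.
- rewrite all_sort; apply/allP => p /mapP [j jk ->].
  by rewrite (acts_letter A) (letter_nat jk).
- apply: sort_letter_sorted; rewrite map_inj_uniq ?iota_uniq // => i j /(acts_inj A) [].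
  done.
- move=> p; rewrite !mem_sort => /mapP [j jk ->]; apply/mapP => -[i ik].
  have := jk; rewrite mem_iota => ?; have := ik; rewrite mem_iota => ?.
  by rewrite -(acts_opp A); [move/(acts_inj A); lia|lia].
Qed.

Lemma cvec_perm C C' : perm_eq C C' -> cvec C = cvec C'.
Proof. by move=> CC'; apply: perm_big. Qed.

Local Notation omega := (omega R t n).
Local Notation weight_scale := (weight_scale R t n).

Lemma acts_cvec w s C : acts w s -> all letter C -> w (cvec C) = cvec (map s C).
Proof.
move=> A; elim: C => [|p C IH] /=; first by rewrite /cvec !big_nil (acts0 A).
by move=> /andP[lp lC]; rewrite /cvec !big_cons (actsD _ _ A) (acts_eps A lp) -/(cvec _) IH.
Qed.

Definition first_letters (k : nat) : seq int := [seq j%:Z | j <- iota 1 k].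

Lemma first_letters_column k : (k <= n)%N -> is_column k (first_letters k).
Proof.
move=> kn; split.
- by rewrite size_map size_iota.
- by apply/allP => p /mapP [j jk ->]; apply: letter_nat jk kn.
- apply/(sortedP 0) => i; rewrite size_map size_iota => ik.
  rewrite !(nth_map 0%N) ?size_iota ?(ltnW ik) // !nth_iota ?(ltnW ik) //.
  by rewrite letter_ltE; lia.
- by move=> p /mapP [j jk ->]; apply/mapP => -[i]; move: jk; rewrite !mem_iota; lia.
Qed.

Lemma mem_first_letters k (x : int) : (x \in first_letters k) = (0 < x <= k%:Z).
Proof.
apply/mapP/idP => [[j]|xk]; first by rewrite mem_iota => ? ->; lia.
by exists `|x|%N; [rewrite mem_iota|]; lia.
Qed.

Lemma omegaE k : omega k = weight_scale k *: cvec (first_letters k).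
Proof. by rewrite /omega /cvec big_map /index_iota subSS subn0. Qed.

Lemma column_letter_le k C j : is_column k C -> (j < k)%N -> letter_le j.+1%:Z (nth 0 C j).
Proof.
move=> [sC lC soC _]; elim: j => [|j IH] jk.
  have : letter (nth 0 C 0) by apply: (allP lC); rewrite mem_nth ?sC.
  by rewrite /letter_le letter_ltE; case: (t) => /=; lia.
have /IH := ltnW jk.
have lt : letter_lt (nth 0 C j) (nth 0 C j.+1).
  by move/(sortedP 0): soC => /(_ j); rewrite sC => /(_ jk).
by move: lt; rewrite /letter_le !letter_ltE; lia.
Qed.

Lemma column_nth_lt k C i j : is_column k C -> (i < j < k)%N -> letter_lt (nth 0 C i) (nth 0 C j).
Proof.
move=> [sC lC soC _] ijk; apply: (sorted_ltn_nth letter_lt_trans 0 soC); rewrite ?inE ?sC; lia.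
Qed.

(** Entries are numbered from 1, like the letters whose images they will be. *)
Definition entry (C : seq int) (j : nat) : int := nth 0 C j.-1.

Lemma column_lift u s k k' C : weyl u -> acts u s -> is_column k C -> (k <= k')%N -> (k' <= n)%N ->
  (forall i j : nat, (0 < i)%N -> (i < j <= k')%N -> letter_lt (s i) (s j)) ->
  (forall j : nat, (0 < j <= k)%N -> letter_le (s j) (entry C j)) ->
  exists w s', [/\ weyl w, acts w s', bruhat_le u w &
    forall j : nat, (0 < j <= k)%N -> s' j = entry C j].
Proof.
move=> Wu Au col kk' kn Hs le_sC; have [sC lC soC nC] := col.
apply: (bruhat_lift Wu Au) => //.
- by lia.
- by move=> i j i0 ijk; apply: (column_nth_lt col); lia.
- move=> i j ik jk; apply/eqP => E.
  have iC : entry C i \in C by rewrite mem_nth // sC; lia.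
  have jC : entry C j \in C by rewrite mem_nth // sC; lia.
  by have := nC _ jC; rewrite -E iC.
- by move=> i ik; apply: (allP lC); rewrite mem_nth // sC; lia.
- split; last exact: le_sC.
  by move=> i j i0 ijk; apply: Hs => //; lia.
Qed.

Lemma column_exists_weyl k C : (k <= n)%N -> is_column k C ->
  exists w s, [/\ weyl w, acts w s & forall j : nat, (0 < j <= k)%N -> s j = entry C j].
Proof.
move=> kn col.
have [||w [s [Ww Aw _ sE]]] := column_lift (generated_id _ _ _ _) acts_id col (leqnn k) kn.
- by move=> i j i0 ij; rewrite letter_ltE; lia.
- by move=> j jk; have := column_letter_le col (j := j.-1); rewrite prednK; [apply|]; lia.
- by exists w, s.
Qed.

Lemma images_entry (s : int -> int) k C : size C = k -> (forall j : nat, (0 < j <= k)%N -> s j = entry C j) ->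
  images s k = C.
Proof.
move=> sC sE; apply: (eq_from_nth (x0 := 0)); first by rewrite size_map size_iota.
move=> i; rewrite size_map size_iota => ik.
by rewrite (nth_map 0%N) ?size_iota // nth_iota // add1n sE.
Qed.

(** * Steps and the values of the roots on them *)

Local Notation carrier := (carrier R t n).
Local Notation segment := (segment R t n).
Local Notation is_vertex := (is_vertex R t n).
Local Notation is_edge := (is_edge R t n).
Local Notation has_dim := (has_dim R t n).

(** The decidable form of being minuscule, see [minusculeP]. *)
Definition is_min (k : nat) : bool :=
  match t with TypeA => true | TypeB => k == n | TypeC => k == 1%N end.

Definition step_scale (k : nat) : R := (if is_min k then 1 else 2%:R^-1) * weight_scale k.

(** The step of a gallery that belongs to a column of length k: the weight of
    the column if the coweight is minuscule, and half of it otherwise. *)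
Definition step_vec (k : nat) (C : seq int) : V := step_scale k *: cvec C.

Lemma step_scaleE k : step_scale k =
  match t with TypeA => 1 | TypeB => 2%:R^-1 | TypeC => if k == 1%N then 1 else 2%:R^-1 end.
Proof.
rewrite /step_scale /weight_scale /is_min; case: (t) => /=; rewrite ?mulr1 //.
by case: ifP => _; rewrite ?mulr1 ?mul1r.
Qed.

Lemma step_scale_gt0 k : 0 < step_scale k.
Proof. by rewrite step_scaleE; case: (t); rewrite ?invr_gt0 ?ltr0n //; case: ifP; rewrite ?invr_gt0 ?ltr0n. Qed.

Lemma multN p C : mult (- p) C = - mult p C.
Proof. by rewrite /mult opprK opprB. Qed.

Lemma mult_bound k C p : is_column k C -> `|mult p C| <= 1.
Proof.
move=> [_ _ _ nC]; rewrite /mult; have := nC p; case: (p \in C).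
  by move=> /(_ isT) /negPf ->; rewrite subr0 normr1.
by move=> _; case: (- p \in C); rewrite ?sub0r ?subr0 ?normrN ?normr0 ?normr1 ?ler01.
Qed.

Lemma mult_typeA k C p : t = TypeA -> is_column k C -> letter p -> mult p C = (p \in C)%:R.
Proof.
move=> tA [_ lC _ _] lp; rewrite /mult; have -> : (- p \in C) = false; last by rewrite subr0.
apply/negP => /(allP lC); move: lp; rewrite tA => /letter_pos + /letter_pos; lia.
Qed.

Lemma dot_root_step k C p q : is_column k C -> letter p -> letter q ->
  dot (root_of p q) (step_vec k C) =
  step_scale k * (root_scale p q * (mult p C - mult q C)).
Proof.
by move=> col lp lq; have [_ lC _ _] := col; rewrite dotZr dot_root_cvec // (column_uniq col).
Qed.

(** No wall separates the two ends of a step strictly, if one of them is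
    special: the values of a root at the ends differ by at most 1. *)
Lemma root_step_small k C x : is_column k C -> (0 < k)%N -> roots x ->
  `|dot x (step_vec k C)| <= 1.
Proof.
move=> col k0 /rootsP [p [q [lp lq pq ->]]]; rewrite dot_root_step //.
have := mult_bound p col; have := mult_bound q col; rewrite !ler_norml => /andP[q1 q2] /andP[p1 p2].
have [tA|tA] := typeA_dec t.
  rewrite (mult_typeA tA col lp) (mult_typeA tA col lq) step_scaleE /root_scale tA !mul1r.
  by case: (p \in C); case: (q \in C) => /=; lra.
have [k1|k1] := eqVneq k 1%N; last first.
  have -> : step_scale k = 2%:R^-1.
    by rewrite step_scaleE (negPf k1); case: (t) tA.
  have : 0 < root_scale p q <= 1.
    rewrite /root_scale; case: (t); rewrite ?ltr01 ?lexx //; case: ifP; rewrite ?ltr01 ?lexx //.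
    by rewrite invr_gt0 ltr0n invf_le1 ?ltr0n // ler1n.
  by move: (root_scale p q) (mult p C) (mult q C) p1 p2 q1 q2 => a b c; nra.
have [tB|tC] := typeBC tA.
  rewrite step_scaleE /root_scale tB mul1r; lra.
rewrite step_scaleE k1 /root_scale tC eqxx mul1r.
have [qp|qp] := eqVneq q (- p).
  by rewrite qp multN; lra.
rewrite mul1r; have [sC _ _ _] := col; move: sC; rewrite k1.
case: C {col p1 p2 q1 q2} => [//|r [|//]] _; rewrite /mult !inE.
have p0 := letter_neq0 lp; have q0 := letter_neq0 lq.
have [<-|pr] := eqVneq p r.
  have -> : (q == p) = false by lia.
  have -> : (- q == p) = false by lia.
  have -> : (- p == p) = false by lia.
  by rewrite /=; lra.
have [pr'|pr'] := eqVneq (- p) r.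
  have -> : (q == r) = false by lia.
  have -> : (- q == r) = false by lia.
  by rewrite /=; lra.
have [<-|qr] := eqVneq q r.
  have -> : (- q == q) = false by lia.
  by rewrite /=; lra.
by case: (- q == r); rewrite /=; lra.
Qed.

Lemma column_head k C : is_column k C -> (0 < k)%N -> exists2 p, p \in C & letter p.
Proof.
move=> [sC lC _ _] k0; have mem : nth 0 C 0 \in C by rewrite mem_nth ?sC.
by exists (nth 0 C 0); last exact: (allP lC).
Qed.

Lemma exists_not_in_column k C : t = TypeA -> is_column k C -> (k <= n)%N ->
  exists2 q, q \notin C & letter q.
Proof.
move=> tA [sC lC soC _] kn; have uC := sorted_letter_uniq soC.
case: (pselect (exists2 q, q \notin C & letter q)) => // no; exfalso.
suff : (n.+1 <= size C)%N by lia.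
rewrite -(size_iota 1 n.+1) -(size_map Posz); apply: uniq_leq_size.
  by rewrite map_inj_uniq ?iota_uniq // => i j [].
move=> x /mapP [j]; rewrite mem_iota => jn ->.
apply/negPn/negP => jC; apply: no; exists j%:Z => //.
by rewrite tA /=; lia.
Qed.

Lemma root_step_one k C : is_column k C -> (0 < k <= n)%N ->
  exists2 x, roots x & dot x (step_vec k C) = 1.
Proof.
move=> col /andP[k0 kn]; have [p pC lp] := column_head col k0.
have p0 := letter_neq0 lp; have mp := mult_column col pC.
have [tA|tA] := typeA_dec t.
  have [q qC lq] := exists_not_in_column tA col kn.
  exists (root_of p q); first by apply/rootsP; exists p, q; split=> //; apply: contraNneq qC => <-.
  rewrite dot_root_step // mp (mult_typeA tA col lq) (negPf qC) step_scaleE /root_scale tA /=.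
  by rewrite !mul1r subr0.
have lNp : letter (- p) by rewrite letterN.
have [tC|tB] : (t = TypeC /\ (1 < k)%N) \/ (t = TypeB \/ k = 1%N).
  by case: (typeBC tA) => ->; [right; left|case: (leqP k 1) => ?; [right; right; lia|left]].
- have [sC lC _ _] := col; have uC := column_uniq col.
  have [q qC qp] : exists2 q, q \in C & q != p.
    case: (pselect (exists2 q, q \in C & q != p)) => // no; exfalso.
    suff : (size C <= 1)%N by lia.
    rewrite -(size_nseq 1 p); apply: uniq_leq_size => // q qC; rewrite inE.
    by apply/negPn/negP => qp; apply: no; exists q.
  have lq := allP lC q qC; have q0 := letter_neq0 lq.
  have mq := mult_column col qC.
  have nqp : p != - q.
    by apply/eqP => E; have [_ _ _ /(_ q qC)] := col; rewrite -E pC.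
  exists (root_of p (- q)); first by apply/rootsP; exists p, (- q); split=> //; rewrite letterN.
  rewrite dot_root_step ?letterN // multN mp mq step_scaleE root_scale1; last by lia.
  have -> : (k == 1%N) = false by lia.
  by rewrite tC.1; lra.
exists (root_of p (- p)); first by apply/rootsP; exists p, (- p); split=> //; lia.
rewrite dot_root_step // multN mp step_scaleE /root_scale eqxx.
case: tB => [->|->]; first by lra.
by case: (typeBC tA) => ->; rewrite ?eqxx; lra.
Qed.

Lemma apartment_ext x : apartment x -> (forall p, letter p -> dot (eps p) x = 0) -> x = 0.
Proof.
move=> ax H; apply/rowP => j; rewrite mxE.
have lj := letter_of_ord j; have := H _ lj.
by rewrite (dot_eps_ord (p := j.+1%:Z) (j := j) ax) // gtr0_sgz // mul1r.
Qed.

Lemma dot_eps_opp p x : dot (eps (- p)) x = - dot (eps p) x.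
Proof. by rewrite epsN dotNl. Qed.

Lemma dot_root p q x : dot (root_of p q) x = root_scale p q * (dot (eps p) x - dot (eps q) x).
Proof. by rewrite dotZl dotBl. Qed.

Lemma dot_root_eq0 p q x : (dot (root_of p q) x == 0) = (dot (eps p) x == dot (eps q) x).
Proof. by rewrite dot_root mulf_eq0 subr_eq0 gt_eqF ?root_scale_gt0. Qed.

Lemma sum_dot_eps x : t = TypeA -> apartment x ->
  \sum_(j <- iota 1 n.+1) dot (eps j%:Z) x = 0.
Proof.
move=> tA ax; have sx : \sum_i x 0 i = 0.
  by have := ax; rewrite /apartment /=; move: (\sum_i x 0 i) => S; rewrite tA.
transitivity (\sum_(i < ambient t n) x 0 i); last exact: sx.
rewrite -[iota 1 n.+1]/(index_iota 1 n.+2) big_add1 /=.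
have -> : n.+1 = ambient t n by rewrite tA.
rewrite big_mkord; apply: eq_bigr => i _.
by rewrite (dot_eps_ord (p := i.+1%:Z) (j := i) ax) // gtr0_sgz // mul1r.
Qed.

(** The roots that vanish on a step vanish simultaneously only on its line. This
    is why a step spans an edge and not a face of larger dimension. A letter
    outside of the column, together with its opposite, contributes 0 in types B
    and C; in type A all letters outside of the column contribute the same,
    hence 0 as the sum is 0. *)
Lemma step_line k C x : is_column k C -> (0 < k <= n)%N -> apartment x ->
  (forall alpha, roots alpha -> dot alpha (step_vec k C) = 0 -> dot alpha x = 0) ->
  exists l, x = l *: step_vec k C.
Proof.
move=> col /andP[k0 kn] ax H; have [p0 pC lp0] := column_head col k0.
have [sC lC soC nC] := col; have uC := column_uniq col.
set f := step_vec k C.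
have af : apartment f by apply/apartmentZ/apartment_cvec.
have fp p : letter p -> dot (eps p) f = step_scale k * (mult p C - shift_const * k%:R).
  by move=> lp; rewrite dotZr dot_eps_cvec // sC.
have fC p : p \in C -> dot (eps p) f = dot (eps p0) f.
  by move=> pc; rewrite !fp ?(allP lC p pc) // !(mult_column col).
have f0 : dot (eps p0) f != 0.
  rewrite fp // (mult_column col pC) mulf_neq0 //; first by rewrite gt_eqF ?step_scale_gt0.
  rewrite subr_eq0 eq_sym lt_eqF // /shift_const; case: (t); rewrite ?mul0r ?ltr01 //.
  by rewrite mulrC ltr_pdivrMr ?ltr0n // mul1r ltr_nat.
exists (dot (eps p0) x / dot (eps p0) f).
apply/eqP; rewrite -subr_eq0; apply/eqP.
set y := x - _; have ay : apartment y by apply/apartmentB/apartmentZ.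
have y0 : dot (eps p0) y = 0 by rewrite dotBr dotZr divfK // subrr.
have Hy p q : letter p -> letter q -> p != q -> dot (eps p) f = dot (eps q) f ->
    dot (eps p) y = dot (eps q) y.
  move=> lp lq pq /eqP; rewrite -dot_root_eq0 => /eqP fpq.
  apply/eqP; rewrite -dot_root_eq0 dotBr dotZr fpq mulr0 subr0; apply/eqP/H => //.
  by apply/rootsP; exists p, q.
have yC p : p \in C -> dot (eps p) y = 0.
  move=> pc; have [->//|pp0] := eqVneq p p0.
  by rewrite -y0; apply: Hy; rewrite ?fC // (allP lC).
apply: apartment_ext => // q lq; have [qC|qC] := boolP (q \in C); first exact: yC.
have [nqC|nqC] := boolP (- q \in C).
  by have := yC _ nqC; rewrite dot_eps_opp => /eqP; rewrite oppr_eq0 => /eqP.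
have [tA|tA] := typeA_dec t; last first.
  have : dot (eps q) y = dot (eps (- q)) y.
    apply: Hy; rewrite ?letterN //; first by have := letter_neq0 lq; lia.
    rewrite dot_eps_opp fp // /mult (negPf qC) (negPf nqC) /shift_const.
    by case: (t) tA => // _; rewrite mul0r !subr0 mulr0 oppr0.
  by rewrite dot_eps_opp => /eqP; rewrite -subr_eq0 opprK -mulr2n mulrn_eq0 => /eqP.
have yq r : letter r -> r \notin C -> dot (eps r) y = dot (eps q) y.
  move=> lr rC; have [->//|rq] := eqVneq r q.
  by apply: Hy => //; rewrite !fp // !(mult_typeA tA col) // (negPf rC) (negPf qC).
have := sum_dot_eps tA ay.
rewrite big_seq (eq_bigr (fun j : nat => (j%:Z \notin C)%:R * dot (eps q) y)) => [|j]; last first.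
  rewrite mem_iota => jn; have lj : letter j by rewrite tA /=; lia.
  have [jC|jC] := boolP (j%:Z \in C); first by rewrite (yC _ jC) mul0r.
  by rewrite (yq _ lj jC) mul1r.
rewrite -big_seq -mulr_suml => /eqP; rewrite mulf_eq0 => /orP[|/eqP //].
rewrite -natr_sum pnatr_eq0 sum_nat_seq_eq0 => /allP /(_ `|q|%N).
rewrite mem_iota implyTb => H0; exfalso; move: lq qC; rewrite tA /= => lq qC.
have := H0 ltac:(lia); rewrite gez0_abs ?qC //; lia.
Qed.

(** * Special points, vertices and edges *)

(** The points of the coweight lattice, see [specialP]. *)
Definition special_pt (x : V) : Prop :=
  apartment x /\ forall alpha, roots alpha -> dot alpha x \is a Num.int.

Lemma rootsN alpha : roots alpha -> roots (- alpha).
Proof. by case=> H; [right; rewrite opprK|left]. Qed.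

Lemma segmentP x y z : segment x y z <->
  exists s : R, 0 <= s <= 1 /\ z = x + s *: (y - x).
Proof.
rewrite /segment; split=> [[s /= s01 <-]|[s [s01 ->]]].
  by exists s; split=> //; apply/rowP => j; rewrite !mxE; ring.
by exists s => //=; apply/rowP => j; rewrite !mxE; ring.
Qed.

Lemma segment0P f z : segment 0 f z <-> exists s : R, 0 <= s <= 1 /\ z = s *: f.
Proof. by rewrite segmentP; split=> -[s [s01 ->]]; exists s; rewrite ?add0r ?subr0. Qed.

Lemma segmentC x y : segment x y = segment y x.
Proof.
apply/seteqP; split=> z /segmentP [s [s01 ->]]; apply/segmentP; exists (1 - s);
  (split; first by lra); apply/rowP => j; rewrite !mxE; ring.
Qed.

Lemma segment_shift u x y : segment (u + x) (u + y) = [set u + z | z in segment x y].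
Proof.
apply/seteqP; split=> z.
  move=> /segmentP [s [s01 ->]]; exists (x + s *: (y - x)); first by apply/segmentP; exists s.
  by apply/rowP => j; rewrite !mxE; ring.
move=> [_ /segmentP [s [s01 ->]] <-]; apply/segmentP; exists s; split=> //.
by apply/rowP => j; rewrite !mxE; ring.
Qed.

Lemma segmentN x y : segment (- x) (- y) = [set - z | z in segment x y].
Proof.
apply/seteqP; split=> z.
  move=> /segmentP [s [s01 ->]]; exists (x + s *: (y - x)); first by apply/segmentP; exists s.
  by apply/rowP => j; rewrite !mxE; ring.
move=> [_ /segmentP [s [s01 ->]] <-]; apply/segmentP; exists s; split=> //.
by apply/rowP => j; rewrite !mxE; ring.
Qed.

Lemma segment_left x y : segment x y x.
Proof. by apply/segmentP; exists 0; rewrite lexx ler01 scale0r addr0. Qed.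

Lemma segment_right x y : segment x y y.
Proof. by rewrite segmentC; apply: segment_left. Qed.

Lemma carrier_self x : apartment x -> carrier x x.
Proof. by move=> ax; split. Qed.

Lemma carrier_shift u x y : special_pt u -> carrier x y -> carrier (u + x) (u + y).
Proof.
move=> [au uint] [ay H]; split; first exact: apartmentD.
move=> alpha m ra; have /intrP [k uk] := uint _ ra; rewrite !dotDr uk.
have := H alpha (k + m) ra; rewrite intrD; set a := dot alpha x; set b := dot alpha y.
by rewrite [k%:~R + a]addrC [k%:~R + b]addrC -!addrA.
Qed.

Lemma special_ptN u : special_pt u -> special_pt (- u).
Proof.
move=> [au uint]; split; first exact: apartmentN.
by move=> alpha ra; rewrite dotNr rpredN uint.
Qed.

Lemma special_ptD u v : special_pt u -> special_pt v -> special_pt (u + v).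
Proof.
move=> [au uint] [av vint]; split; first exact: apartmentD.
by move=> alpha ra; rewrite dotDr rpredD ?uint ?vint.
Qed.

Lemma special_ptB u v : special_pt u -> special_pt v -> special_pt (u - v).
Proof. by move=> su sv; apply/special_ptD/special_ptN. Qed.

Lemma special_pt0 : special_pt 0.
Proof. by split=> [|alpha _]; [apply: apartment0|rewrite dot0r rpred0]. Qed.

(** Translations by special points permute the walls. *)
Lemma carrier_shiftE u x : special_pt u -> carrier (u + x) = [set u + y | y in carrier x].
Proof.
move=> su; apply/seteqP; split=> [z zc|_ [y yc <-]]; last exact: carrier_shift.
exists (z - u); last by rewrite addrC subrK.
by have := carrier_shift (special_ptN su) zc; rewrite addKr addrC.
Qed.

Lemma carrierN x : carrier (- x) = [set - y | y in carrier x].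
Proof.
have H a b : carrier a b -> carrier (- a) (- b).
  move=> [ab C]; split; first exact: apartmentN.
  by move=> alpha m ra; rewrite !dotNr -!dotNl; apply/C/rootsN.
apply/seteqP; split=> [z /H|_ [y yc <-]]; last exact: H.
by rewrite opprK => zc; exists (- z); rewrite ?opprK.
Qed.

Lemma is_vertexP v : is_vertex v <-> carrier v = [set v].
Proof.
split=> [[[x ax vE] _]|cv].
  have xv : x = v by have := carrier_self ax; rewrite -vE.
  by rewrite -{1}xv vE.
have av : apartment v by have : carrier v v; [rewrite cv|case].
split; first by exists v.
exists 0%VS; split; first by rewrite dimv0.
  by move=> x y /= -> ->; rewrite subrr mem0v.
by move=> U _; apply: sub0v.
Qed.

(** A point is a vertex if it is the only one on all the walls through it, which
    belong to the roots with integral value. *)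
Lemma vertex_of_int v : apartment v ->
  (forall y, apartment y -> (forall alpha, roots alpha -> dot alpha v \is a Num.int ->
     dot alpha y = dot alpha v) -> y = v) -> is_vertex v.
Proof.
move=> av H; apply/is_vertexP/seteqP; split=> [y [ay C]|_ ->]; last exact: carrier_self.
apply: H => // alpha ra /intrP [k vk]; apply/eqP; rewrite eq_le; apply/andP; split.
  have := C (- alpha) k (rootsN ra); rewrite !dotNl vk addNr lexx => /(_ isT); lra.
have := C alpha (- k) ra; rewrite vk intrN subrr lexx => /(_ isT); lra.
Qed.

Lemma roots_ext x : apartment x -> (forall alpha, roots alpha -> dot alpha x = 0) -> x = 0.
Proof.
move=> ax H; apply: apartment_ext => // p lp.
have Hpq q r : letter q -> letter r -> dot (eps q) x = dot (eps r) x.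
  move=> lq lr; have [->//|qr] := eqVneq q r.
  by apply/eqP; rewrite -dot_root_eq0; apply/eqP/H/rootsP; exists q, r.
have [tA|tA] := typeA_dec t.
  have := sum_dot_eps tA ax; rewrite big_seq (eq_bigr (fun=> dot (eps p) x)) => [|j]; last first.
    by rewrite mem_iota => jn; apply: Hpq => //; rewrite tA /=; lia.
  rewrite -big_seq big_const_seq count_predT size_iota iter_addr addr0 => /eqP.
  by rewrite mulrn_eq0 => /eqP.
have lNp : letter (- p) by rewrite letterN.
by have := Hpq p (- p) lp lNp; rewrite dot_eps_opp => /eqP; rewrite -subr_eq0 opprK -mulr2n mulrn_eq0 => /eqP.
Qed.

Lemma special_vertex v : special_pt v -> is_vertex v.
Proof.
move=> [av vint]; apply: vertex_of_int => // y ay H; apply/eqP; rewrite -subr_eq0; apply/eqP.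
apply: roots_ext => [|alpha ra]; first exact: apartmentB.
by rewrite dotBr H ?subrr // vint.
Qed.

Lemma vertex_apartment v : is_vertex v -> apartment v.
Proof. by move=> /is_vertexP cv; have : carrier v v; [rewrite cv|case]. Qed.

Lemma specialP v : special R t n v <-> special_pt v.
Proof.
split=> [[vv H]|sv].
  split=> [|alpha ra]; first exact: vertex_apartment.
  have [m [_ E]] := H alpha ra; apply/intrP; exists (- m); rewrite intrN.
  by apply/eqP; rewrite -addr_eq0 E.
split; first exact: special_vertex.
move=> alpha ra; have [av vint] := sv; have /intrP [k vk] := vint _ ra.
by exists (- k); split=> //; rewrite vk intrN subrr.
Qed.

(** The directions and lengths of the edges that start in the origin, and hence
    of those that start in any special vertex. *)
Definition edge_vec (g : V) : Prop :=
  [/\ apartment g, g != 0 & forall s : R, 0 < s < 1 -> carrier (s *: g) = segment 0 g].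

Lemma edge_vecN g : edge_vec g -> edge_vec (- g).
Proof.
move=> [ag g0 H]; split; [exact: apartmentN|by rewrite oppr_eq0|move=> s s01].
by rewrite scalerN carrierN H // -segmentN oppr0.
Qed.

Lemma edge_carrier u g s : special_pt u -> edge_vec g -> 0 < s < 1 ->
  carrier (u + s *: g) = segment u (u + g).
Proof.
move=> su [ag g0 H] s01; rewrite carrier_shiftE // H //.
by rewrite -[in RHS](addr0 u) -addrA segment_shift add0r.
Qed.

Lemma segment_dim x y : x != y -> has_dim (segment x y) 1.
Proof.
move=> xy; exists <[y - x]>%VS; split.
- by rewrite dim_vline subr_eq0 eq_sym xy.
- move=> _ _ /segmentP [s [_ ->]] /segmentP [r [_ ->]].
  apply/vlineP; exists (r - s); apply/rowP => j; rewrite !mxE; ring.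
- move=> U H; rewrite -memvE; apply: H; [exact: segment_left|exact: segment_right].
Qed.

Lemma is_edge_seg u g : special_pt u -> edge_vec g -> is_edge (segment u (u + g)).
Proof.
move=> su eg; have [ag g0 H] := eg; have [au _] := su; split.
  exists (u + 2%:R^-1 *: g); first by apply/apartmentD/apartmentZ.
  by rewrite (edge_carrier su eg) // invr_gt0 ltr0n invf_lt1 ?ltr0n // ltr1n.
by apply: segment_dim; rewrite -subr_eq0 opprD addNKr oppr_eq0.
Qed.

Lemma edge_vertex u g z : special_pt u -> edge_vec g -> segment u (u + g) z -> is_vertex z ->
  z = u \/ z = u + g.
Proof.
move=> su eg /segmentP [s [/andP[s0 s1] ->]].
have -> : u + s *: (u + g - u) = u + s *: g by rewrite [u + g]addrC addrK.
move: s0 s1; rewrite !le_eqVlt => /orP[/eqP <-|s0]; first by rewrite scale0r addr0; left.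
move=> /orP[/eqP ->|s1]; first by rewrite scale1r; right.
move=> /is_vertexP; rewrite (edge_carrier su eg) ?s0 // => E.
have [_ g0 _] := eg.
have Eu : u = u + s *: g by have := segment_left u (u + g); rewrite E.
by have /eqP := esym Eu; rewrite -subr_eq0 addrC addKr scaler_eq0 gt_eqF //= (negPf g0).
Qed.

Local Notation affine_weyl := (affine_weyl R t n).

Lemma step_edge_vec k C : is_column k C -> (0 < k <= n)%N -> edge_vec (step_vec k C).
Proof.
move=> col kn; have [_ lC _ _] := col.
have [beta rb] := root_step_one col kn.
have line x := @step_line k C x col kn.
have small alpha := @root_step_small k C alpha col.
have: apartment (step_vec k C) by apply/apartmentZ/apartment_cvec.
move: (step_vec k C) line small => f line small af fb.
have k0 : (0 < k)%N by lia.
split=> //.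
  by apply/eqP => f0; move: fb; rewrite f0 dot0r => /eqP; rewrite eq_sym oner_eq0.
move=> s /andP[s0 s1]; apply/seteqP; split=> y.
- move=> [ay H]; have [l yE] : exists l, y = l *: f.
    apply: line => // alpha ra fa; apply/eqP; rewrite eq_le; apply/andP; split.
      have := H (- alpha) 0 (rootsN ra); rewrite !dotNl dotZr fa mulr0; lra.
    have := H alpha 0 ra; rewrite dotZr fa mulr0; lra.
  apply/segment0P; exists l; split=> //.
  have := H beta 0 rb; have := H (- beta) 1 (rootsN rb).
  rewrite yE !dotNl !dotZr fb !mulr1 addr0 => H1 H2; lra.
- move=> /segment0P [r [/andP[r0 r1] ->]]; split; first exact: apartmentZ.
  move=> alpha m ra; rewrite !dotZr; have := small _ k0 ra.
  rewrite ler_norml; move: (dot alpha f) => a /andP[a1 a2] H.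
  have [m1|m0] := lerP 1 m.
    have : 1 <= m%:~R :> R by rewrite ler1z.
    by move: H; nra.
  have [m_neg|m00] := ltrP m 0.
    have : m%:~R <= -1 :> R by rewrite -[-1 : R]/((-1)%:~R) ler_int; lia.
    by move: H a2; nra.
  have : m = 0 by lia.
  by move=> mE; move: H; rewrite mE !addr0; nra.
Qed.

Lemma half_double (a : R) : 2%:R^-1 * (a + a) = a.
Proof. by field. Qed.

(** If the coweight is not minuscule, enough roots are integral at the half
    weight to make it a vertex: in type B these are the multiples of the single
    eps p; in type C the sums and differences of two entries, of which there are
    at least two, and the single letters outside of the column. *)
Lemma mid_vertex k C : is_column k C -> (0 < k <= n)%N -> ~~ is_min k ->
  is_vertex (step_vec k C).
Proof.
move=> col /andP[k0 kn] nmin; have [sC lC soC nC] := col.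
have tA : t <> TypeA by move=> tA; move: nmin; rewrite /is_min tA.
have k1 : t = TypeC -> (1 < k)%N by move=> tC; move: nmin; rewrite /is_min tC; lia.
have sc : step_scale k = 2%:R^-1.
  by rewrite step_scaleE; case: (t) tA k1 => // _; case: eqP => // -> /(_ erefl).
have lN p : letter p -> letter (- p) by rewrite letterN.
have af : apartment (step_vec k C) by apply/apartmentZ/apartment_cvec.
apply: vertex_of_int => // y ay H; apply/eqP; rewrite -subr_eq0; apply/eqP.
set z := y - _; have az : apartment z by apply: apartmentB.
have Hz p q : letter p -> letter q -> p != q ->
    2%:R^-1 * (root_scale p q * (mult p C - mult q C)) \is a Num.int ->
    dot (eps p) z = dot (eps q) z.
  move=> lp lq pq I; apply/eqP; rewrite -dot_root_eq0 dotBr H ?subrr //.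
    by apply/rootsP; exists p, q.
  by rewrite dot_root_step // sc.
have self p : letter p -> dot (eps p) z = dot (eps (- p)) z -> dot (eps p) z = 0.
  by move=> lp; rewrite dot_eps_opp => /eqP; rewrite -subr_eq0 opprK -mulr2n mulrn_eq0 => /eqP.
apply: apartment_ext => // p lp; have p0 := letter_neq0 lp.
have [tB|tC] := typeBC tA.
  apply: self => //; apply: Hz; rewrite ?lN //; first by lia.
  rewrite root_scaleB // multN mul1r opprK half_double.
  by rewrite /mult rpredB ?rpred_nat.
have yC q : q \in C -> dot (eps q) z = 0.
  move=> qC; have lq := allP lC q qC; have q0 := letter_neq0 lq.
  have [r rC rq] : exists2 r, r \in C & r != q.
    case: (pselect (exists2 r, r \in C & r != q)) => // no; exfalso.
    suff : (size C <= 1)%N by have := k1 tC; lia.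
    rewrite -(size_nseq 1 q); apply: uniq_leq_size (sorted_letter_uniq soC) _ => r rC; rewrite inE.
    by apply/negPn/negP => rq; apply: no; exists r.
  have lr := allP lC r rC; have mr := mult_column col rC; have mq := mult_column col qC.
  have nqr : q != - r by apply/eqP => E; have := nC _ rC; rewrite -E qC.
  apply: self => //; transitivity (dot (eps r) z).
    by apply: Hz; rewrite ?mr ?mq ?subrr ?mulr0 ?rpred0 // eq_sym.
  apply: Hz; rewrite ?lN //; first by lia.
  by rewrite multN mr mq opprK root_scale1 ?mul1r ?mulVf ?rpred1 ?pnatr_eq0 //; lia.
have [pC|pC] := boolP (p \in C); first exact: yC.
have [npC|npC] := boolP (- p \in C).
  by have := yC _ npC; rewrite dot_eps_opp => /eqP; rewrite oppr_eq0 => /eqP.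
apply: self => //; apply: Hz; rewrite ?lN //; first by lia.
by rewrite multN /mult (negPf pC) (negPf npC) !subrr oppr0 subrr !mulr0 rpred0.
Qed.

Lemma weyl_roots w s alpha : acts w s -> roots alpha -> roots (w alpha).
Proof.
move=> A /rootsP [p [q [lp lq pq ->]]]; rewrite (acts_root A) //.
by apply/rootsP; exists (s p), (s q); rewrite !(acts_letter A) (inj_eq (acts_inj A)).
Qed.

Lemma weyl_special w x : weyl w -> special_pt x -> special_pt (w x).
Proof.
move=> Ww [ax xint]; have [s A] := weyl_acts Ww; split; first exact: acts_apartment A _ _.
have [w' [Ww' wK w'K]] := weyl_inv Ww; have [s' A'] := weyl_acts Ww'.
move=> alpha ra; rewrite -(w'K alpha) (acts_dot A); apply: xint; exact: weyl_roots A' ra.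
Qed.

Lemma omega_special k : (0 < k <= n)%N -> special_pt (omega k).
Proof.
move=> /andP[k0 kn]; have col := first_letters_column kn; have [sC lC soC nC] := col.
rewrite omegaE; split; first exact/apartmentZ/apartment_cvec.
move=> alpha /rootsP [p [q [lp lq pq ->]]]; rewrite dotZr dot_root_cvec ?(column_uniq col) //.
have mi r : mult r (first_letters k) \is a Num.int by rewrite /mult rpredB ?rpred_nat.
have mB : mult p (first_letters k) - mult q (first_letters k) \is a Num.int by rewrite rpredB.
rewrite /weight_scale; case: ifP => [/andP[tB /eqP kE]|_].
  have tE : t = TypeB by case: (t) tB.
  have full r : letter r -> mult r (first_letters k) = 1 \/ mult r (first_letters k) = -1.
    move=> lr; have rn : (0 < `|r| <= k)%N by move: lr; rewrite tE kE.
    rewrite /mult !mem_first_letters; have [[-> ->]|[-> ->]] : (0 < r <= k%:Z) = true /\ (0 < - r <= k%:Z) = false \/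
        (0 < r <= k%:Z) = false /\ (0 < - r <= k%:Z) = true by lia.
      by rewrite subr0; left.
    by rewrite sub0r; right.
  rewrite root_scaleB // mul1r.
  have [->|->] := full p lp; have [->|->] := full q lq; rewrite ?subrr ?mulr0 ?rpred0 //.
    by rewrite opprK mulVf ?rpred1 // pnatr_eq0.
  by rewrite -opprD mulrN mulVf ?rpredN ?rpred1 // pnatr_eq0.
rewrite mul1r /root_scale; case: (t); rewrite ?mul1r //; case: ifP => [/eqP ->|_]; rewrite ?mul1r //.
by rewrite multN opprK half_double.
Qed.

(** * The coroot lattice and the affine Weyl group *)

(** The lattice spanned by the coroots, in coordinates: integral vectors, with
    coordinate sum 0 in type A and even in type C. *)
Definition coroot_lattice (x : V) : Prop :=
  [/\ apartment x, forall j, x 0 j \is a Num.int &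
      t = TypeC -> 2%:R^-1 * \sum_j x 0 j \is a Num.int].
Local Notation QV := coroot_lattice.

Lemma QVD x y : QV x -> QV y -> QV (x + y).
Proof.
move=> [ax xi xc] [ay yi yc]; split; first exact: apartmentD.
  by move=> j; rewrite mxE rpredD.
move=> tC; rewrite (eq_bigr (fun j => x 0 j + y 0 j)) => [|j _]; last by rewrite mxE.
by rewrite big_split mulrDr rpredD ?xc ?yc.
Qed.

Lemma QVZ x (m : int) : QV x -> QV (m%:~R *: x).
Proof.
move=> [ax xi xc]; split; first exact: apartmentZ.
  by move=> j; rewrite mxE rpredM ?intr_int.
move=> tC; rewrite (eq_bigr (fun j => m%:~R * x 0 j)) => [|j _]; last by rewrite mxE.
by rewrite -mulr_sumr mulrCA rpredM ?intr_int ?xc.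
Qed.

Lemma QVN x : QV x -> QV (- x).
Proof. by move=> Qx; have := QVZ (-1) Qx; rewrite intrN scaleN1r. Qed.

Lemma QVB x y : QV x -> QV y -> QV (x - y).
Proof. by move=> Qx Qy; apply/QVD/QVN. Qed.

Lemma QV0 : QV 0.
Proof.
split; [exact: apartment0|by move=> j; rewrite mxE rpred0|move=> _].
by rewrite big1 ?mulr0 ?rpred0 // => j _; rewrite mxE.
Qed.

Lemma sum_eps p : t <> TypeA -> letter p -> \sum_j (eps p) 0 j = (sgz p)%:~R.
Proof.
move=> tA lp; have [j pj _] := letter_ord lp.
rewrite (eq_bigr (fun i => (sgz p)%:~R * (i == j)%:R)) => [|i _]; last first.
  rewrite !mxE pj eqSS; congr (_ * _); have -> : (if t is TypeA then n.+1%:R^-1 else 0) = 0 :> R by case: (t) tA.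
  by rewrite subr0.
rewrite -mulr_sumr (bigD1 j) //= eqxx big1 ?addr0 ?mulr1 // => i /negPf ij.
by rewrite -[i == j]/(i == j) ij.
Qed.

Lemma eps_coord p j : (eps p) 0 j = (sgz p)%:~R * (j.+1 == `|p|%N)%:R - (sgz p)%:~R * shift_const.
Proof. by rewrite !mxE mulrBr. Qed.

Lemma eps_coord_int p j : t <> TypeA -> (eps p) 0 j \is a Num.int.
Proof.
move=> tA; rewrite eps_coord; have -> : shift_const = 0 by rewrite /shift_const; case: (t) tA.
by rewrite mulr0 subr0 rpredM ?intr_int ?rpred_nat.
Qed.

Lemma QV_coroot p q : letter p -> letter q -> p != q -> QV (coroot_of p q).
Proof.
move=> lp lq pq; split.
- by apply/apartmentZ/apartmentB; apply: apartment_eps.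
- move=> j; have [tA|tA] := typeA_dec t.
    have sp : sgz p = 1 by move: lp; rewrite tA => /letter_pos /gtr0_sgz.
    have sq : sgz q = 1 by move: lq; rewrite tA => /letter_pos /gtr0_sgz.
    have qp : q != - p by move: lp lq; rewrite tA => /letter_pos + /letter_pos; lia.
    rewrite /coroot_of; have -> : coroot_scale p q = 1 by rewrite /coroot_scale (negPf qp); case: (t).
    rewrite scale1r mxE [X in _ + X]mxE !eps_coord sp sq !mul1r.
    have -> (a b c : R) : a - b - (c - b) = a - c by ring.
    by rewrite rpredB ?rpred_nat.
  rewrite /coroot_of /coroot_scale; case: (typeBC tA) => tE; last first.
    have -> (a : R) : match t with TypeC => 1 | _ => a end = 1 by rewrite tE.
    by rewrite scale1r mxE [X in _ + X]mxE rpredB ?eps_coord_int.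
  have -> (a : R) : match t with TypeC => 1 | _ => a end = a by rewrite tE.
  case: eqP => [->|_]; last by rewrite scale1r mxE [X in _ + X]mxE rpredB ?eps_coord_int.
  rewrite epsN opprK mxE [X in _ * X]mxE half_double.
  exact: eps_coord_int.
- move=> tC; rewrite /coroot_of /coroot_scale.
  have -> (a : R) : match t with TypeC => 1 | _ => a end = 1 by rewrite tC.
  have tA : t <> TypeA by rewrite tC.
  rewrite scale1r (eq_bigr (fun j => eps p 0 j - eps q 0 j)) => [|j _]; last by rewrite !mxE.
  rewrite sumrB !sum_eps //.
  have sgE (r : int) : r != 0 -> sgz r = 1 \/ sgz r = -1 by case: (sgzP r) => //; auto.
  have [->|->] := sgE p (letter_neq0 lp); have [->|->] := sgE q (letter_neq0 lq);
    rewrite ?subrr ?mulr0 ?rpred0 // ?intrN ?opprK ?half_double ?rpred1 //.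
  by rewrite rpredN rpred1.
Qed.

Lemma int_coords_special x : apartment x -> (forall j, x 0 j \is a Num.int) -> special_pt x.
Proof.
move=> ax xi; split=> // alpha /rootsP [p [q [lp lq pq ->]]].
have ci r : letter r -> dot (eps r) x \is a Num.int.
  move=> lr; have [j rj _] := letter_ord lr; rewrite (dot_eps_ord ax rj).
  by rewrite rpredM ?intr_int.
have [s1|[-> s2]] : root_scale p q = 1 \/ q = - p /\ root_scale p q = 2%:R^-1.
  rewrite /root_scale; case: (t); try (by left); case: eqP => [->|_]; [by right|by left].
- by rewrite dot_root s1 mul1r rpredB ?ci.
- by rewrite dot_root dot_eps_opp opprK s2 half_double ci.
Qed.

Lemma QV_special x : QV x -> special_pt x.
Proof. by case=> ax xi _; apply: int_coords_special. Qed.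

(** A reflection moves a special point by an integral multiple of the coroot. *)
Lemma weyl_sub_QV w x : weyl w -> special_pt x -> QV (w x - x).
Proof.
move=> Ww sx; elim: Ww => [|f g [alpha /rootsP [p [q [lp lq pq ->]]] ->] Wg IH].
  by rewrite subrr; apply: QV0.
have -> : (rf p q \o g) x - x = (rf p q (g x) - g x) + (g x - x).
  by rewrite /= addrA subrK.
apply: QVD IH; rewrite refl_root0 // addrC addKr; apply: QVN.
have [_ gi] := weyl_special Wg sx.
have /intrP [m ->] : dot (root_of p q) (g x) \is a Num.int by apply/gi/rootsP; exists p, q.
exact/QVZ/QV_coroot.
Qed.

Lemma weyl_QV w x : weyl w -> QV x -> QV (w x).
Proof.
move=> Ww Qx; rewrite -(subrK x (w x)); apply: QVD => //.
exact/weyl_sub_QV/QV_special.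
Qed.

Lemma weyl_affine w : weyl w -> affine_weyl w.
Proof.
elim=> [|f g [alpha ra ->] _ IH]; first by constructor.
by apply: generated_comp IH; exists alpha, 0.
Qed.

Lemma affine_comp f g : affine_weyl f -> affine_weyl g -> affine_weyl (f \o g).
Proof. exact: generated_trans. Qed.

Definition translation (q x : V) : V := x + q.

Lemma translation_comp (q r : V) : translation (q + r) = translation r \o translation q.
Proof. by apply/funext => x; rewrite /translation /= addrA. Qed.

Lemma affine_coroot p q (m : int) : letter p -> letter q -> p != q ->
  affine_weyl (translation (m%:~R *: coroot_of p q)).
Proof.
move=> lp lq pq.
have -> : translation (m%:~R *: coroot_of p q) = refl (root_of p q) (- m) \o rf p q.
  apply/funext => x; rewrite /translation /= reflE // scalerDl opprD addrA -refl_root0 // reflK //.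
  by rewrite intrN scaleNr opprK.
have rr : roots (root_of p q) by apply/rootsP; exists p, q.
apply: generated_comp; first by exists (root_of p q), (- m).
by apply: generated1; exists (root_of p q), 0.
Qed.

Lemma eps_decomp x : apartment x -> x = \sum_(i < ambient t n) x 0 i *: eps i.+1.
Proof.
move=> ax; apply/rowP => j; rewrite summxE.
rewrite (eq_bigr (fun i => x 0 i * (j == i)%:R - x 0 i * shift_const)) => [|i _]; last first.
  by rewrite mxE eps_coord /= gtr0_sgz // !mul1r mulrBr eqSS.
rewrite sumrB -mulr_suml (bigD1 j) //= eqxx mulr1 big1 ?addr0 => [|i ij]; last first.
  by rewrite eq_sym (negPf ij) mulr0.
have : (\sum_i x 0 i) * shift_const = 0; last by move=> ->; rewrite subr0.
move: ax; rewrite /apartment /shift_const /=; move: (\sum_i x 0 i) => S.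
by case: (t) => [->|_|_]; rewrite ?mul0r ?mulr0.
Qed.

(** In type B each eps i is a coroot. In the other types the differences of two
    such vectors are, and they reduce q to a multiple of the last one: the zero
    multiple in type A, and an even multiple, hence a multiple of a coroot, in
    type C. *)
Lemma affine_translation (q : V) : QV q -> affine_weyl (translation q).
Proof.
move=> [aq qi qc]; have id0 : translation 0 = id by apply/funext => x; rewrite /translation addr0.
have sumT (I : eqType) (s : seq I) (F : I -> V) : (forall i, i \in s -> affine_weyl (translation (F i))) ->
    affine_weyl (translation (\sum_(i <- s) F i)).
  elim: s => [|i s IH] H; first by rewrite big_nil id0; constructor.
  rewrite big_cons translation_comp; apply: affine_comp.
    by apply: IH => j js; apply: H; rewrite inE js orbT.
  by apply: H; rewrite mem_head.
pose e (i : 'I_(ambient t n)) : int := i.+1%:Z.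
have lett (i : 'I_(ambient t n)) : letter (e i) by apply: letter_of_ord.
have [tB|nB] : t = TypeB \/ t <> TypeB by case: (t); [right|left|right].
  rewrite (eps_decomp aq); apply: sumT => i _; have /intrP [m ->] := qi i.
  have -> : eps (e i) = coroot_of (e i) (- e i).
    rewrite /coroot_of /coroot_scale eqxx; have -> (a : R) : match t with TypeC => 1 | _ => a end = a by rewrite tB.
    rewrite epsN opprK; move: (eps _) => v; apply/rowP => j.
    by rewrite !mxE half_double.
  have tA : t <> TypeA by rewrite tB.
  by apply: affine_coroot; [exact: lett|by rewrite letterN|rewrite /e; lia].
case nE : (ambient t n) => [|N].
  have -> : q = 0 by apply/rowP => j; have := ltn_ord j; rewrite {2}nE.
  by rewrite id0; constructor.
have ltN : (N < ambient t n)%N by rewrite nE.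
pose L := Ordinal ltN.
have -> : q = \sum_(i < ambient t n) q 0 i *: (eps (e i) - eps (e L)) + (\sum_i q 0 i) *: eps (e L).
  rewrite [LHS](eps_decomp aq) scaler_suml -big_split /=; apply: eq_bigr => i _.
  by rewrite -scalerDr subrK.
rewrite translation_comp; apply: affine_comp.
  have [tA|tC] : t = TypeA \/ t = TypeC by case: (t) nB => // _; [left|right].
    have -> : (\sum_i q 0 i) = 0 by move: aq; rewrite /apartment /=; move: (\sum_i q 0 i) => S; rewrite tA.
    by rewrite scale0r id0; constructor.
  have /intrP [m mE] := qc tC.
  have -> : (\sum_i q 0 i) *: eps (e L) = m%:~R *: coroot_of (e L) (- e L).
    rewrite -mE /coroot_of /coroot_scale; have -> (a : R) : match t with TypeC => 1 | _ => a end = 1 by rewrite tC.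
    rewrite epsN opprK scale1r; move: (eps _) (\sum_j q 0 j) => v S.
    by apply/rowP => j; rewrite !mxE -mulrA mulrCA half_double.
  have tA : t <> TypeA by rewrite tC.
  by apply: affine_coroot; [exact: lett|by rewrite letterN|rewrite /e; lia].
apply: sumT => i _; have /intrP [m ->] := qi i.
have [->|iL] := eqVneq i L; first by rewrite subrr scaler0 id0; constructor.
have eiL : e i != e L by apply: contra iL; rewrite /e eqz_nat eqSS.
have -> : eps (e i) - eps (e L) = coroot_of (e i) (e L).
  rewrite /coroot_of /coroot_scale; have -> : (e L == - e i) = false by rewrite /e; lia.
  by case: (t); rewrite scale1r.
exact: affine_coroot.
Qed.

(** The affine Weyl group is the semidirect product of the Weyl group and the
    translations by the coroot lattice. *)
Lemma affine_weylP f : affine_weyl f <->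
  exists w (q : V), [/\ weyl w, QV q & f = (fun x => w x + q)].
Proof.
split=> [|[w [q [Ww Qq ->]]]]; last first.
  have -> : (fun x => w x + q) = translation q \o w by [].
  by apply: affine_comp; [exact: affine_translation|exact: weyl_affine].
elim=> [|g h [alpha [m [/rootsP [p [r [lp lr pr ->]]] ->]]] _ [w [q [Ww Qq ->]]]].
  exists id, 0; split; [by constructor|exact: QV0|].
  by apply/funext => x; rewrite addr0.
have A := acts_refl lp lr pr.
exists (rf p r \o w), (rf p r q - m%:~R *: coroot_of p r); split.
- by apply: weyl_comp => //; apply: weyl_refl.
- by apply: QVB; [apply: weyl_QV => //; apply: weyl_refl|apply/QVZ/QV_coroot].
- apply/funext => x /=; rewrite addrA -(actsD _ _ A) reflE // scalerDl opprD addrA.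
  by rewrite -refl_root0.
Qed.

(** * Conjugation into the fundamental alcove and into the dominant chamber *)

Lemma int_gap (a : R) : a \is a Num.int -> 0 < a < 1 -> False.
Proof. by move=> /intrP [m ->]; rewrite ltr0z ltrz1 => ?; lia. Qed.

(** The obstruction to the conjugacy of the two ends of an edge; see
    [cell_noconj]. *)
Lemma omega_step_not_QV k : (0 < k <= n)%N -> ~ QV (step_vec k (first_letters k)).
Proof.
move=> /andP[k0 kn] [af fi fc]; have col := first_letters_column kn.
have [sC lC soC nC] := col; have uC := column_uniq col.
have l1 : letter 1 by case: (t) => /=; lia.
have m1 : 1 \in first_letters k by apply/mapP; exists 1%N; rewrite // mem_iota; lia.
have [j j1 _] := letter_ord l1.
have fj : (step_vec k (first_letters k)) 0 j = step_scale k * (1 - shift_const * k%:R).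
  transitivity (dot (eps 1) (step_vec k (first_letters k))).
    by rewrite (dot_eps_ord (p := 1) (j := j) af) // mul1r.
  by rewrite dotZr dot_eps_cvec // sC (mult_column col).
have := fi j; rewrite fj step_scaleE /shift_const => H.
have [tA|tA] := typeA_dec t.
  apply: (int_gap H); rewrite tA mul1r; apply/andP; split.
    by rewrite subr_gt0 mulrC ltr_pdivrMr ?ltr0n // mul1r ltr_nat ltnS.
  by rewrite gtrBl mulr_gt0 ?invr_gt0 ?ltr0n.
have sh0 : (if t is TypeA then n.+1%:R^-1 else 0) = 0 :> R by case: (t) tA.
rewrite sh0 mul0r subr0 mulr1 in H.
have half : ~ (2%:R^-1 : R) \is a Num.int by move=> I; apply: (int_gap I); lra.
have [tB|tC] := typeBC tA; first by apply: half; move: H; rewrite tB.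
move: H; rewrite tC; have [kE|kE] := eqVneq k 1%N => H; last exact: half.
apply: half; have := fc tC; rewrite /step_vec kE.
have -> : step_scale 1 = 1 by rewrite step_scaleE tC.
rewrite scale1r /cvec /first_letters /= big_seq1 sum_eps // mulr1.
by [].
Qed.

Lemma carrier_weyl w x y : weyl w -> carrier x y -> carrier (w x) (w y).
Proof.
move=> Ww [ay H]; have [s A] := weyl_acts Ww; split; first exact: acts_apartment A _ _.
have [w' [Ww' wK w'K]] := weyl_inv Ww; have [s' A'] := weyl_acts Ww'.
move=> alpha m ra; rewrite -(w'K alpha) !(acts_dot A); apply: H; exact: weyl_roots A' ra.
Qed.

Lemma carrier_affine w x y : affine_weyl w -> carrier x y -> carrier (w x) (w y).
Proof.
move=> /affine_weylP [w0 [q [W0 Qq ->]]] xy; rewrite ![_ + q]addrC.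
by apply: carrier_shift; [exact: QV_special|exact: carrier_weyl].
Qed.

Lemma affine_inv w : affine_weyl w -> exists w', [/\ affine_weyl w', cancel w w' & cancel w' w].
Proof.
move=> /affine_weylP [w0 [q [W0 Qq ->]]].
have [w' [Ww' wK w'K]] := weyl_inv W0; have [s A] := weyl_acts W0; have [s' A'] := weyl_acts Ww'.
exists (fun x => w' x + - w' q); split.
- by apply/affine_weylP; exists w', (- w' q); split=> //; apply/QVN/weyl_QV.
- by move=> x; rewrite (actsD _ _ A') wK addrK.
- by move=> x; rewrite (actsD _ _ A) (actsN _ A) !w'K subrK.
Qed.

Lemma affine_carrierE w x : affine_weyl w -> carrier (w x) = w @` carrier x.
Proof.
move=> aw; have [w' [aw' wK w'K]] := affine_inv aw.
apply/seteqP; split=> [y yc|_ [y yc <-]]; last exact: carrier_affine.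
by exists (w' y); rewrite ?w'K //; have := carrier_affine aw' yc; rewrite wK.
Qed.

Lemma affine_apartment w x : affine_weyl w -> apartment x -> apartment (w x).
Proof.
move=> /affine_weylP [w0 [q [W0 [aq _ _] ->]]] ax; apply: apartmentD => //.
by have [s A] := weyl_acts W0; apply: acts_apartment A _ _.
Qed.

Lemma affine_segment w x y : affine_weyl w -> w @` segment x y = segment (w x) (w y).
Proof.
move=> /affine_weylP [w0 [q [W0 Qq ->]]]; have [s A] := weyl_acts W0.
have E (r : R) : w0 (x + r *: (y - x)) + q = w0 x + q + r *: (w0 y + q - (w0 x + q)).
  rewrite (actsD _ _ A) (actsZ _ _ A) (actsB _ _ A); apply/rowP => j; rewrite !mxE; ring.
apply/seteqP; split=> [_ [z /segmentP [r [r01 ->]] <-]|z /segmentP [r [r01 ->]]].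
  by apply/segmentP; exists r; rewrite E.
by exists (x + r *: (y - x)); rewrite ?E //; apply/segmentP; exists r.
Qed.

Lemma affine_vertex w x : affine_weyl w -> is_vertex (w x) <-> is_vertex x.
Proof.
have H f y : affine_weyl f -> is_vertex y -> is_vertex (f y).
  by move=> af /is_vertexP E; apply/is_vertexP; rewrite affine_carrierE // E image_set1.
move=> aw; split; last exact: H.
by have [w' [aw' wK w'K]] := affine_inv aw; move/(H w' _ aw'); rewrite wK.
Qed.

(** A common denominator for the points that occur as vertices or midpoints of
    edges, and for the base point of the fundamental alcove chosen below. *)
Definition grid_den : nat := (8 * n.+1 * (2 * (ambient t n).+1))%N.
Definition grid (x : V) : Prop := forall j, grid_den%:R * x 0 j \is a Num.int.
Definition alcove_pt : V :=
  \row_j ((ambient t n - j)%:R / (2 * (ambient t n).+1)%:R).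
Definition dist2 (x : V) : R := dot (x - alcove_pt) (x - alcove_pt).

(** The squared distances of these points from the base point lie in a discrete
    set. *)
Lemma grid_dist2 x : grid x -> grid_den%:R ^+ 2 * dist2 x \is a Num.int /\ 0 <= dist2 x.
Proof.
move=> gx; split; last by apply: sumr_ge0 => j _; rewrite -expr2 sqr_ge0.
rewrite /dist2 /dot mulr_sumr rpred_sum // => j _.
rewrite -expr2 -exprMn rpredX // mxE mulrDr rpredD ?gx //.
rewrite mxE mulrN rpredN mxE /grid_den natrM mulrCA -mulrA mulrCA mulfV ?mulr1; last by rewrite pnatr_eq0.
by rewrite -natrM rpred_nat.
Qed.

Lemma dot_epsB_gen p q (i j : 'I_(ambient t n)) x : letter p -> letter q ->
  `|p|%N = i.+1 -> `|q|%N = j.+1 ->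
  dot (eps p - eps q) x = (sgz p)%:~R * x 0 i - (sgz q)%:~R * x 0 j.
Proof.
move=> lp lq pi qj; rewrite /dot.
have pick (k : 'I_(ambient t n)) (a : R) : \sum_l a * (l == k)%:R * x 0 l = a * x 0 k.
  by rewrite (bigD1 k) //= eqxx mulr1 big1 ?addr0 // => l /negPf lk; rewrite [l == k]lk mulr0 mul0r.
rewrite -(pick i) -(pick j) -sumrB; apply: eq_bigr => l _; rewrite -mulrBl; congr (_ * _).
rewrite mxE [X in _ + X]mxE !eps_coord pi qj !eqSS.
suff -> : (sgz p)%:~R * shift_const = (sgz q)%:~R * shift_const :> R by rewrite -[l == i]/(l == i); ring.
rewrite /shift_const; move: lp lq; case: (t) => [|_ _|_ _]; rewrite ?mulr0 //.
by move=> /letter_pos /gtr0_sgz -> /letter_pos /gtr0_sgz ->.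
Qed.

Lemma alcove_pt_coord j : alcove_pt 0 j = (ambient t n - j)%:R / (2 * (ambient t n).+1)%:R.
Proof. by rewrite mxE. Qed.

(** The base point is an interior point of the fundamental alcove. *)
Lemma pos_root_alcove_pt alpha : pos_roots alpha -> 0 < dot alpha alcove_pt < 1.
Proof.
move=> /pos_rootsP [p [q [lp lq pq ->]]].
have [i pi _] := letter_ord lp; have [j qj _] := letter_ord lq.
have p0 := letter_neq0 lp; have q0 := letter_neq0 lq.
have di : 0 < (2 * (ambient t n).+1)%:R :> R by rewrite ltr0n.
have E : dot (eps p - eps q) alcove_pt =
    ((sgz p * (ambient t n - i)%:Z - sgz q * (ambient t n - j)%:Z)%R)%:~R / (2 * (ambient t n).+1)%:R.
  by rewrite (dot_epsB_gen _ lp lq pi qj) !alcove_pt_coord !mulrA -mulrBl intrB !intrM.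
rewrite /root_of dotZl E; set m := (_ - _ : int); have : 0 < m < (2 * (ambient t n).+1)%N%:Z.
  have := ltn_ord i; have := ltn_ord j; move: pq; rewrite letter_ltE /m.
  by case: (sgzP p) p0 => //; case: (sgzP q) q0 => //; lia.
move=> /andP[m0 m1]; have s0 := root_scale_gt0 p q; apply/andP; split.
  by rewrite mulr_gt0 ?divr_gt0 ?ltr0z.
have s1 : root_scale p q <= 1.
  rewrite /root_scale; case: (t) => //; case: ifP => // _.
  by rewrite invf_le1 ?ltr0n // ler1n.
apply: le_lt_trans (_ : 1 * (m%:~R / (2 * (ambient t n).+1)%:R) < 1).
  by apply: ler_wpM2r => //; rewrite divr_ge0 ?ler0n // ler0z ltW.
rewrite mul1r ltr_pdivrMr // mul1r -[X in _ < X]/(((2 * (ambient t n).+1)%N%:Z)%:~R).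
by rewrite ltr_int.
Qed.

(** A reflection in a wall that separates x from the base point brings x closer
    to it. *)
Lemma reflect_closer alpha m x : pos_roots alpha ->
  (dot alpha x + m%:~R) * (dot alpha alcove_pt + m%:~R) < 0 ->
  dist2 (refl alpha m x) < dist2 x.
Proof.
move=> /pos_rootsP [p [q [lp lq pq ->]]]; have npq := letter_lt_neq pq.
rewrite reflE // /dist2; set c := dot _ x + _; set d := dot _ alcove_pt + _.
have := dot_root_coroot lp lq npq.
have s0 := root_scale_gt0 p q.
have s'0 : 0 < coroot_scale p q.
  by rewrite /coroot_scale; case: (t) => //; case: ifP => // _; rewrite invr_gt0 ltr0n.
have cE : coroot_of p q = (coroot_scale p q / root_scale p q) *: root_of p q.
  by rewrite /root_of scalerA divfK ?gt_eqF.
rewrite cE; set g := _ / _; have g0 : 0 < g by rewrite divr_gt0.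
rewrite dotZr => gaa cd; have -> : x - c *: (g *: root_of p q) - alcove_pt =
    (x - alcove_pt) - (c * g) *: root_of p q.
  by rewrite scalerA addrAC.
have yE : dot (root_of p q) (x - alcove_pt) = c - d.
  by rewrite dotBr /c /d; ring.
move: (x - alcove_pt) (root_of p q) yE gaa => y a yE gaa.
rewrite !dotBl !dotBr !dotZl !dotZr (dotC y a) yE.
have -> : dot y y - c * g * (c - d) - (c * g * (c - d) - c * g * (c * g * dot a a)) =
   dot y y + g * (2%:R * (c * d) + c ^+ 2 * (g * dot a a - 2%:R)) by ring.
rewrite gaa subrr mulr0 addr0 gtrDl pmulr_rlt0 //.
by rewrite pmulr_rlt0 ?ltr0n.
Qed.

Lemma grid_root alpha x : roots alpha -> apartment x -> grid x ->
  grid_den%:R * dot alpha x \is a Num.int.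
Proof.
move=> ra ax gx; rewrite -dotZr.
have [|_ H] := @int_coords_special (grid_den%:R *: x) (apartmentZ _ ax); last exact: H.
by move=> j; rewrite mxE.
Qed.

Lemma grid_refl alpha m x : roots alpha -> apartment x -> grid x -> grid (refl alpha m x).
Proof.
move=> ra ax gx; have K := grid_root ra ax gx.
move: ra K => /rootsP [p [q [lp lq pq ->]]] K j; rewrite reflE // mxE [X in _ + X]mxE.
rewrite mulrDr rpredD ?gx // mulrN rpredN mxE mulrA rpredM //.
  by rewrite mulrDr rpredD ?K // rpredM ?rpred_nat ?intr_int.
by have [_ I _] := QV_coroot lp lq pq.
Qed.

Lemma special_grid x : special_pt x -> grid (4%:R^-1 *: x).
Proof.
move=> [ax xi] j; rewrite mxE.
have -> : grid_den%:R * (4%:R^-1 * x 0 j) = (2 * (ambient t n).+1)%:R * ((2 * n.+1)%:R * x 0 j).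
  by rewrite /grid_den !natrM; field.
rewrite rpredM ?rpred_nat //.
have lj := letter_of_ord j.
have cj : dot (eps j.+1) x = x 0 j by rewrite (dot_eps_ord (p := j.+1%:Z) (j := j) ax) // gtr0_sgz // mul1r.
have [tA|tA] := typeA_dec t.
  rewrite natrM -mulrA rpredM ?rpred_nat //.
  have -> : n.+1%:R * x 0 j = \sum_(i <- iota 1 n.+1) (dot (eps j.+1) x - dot (eps i%:Z) x).
    rewrite sumrB sum_dot_eps // subr0 big_const_seq count_predT size_iota iter_addr addr0.
    by rewrite cj mulr_natl.
  rewrite big_seq rpred_sum // => i; rewrite mem_iota => iN.
  have li : letter i by rewrite tA /=; lia.
  have [->|ji] := eqVneq j.+1%:Z i%:Z; first by rewrite subrr rpred0.
  have := xi (root_of j.+1 i) _; rewrite dot_root /root_scale.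
  have -> (a b : R) : match t with TypeC => a | _ => b end = b by rewrite tA.
  by rewrite mul1r; apply; apply/rootsP; exists j.+1%:Z, i%:Z.
have lNj : letter (- j.+1%:Z) by rewrite letterN.
have := xi (root_of j.+1 (- j.+1%:Z)) _; rewrite dot_root dot_eps_opp opprK cj => H.
have {}H : root_scale j.+1 (- j.+1%:Z) * (x 0 j + x 0 j) \is a Num.int.
  by apply: H; apply/rootsP; exists j.+1%:Z, (- j.+1%:Z); split=> //; lia.
rewrite mulnC natrM -mulrA rpredM ?rpred_nat // mulr_natl mulr2n.
move: H; rewrite /root_scale eqxx; case: (typeBC tA) => tE.
  have -> (a b : R) : match t with TypeC => a | _ => b end = b by rewrite tE.
  by rewrite mul1r.
have -> (a b : R) : match t with TypeC => a | _ => b end = a by rewrite tE.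
by rewrite half_double => H; rewrite rpredD.
Qed.

(** As long as some wall of a family separates the point from the base point,
    reflect in it. The squared distance decreases in a discrete set, so this
    stops. The family of all walls leads into the fundamental alcove, that of
    the walls through the origin into the dominant chamber. *)
Lemma descent (G : set (V -> V)) (P : set V) : G id ->
  (forall alpha m g, roots alpha -> G (refl alpha m) -> G g -> G (g \o refl alpha m)) ->
  (forall x, apartment x -> P x \/ exists alpha m, [/\ pos_roots alpha, G (refl alpha m) &
      (dot alpha x + m%:~R) * (dot alpha alcove_pt + m%:~R) < 0]) ->
  forall x, apartment x -> grid x -> exists2 g, G g & P (g x).
Proof.
move=> G1 GM step x ax gx.
have [m] : exists m : nat, grid_den%:R ^+ 2 * dist2 x <= m%:R.
  have [/intrP [k ->] d0] := grid_dist2 gx; exists `|k|%N.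
  by rewrite natr_absz intr_norm ler_norm.
elim: m x ax gx => [|m IH] x ax gx dx.
  have [Px|[alpha [m [pa _ neg]]]] := step x ax; first by exists id.
  exfalso; have lt := reflect_closer pa neg.
  have [_ d0] := grid_dist2 (grid_refl m (or_introl pa) ax gx).
  have K0 : 0 < grid_den%:R ^+ 2 :> R by rewrite exprn_gt0 // ltr0n.
  by move: dx; rewrite leNgt mulr_gt0 // (le_lt_trans d0).
have [Px|[alpha [k [pa Gr neg]]]] := step x ax; first by exists id.
have lt := reflect_closer pa neg; have ra : roots alpha by left.
have gr := grid_refl k ra ax gx.
have ar : apartment (refl alpha k x).
  by apply: affine_apartment => //; apply: generated1; exists alpha, k.
have [|g Gg Pg] := IH (refl alpha k x) ar gr; last by exists (g \o refl alpha k); first exact: GM.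
have [/intrP [a aE] _] := grid_dist2 gx; have [/intrP [b bE] _] := grid_dist2 gr.
have K0 : 0 < grid_den%:R ^+ 2 :> R by rewrite exprn_gt0 // ltr0n.
have : grid_den%:R ^+ 2 * dist2 (refl alpha k x) < grid_den%:R ^+ 2 * dist2 x by rewrite ltr_pM2l.
move: dx; rewrite aE bE ltr_int -[m.+1%:R]/(m.+1%:Z%:~R) -[m%:R]/(m%:Z%:~R) !ler_int.
by lia.
Qed.

Lemma alcove_conj x : apartment x -> grid x ->
  exists2 w, affine_weyl w & fundamental_alcove R t n (w x).
Proof.
move=> ax gx; pose P y := apartment y -> fundamental_alcove R t n y.
have [|||w aw Pw] := @descent affine_weyl P _ _ _ x ax gx.
- by constructor.
- by move=> alpha m g _ H1 H2; apply: affine_comp.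
- move=> y ay; case: (pselect (fundamental_alcove R t n y)) => [Fy|nF]; [by left|right].
  case: (pselect (exists2 alpha, pos_roots alpha & ~~ (0 <= dot alpha y <= 1))) => [[alpha pa no]|no].
    have /andP[r0 r1] := pos_root_alcove_pt pa.
    have gen m : affine_weyl (refl alpha m) by apply: generated1; exists alpha, m; split=> //; left.
    have [neg|pos] := ltP (dot alpha y) 0.
      exists alpha, 0; split=> //; rewrite !addr0; nra.
    exists alpha, (-1); split=> //; rewrite intrN; move: no; rewrite pos -ltNge; nra.
  exfalso; apply: nF; split=> // alpha pa; apply/negPn/negP => H; apply: no; by exists alpha.
- by exists w => //; apply: Pw; apply: affine_apartment.
Qed.

Lemma dominant_conj x : apartment x -> grid x ->
  exists2 w, weyl w & dominant_chamber R t n (w x).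
Proof.
move=> ax gx; pose P y := apartment y -> dominant_chamber R t n y.
have [|||w aw Pw] := @descent weyl P _ _ _ x ax gx.
- by constructor.
- by move=> alpha m g _ H1 H2; apply: weyl_comp.
- move=> y ay; case: (pselect (dominant_chamber R t n y)) => [Fy|nF]; [by left|right].
  case: (pselect (exists2 alpha, pos_roots alpha & dot alpha y < 0)) => [[alpha pa neg]|no].
    have /andP[r0 r1] := pos_root_alcove_pt pa.
    exists alpha, 0; split=> //; last by rewrite !addr0; nra.
    by apply: generated1; exists alpha => //; left.
  exfalso; apply: nF; split=> // alpha pa; rewrite leNgt; apply/negP => H; apply: no; by exists alpha.
- exists w => //; apply: Pw; apply: affine_apartment => //; exact: weyl_affine.
Qed.

(** * Galleries along paths *)

Local Notation gallery := (gallery R t n).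
Local Notation Gallery := (Gallery R t n).
Local Notation source := (source R t n).
Local Notation steps := (steps R t n).
Local Notation target := (target R t n).
Local Notation vertex_at := (vertex_at R t n).
Local Notation edge_at := (edge_at R t n).
Local Notation concat := (concat R t n).

Fixpoint path_steps (x : V) (l : seq V) : seq (set V * V) :=
  if l is v :: l' then (segment x (x + v), x + v) :: path_steps (x + v) l' else [::].

Definition path_gallery (l : seq V) : gallery := Gallery 0 (path_steps 0 l).

Definition partial_sum (l : seq V) (k : nat) : V := \sum_(v <- take k l) v.

Lemma partial_sum0 l : partial_sum l 0 = 0.
Proof. by rewrite /partial_sum take0 big_nil. Qed.

Lemma partial_sum_cons v l k : partial_sum (v :: l) k.+1 = v + partial_sum l k.
Proof. by rewrite /partial_sum /= big_cons. Qed.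

Lemma partial_sum_size l : partial_sum l (size l) = \sum_(v <- l) v.
Proof. by rewrite /partial_sum take_size. Qed.

Lemma partial_sumS l k : (k < size l)%N -> partial_sum l k.+1 = partial_sum l k + nth 0 l k.
Proof. by move=> kl; rewrite /partial_sum (take_nth 0 kl) -cats1 big_cat big_seq1. Qed.

Lemma size_path_steps x l : size (path_steps x l) = size l.
Proof. by elim: l x => //= v l IH x; rewrite IH. Qed.

Lemma vertex_path_steps x l k : (k <= size l)%N ->
  nth 0 (x :: unzip2 (path_steps x l)) k = x + partial_sum l k.
Proof.
elim: l x k => [|v l IH] x [|k] //= kl; rewrite ?partial_sum0 ?addr0 //.
by rewrite partial_sum_cons addrA -IH.
Qed.

Lemma edge_path_steps x l k : (k < size l)%N ->
  nth set0 (unzip1 (path_steps x l)) k = segment (x + partial_sum l k) (x + partial_sum l k.+1).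
Proof.
elim: l x k => [|v l IH] x [|k] //= kl.
  by rewrite partial_sum_cons !partial_sum0 !addr0.
by rewrite !partial_sum_cons !addrA -IH.
Qed.

Lemma size_path l : size (steps (path_gallery l)) = size l.
Proof. exact: size_path_steps. Qed.

Lemma vertex_path l k : (k <= size l)%N -> vertex_at (path_gallery l) k = partial_sum l k.
Proof. by move=> kl; rewrite /vertex_at vertex_path_steps // add0r. Qed.

Lemma edge_path l k : (k < size l)%N ->
  edge_at (path_gallery l) k = segment (partial_sum l k) (partial_sum l k.+1).
Proof. by move=> kl; rewrite /edge_at edge_path_steps // !add0r. Qed.

Lemma target_vertex g : target g = vertex_at g (size (steps g)).
Proof. by rewrite /target /vertex_at (last_nth 0) size_map. Qed.

Lemma target_path l : target (path_gallery l) = \sum_(v <- l) v.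
Proof. by rewrite target_vertex size_path vertex_path // partial_sum_size. Qed.

Lemma path_steps_cat x l1 l2 :
  path_steps x (l1 ++ l2) = path_steps x l1 ++ path_steps (x + \sum_(v <- l1) v) l2.
Proof.
elim: l1 x => [|v l1 IH] x /=; first by rewrite big_nil addr0.
by rewrite IH big_cons addrA.
Qed.

Lemma path_steps_shift u x l :
  path_steps (u + x) l = [seq ((fun z => u + z) @` c.1, u + c.2) | c <- path_steps x l].
Proof.
by elim: l x => //= v l IH x; rewrite -addrA segment_shift IH.
Qed.

Lemma concat_path l1 l2 : concat (path_gallery l1) (path_gallery l2) = path_gallery (l1 ++ l2).
Proof.
rewrite /concat target_path /path_gallery /= path_steps_cat add0r subr0.
by rewrite -path_steps_shift addr0.
Qed.

Lemma path_gallery_inj : injective path_gallery.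
Proof.
move=> l l' /(congr1 steps) /=; move: (0) => x.
elim: l l' x => [|v l IH] [|v' l'] x //= [_ /addrI -> E]; congr (_ :: _); exact: IH E.
Qed.

Lemma gallery_ext g h : source g = source h -> size (steps g) = size (steps h) ->
  (forall k, (k <= size (steps g))%N -> vertex_at g k = vertex_at h k) ->
  (forall k, (k < size (steps g))%N -> edge_at g k = edge_at h k) -> g = h.
Proof.
case: g => x gs; case: h => y hs /= -> ss Hv He; congr Gallery.
apply: (eq_from_nth (x0 := (set0, y))) => // k kg.
have kh : (k < size hs)%N by rewrite -ss.
have := He k kg; have := Hv k.+1 kg; rewrite /vertex_at /edge_at /=.
rewrite !(nth_map (set0, y)) //.
by case: (nth _ gs k) => a b; case: (nth _ hs k) => c d /= -> ->.
Qed.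

(** A gallery whose edges are the segments between its vertices is determined by
    the differences of successive vertices. *)
Lemma path_of_vertices g (x : nat -> V) : source g = 0 -> x 0%N = 0 ->
  (forall k, (k <= size (steps g))%N -> vertex_at g k = x k) ->
  (forall k, (k < size (steps g))%N -> edge_at g k = segment (x k) (x k.+1)) ->
  g = path_gallery [seq x k.+1 - x k | k <- iota 0 (size (steps g))].
Proof.
move=> g0 x0 Hv He; set l := map _ _.
have sl : size l = size (steps g) by rewrite size_map size_iota.
have ps k : (k <= size l)%N -> partial_sum l k = x k.
  elim: k => [|k IH] kl; first by rewrite partial_sum0 x0.
  rewrite partial_sumS // IH ?(ltnW kl) // (nth_map 0%N) ?nth_iota ?size_iota -?sl //.
  by rewrite add0n addrC subrK.
apply: gallery_ext => // [|k kg|k kg]; first by rewrite size_path sl.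
  by rewrite Hv // vertex_path ?sl // ps ?sl.
by rewrite He // edge_path ?sl // !ps ?sl // ltnW.
Qed.

(** * Tableaux as paths *)

(** The two half steps of a block differ by a vector of the coroot lattice: this
    makes the end of the block special and gives its second edge the type of the
    reference edge. [linkedP] makes the condition explicit. *)
Definition linked (C C' : seq int) : Prop := QV (2%:R^-1 *: (cvec C - cvec C')).

(** Tableaux read block by block, from right to left: one column for a minuscule
    coweight, and two columns otherwise. *)
Fixpoint word_tableau (w : seq nat) (T : tableau) : Prop :=
  if w is i :: w' then
    if is_min i then exists C T', [/\ T = C :: T', is_column i C & word_tableau w' T']
    else exists C C' T', [/\ T = C :: C' :: T', is_column i C, is_column i C', linked C C' &
                             word_tableau w' T']
  else T = [::].

Definition ref_block (i : nat) : tableau :=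
  if is_min i then [:: first_letters i] else [:: first_letters i; first_letters i].

(** The tableau of the gallery gamma_lambda. *)
Definition ref_tableau (w : seq nat) : tableau := flatten [seq ref_block i | i <- w].

Definition tableau_steps (T : tableau) : seq V := [seq step_vec (size C) C | C <- T].

Definition good_word (w : seq nat) : Prop := all (fun i => 0 < i <= n)%N w.

Lemma linked_refl C : linked C C.
Proof. by rewrite /linked subrr scaler0; apply: QV0. Qed.

Lemma ref_word_tableau w : good_word w -> word_tableau w (ref_tableau w).
Proof.
elim: w => //= i w IH /andP[/andP[i0 i_n] gw]; have col := first_letters_column i_n.
rewrite /ref_tableau /= -/(ref_tableau w) /ref_block; case: (is_min i) => /=.
  by exists (first_letters i), (ref_tableau w); split=> //; apply: IH.
exists (first_letters i), (first_letters i), (ref_tableau w); split=> //; first exact: linked_refl.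
exact: IH.
Qed.

Lemma column_weyl k C : (k <= n)%N -> is_column k C -> exists w s,
  [/\ weyl w, acts w s, w (cvec (first_letters k)) = cvec C &
      forall j : nat, (0 < j <= k)%N -> s j = entry C j].
Proof.
move=> kn col; have [w [s [Ww A sE]]] := column_exists_weyl kn col.
exists w, s; split=> //; rewrite (acts_cvec A); last by case: (first_letters_column kn).
have [sC _ _ _] := col; rewrite -(images_entry sC sE).
by rewrite /first_letters -map_comp.
Qed.

Lemma column_special k C : (0 < k <= n)%N -> is_column k C ->
  special_pt (weight_scale k *: cvec C).
Proof.
move=> /andP[k0 kn] col; have [w [s [Ww A wE _]]] := column_weyl kn col.
by rewrite -wE -(actsZ _ _ A) -omegaE; apply: weyl_special => //; apply: omega_special; lia.
Qed.

Lemma step_min k C : is_min k -> step_vec k C = weight_scale k *: cvec C.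
Proof. by move=> m; rewrite /step_vec /step_scale m mul1r. Qed.

Lemma weight_scale_nmin k : ~~ is_min k -> weight_scale k = 1.
Proof.
by rewrite /is_min /weight_scale; case: (t) => //=; case: eqP.
Qed.

Lemma step_nmin k C : ~~ is_min k -> step_vec k C = 2%:R^-1 *: cvec C.
Proof. by move=> m; rewrite /step_vec /step_scale (negPf m) weight_scale_nmin // mulr1. Qed.

Lemma step_weyl k C w : weyl w -> w (cvec (first_letters k)) = cvec C ->
  w (step_vec k (first_letters k)) = step_vec k C.
Proof. by move=> Ww E; have [s A] := weyl_acts Ww; rewrite /step_vec (actsZ _ _ A) E. Qed.

Lemma step_not_QV k C : (0 < k <= n)%N -> is_column k C -> ~ QV (step_vec k C).
Proof.
move=> kn col; have kn' : (k <= n)%N by lia.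
have [w [s [Ww A wE _]]] := column_weyl kn' col.
have [w' [Ww' wK w'K]] := weyl_inv Ww.
by rewrite -(step_weyl Ww wE) => /(weyl_QV Ww'); rewrite wK; apply: omega_step_not_QV.
Qed.

(** The edges that occur, with their two ends in either order: one end is
    special, and the other one is not congruent to it modulo the coroot lattice.
    The condition on g + g puts the ends and the midpoint on the grid. *)
Definition cell (x y : V) : Prop := exists U g,
  [/\ special_pt U, edge_vec g /\ ~ QV g, special_pt (g + g), is_vertex (U + g) &
      x = U /\ y = U + g \/ x = U + g /\ y = U].

(** Simultaneous conjugacy of two pairs of points under the affine Weyl group,
    with the conjugating element in normal form. *)
Definition conj_pair (x y x0 y0 : V) : Prop := exists w (q : V),
  [/\ weyl w, QV q, x = w x0 + q & y = w y0 + q].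

Lemma vertex_shift U v : special_pt U -> is_vertex v -> is_vertex (U + v).
Proof.
by move=> sU /is_vertexP E; apply/is_vertexP; rewrite carrier_shiftE // E image_set1.
Qed.

Lemma column_step_special k C : (0 < k <= n)%N -> is_column k C ->
  special_pt (step_vec k C + step_vec k C).
Proof.
move=> kn col; have sC := column_special kn col.
have [m|m] := boolP (is_min k); first by rewrite step_min //; apply: special_ptD.
have := sC; rewrite weight_scale_nmin // scale1r step_nmin //.
by have -> : 2%:R^-1 *: cvec C + 2%:R^-1 *: cvec C = cvec C by
  apply/rowP => j; rewrite !mxE -mulrDr half_double.
Qed.

Lemma conj_step k C U U0 w : (0 < k <= n)%N -> is_column k C -> special_pt U0 -> QV (U - U0) ->
  weyl w -> w (cvec (first_letters k)) = cvec C ->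
  conj_pair U (U + step_vec k C) U0 (U0 + step_vec k (first_letters k)).
Proof.
move=> kn col sU0 UU0 Ww wE; have [s A] := weyl_acts Ww.
exists w, (U - w U0); split=> //.
- have -> : U - w U0 = (U - U0) - (w U0 - U0) by rewrite opprB addrA subrK.
  by apply: QVB => //; apply: weyl_sub_QV.
- by rewrite addrC subrK.
- by rewrite (actsD _ _ A) (step_weyl Ww wE) [RHS]addrC addrA subrK.
Qed.

(** Walking through one block of a tableau and of the reference tableau in
    parallel, the two positions stay special, and congruent modulo the coroot
    lattice. *)
Lemma min_block k C U U0 : (0 < k <= n)%N -> is_min k -> is_column k C ->
  special_pt U -> special_pt U0 -> QV (U - U0) ->
  let f := step_vec k C in let f0 := step_vec k (first_letters k) in
  [/\ cell U (U + f), conj_pair U (U + f) U0 (U0 + f0), special_pt (U + f),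
      special_pt (U0 + f0) & QV (U + f - (U0 + f0))].
Proof.
move=> kn m col sU sU0 UU0 f f0; have kn' : (k <= n)%N by lia.
have [w [s [Ww A wE _]]] := column_weyl kn' col.
have sf : special_pt f by rewrite /f step_min //; apply: column_special.
have sf0 : special_pt f0.
  by rewrite /f0 step_min //; apply: column_special => //; apply: first_letters_column.
split.
- exists U, f; split=> //; [|exact: special_ptD| |by left].
    by split; [exact: step_edge_vec|exact: step_not_QV].
  by apply: special_vertex; apply: special_ptD.
- exact: conj_step wE.
- exact: special_ptD.
- exact: special_ptD.
- have -> : U + f - (U0 + f0) = (U - U0) + (w f0 - f0) by rewrite /f0 (step_weyl Ww wE) opprD addrACA.
  by apply: QVD => //; apply: weyl_sub_QV.
Qed.

(** The sum of the two half steps is the weight of the first column up to the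
    vector in the condition on the two columns, so that the end is again
    special. *)
Lemma nmin_block k C C' U U0 : (0 < k <= n)%N -> ~~ is_min k -> is_column k C -> is_column k C' ->
  linked C C' -> special_pt U -> special_pt U0 -> QV (U - U0) ->
  let f := step_vec k C in let f' := step_vec k C' in
  let f0 := step_vec k (first_letters k) in
  [/\ cell U (U + f) /\ cell (U + f) (U + f + f'),
      conj_pair U (U + f) U0 (U0 + f0) /\ conj_pair (U + f) (U + f + f') (U0 + f0) (U0 + f0 + f0),
      special_pt (U + f + f'),
      special_pt (U0 + f0 + f0) & QV (U + f + f' - (U0 + f0 + f0))].
Proof.
move=> kn m col col' lk sU sU0 UU0 f f' f0; have kn' : (k <= n)%N by lia.
have col0 := first_letters_column kn'.
have [w [s [Ww A wE _]]] := column_weyl kn' col.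
have [w' [s' [Ww' A' wE' _]]] := column_weyl kn' col'.
have dbl (v : V) : 2%:R^-1 *: v + 2%:R^-1 *: v = v.
  by apply/rowP => j; rewrite !mxE -mulrDr half_double.
have cl : QV (f - f') by rewrite /f /f' !step_nmin // -scalerBr.
have csp D : is_column k D -> special_pt (cvec D).
  by move=> cD; have := column_special kn cD; rewrite weight_scale_nmin // scale1r.
have ff : f + f = cvec C by rewrite /f step_nmin // dbl.
have ff0 : f0 + f0 = cvec (first_letters k) by rewrite /f0 step_nmin // dbl.
have sum : U + f + f' = U + cvec C - (f - f').
  by rewrite -ff; move: (f) (f') => a b; apply/rowP => j; rewrite !mxE; ring.
have s2 : special_pt (U + f + f').
  by rewrite sum; apply: special_ptB (QV_special cl); apply: special_ptD (csp _ col).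
have s02 : special_pt (U0 + f0 + f0) by rewrite -addrA ff0; apply: special_ptD (csp _ col0).
have vf : is_vertex (U + f) by apply: vertex_shift => //; apply: mid_vertex.
split=> //.
- split; first exists U, f.
    split=> //; [|exact: column_step_special|by left].
    by split; [exact: step_edge_vec|exact: step_not_QV].
  exists (U + f + f'), (- f'); split=> //.
  + split; first exact/edge_vecN/step_edge_vec.
    by move/QVN; rewrite opprK; apply: step_not_QV.
  + by rewrite -opprD; apply/special_ptN/column_step_special.
  + by rewrite addrK.
  + by right; rewrite addrK.
- split; first exact: conj_step wE.
  exists w', (U + f - w' (U0 + f0)); split=> //.
  + have E : w' f0 = f' by apply: step_weyl.
    have -> : U + f - w' (U0 + f0) = (U - U0) - (w' U0 - U0) + (f - f').
      by rewrite (actsD _ _ A') E; apply/rowP => j; rewrite !mxE; ring.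
    by apply: QVD cl; apply: QVB => //; apply: weyl_sub_QV.
  + by rewrite [RHS]addrC subrK.
  + rewrite [w' (U0 + f0 + f0)](actsD _ _ A') (step_weyl Ww' wE') -/f'.
    by move: (w' _) (U + f) (f') => a b c; apply/rowP => j; rewrite !mxE; ring.
- rewrite sum -[U0 + f0 + f0]addrA ff0.
  have -> : U + cvec C - (f - f') - (U0 + cvec (first_letters k)) =
    (U - U0) + (w (cvec (first_letters k)) - cvec (first_letters k)) - (f - f').
    by rewrite wE; apply/rowP => j; rewrite !mxE; ring.
  by apply: QVB cl; apply: QVD => //; apply: weyl_sub_QV => //; apply: csp.
Qed.

Lemma word_tableau_cells w T U U0 : good_word w -> word_tableau w T ->
  special_pt U -> special_pt U0 -> QV (U - U0) ->
  let l := tableau_steps T in let l0 := tableau_steps (ref_tableau w) in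
  [/\ size l = size l0, special_pt (U + \sum_(v <- l) v) &
      forall k, (k < size l)%N ->
        cell (U + partial_sum l k) (U + partial_sum l k.+1) /\
        conj_pair (U + partial_sum l k) (U + partial_sum l k.+1)
                  (U0 + partial_sum l0 k) (U0 + partial_sum l0 k.+1)].
Proof.
elim: w T U U0 => [|i w IH] T U U0 /=.
  by move=> _ -> sU sU0 UU0; rewrite /= big_nil addr0.
move=> /andP[i_n gw]; rewrite /ref_tableau /= -/(ref_tableau w) /ref_block.
have i_n' : (i <= n)%N by lia.
have [sF _ _ _] := first_letters_column i_n'.
have [m|m] := boolP (is_min i).
  move=> [C [T' [-> col wT]]] sU sU0 UU0; have [sC _ _ _] := col.
  have [c1 c2 s1 s2 q1] := min_block i_n m col sU sU0 UU0.
  have [ss sp H] := IH T' _ _ gw wT s1 s2 q1.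
  rewrite /tableau_steps /= sC sF -/(tableau_steps T') -/(tableau_steps (ref_tableau w)).
  split; [by rewrite /= ss|by rewrite big_cons addrA|].
  move=> [|k] kl; first by rewrite !partial_sum_cons !partial_sum0 !addr0.
  by rewrite !partial_sum_cons !addrA; apply: H.
move=> [C [C' [T' [-> col col' lk wT]]]] sU sU0 UU0; have [sC _ _ _] := col; have [sC' _ _ _] := col'.
have [[c1 c1'] [c2 c2'] s1 s2 q1] := nmin_block i_n m col col' lk sU sU0 UU0.
have [ss sp H] := IH T' _ _ gw wT s1 s2 q1.
rewrite /tableau_steps /= sC sC' sF -/(tableau_steps T') -/(tableau_steps (ref_tableau w)).
split; [by rewrite /= ss|by rewrite !big_cons !addrA|].
move=> [|[|k]] kl; first by rewrite !partial_sum_cons !partial_sum0 !addr0.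
  by rewrite !partial_sum_cons !partial_sum0 !addr0 !addrA.
by rewrite !partial_sum_cons !addrA; apply: H.
Qed.

(** * The types of the galleries along tableaux *)

Local Notation face_type := (face_type R t n).
Local Notation is_gallery := (is_gallery R t n).
Local Notation same_type := (same_type R t n).
Local Notation is_gamma_omega := (is_gamma_omega R t n).
Local Notation is_gamma_word := (is_gamma_word R t n).

Lemma cell_sym x y : cell x y -> cell y x.
Proof. by move=> [U [g [sU eg s2 v [[-> ->]|[-> ->]]]]]; exists U, g; split=> //; [right|left]. Qed.

Lemma cell_edge x y : cell x y -> is_edge (segment x y).
Proof.
by move=> [U [g [sU [eg nq] _ _ [[-> ->]|[-> ->]]]]]; rewrite 1?[segment (U + g) _]segmentC; apply: is_edge_seg.
Qed.

Lemma cell_vertex x y : cell x y -> is_vertex x.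
Proof. by move=> [U [g [sU [eg nq] _ v [[-> _]|[-> _]]]]] //; apply: special_vertex. Qed.

Lemma cell_edge_vertex x y z : cell x y -> segment x y z -> is_vertex z -> z = x \/ z = y.
Proof.
move=> [U [g [sU [eg nq] _ _ [[-> ->]|[-> ->]]]]]; last rewrite segmentC;
  by move=> H1 H2; have [] := edge_vertex sU eg H1 H2; auto.
Qed.

Lemma cell_grid x y : cell x y -> grid x.
Proof.
have quarter a : special_pt (a + a + (a + a)) -> grid a.
  move=> /special_grid; have -> // : 4%:R^-1 *: (a + a + (a + a)) = a.
  by apply/rowP => j; rewrite !mxE; field.
move=> [U [g [sU [eg nq] s2 _ [[-> _]|[-> _]]]]]; apply: quarter.
  by do 2 apply: special_ptD => //; apply: special_ptD.
have -> : U + g + (U + g) + (U + g + (U + g)) = (U + U + (U + U)) + (g + g + (g + g)).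
  by apply/rowP => j; rewrite !mxE; ring.
by apply: special_ptD; [do 2 apply: special_ptD => //; apply: special_ptD|apply: special_ptD].
Qed.

Lemma cell_carrier x y : cell x y -> exists z, [/\ apartment z, grid z & segment x y = carrier z].
Proof.
have quarter a : special_pt (a + a + (a + a)) -> grid a.
  move=> /special_grid; have -> // : 4%:R^-1 *: (a + a + (a + a)) = a.
  by apply/rowP => j; rewrite !mxE; field.
move=> [U [g [sU [eg nq] s2 _ E]]]; have [ag _ _] := eg; have [aU _] := sU.
exists (U + 2%:R^-1 *: g); split; first by apply/apartmentD/apartmentZ.
  apply: quarter; have -> : U + 2%:R^-1 *: g + (U + 2%:R^-1 *: g) +
      (U + 2%:R^-1 *: g + (U + 2%:R^-1 *: g)) = (U + U + (U + U)) + (g + g).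
    by apply/rowP => j; rewrite !mxE; field.
  by apply: special_ptD s2; do 2 apply: special_ptD => //; apply: special_ptD.
rewrite (edge_carrier sU eg); last by apply/andP; split; lra.
by case: E => -[-> ->]; rewrite // segmentC.
Qed.

Lemma carrier_alcove x : fundamental_alcove R t n x -> carrier x `<=` fundamental_alcove R t n.
Proof.
move=> [ax H] y [ay C]; split=> // alpha pa; have /andP[h0 h1] := H alpha pa.
have ra : roots alpha by left.
apply/andP; split.
  by have := C alpha 0 ra; rewrite !addr0 => /(_ h0).
have := C (- alpha) 1 (rootsN ra); rewrite !dotNl => /(_ ltac:(lra)); lra.
Qed.

Lemma affine_face x : apartment x -> grid x -> exists w, [/\ affine_weyl w &
  face_type (carrier x) (w @` carrier x)].
Proof.
move=> ax gx; have [w aw Fw] := alcove_conj ax gx; exists w; split=> //.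
rewrite -affine_carrierE //; split.
- by exists (w x) => //; apply: affine_apartment.
- exact: carrier_alcove.
- by exists w => //; rewrite affine_carrierE.
Qed.

(** A type exists, because a face whose interior meets the grid can be moved
    into the fundamental alcove. *)
Lemma same_face_type F F0 w : affine_weyl w -> F = w @` F0 ->
  (exists z, [/\ apartment z, grid z & F = carrier z]) ->
  exists D, face_type F D /\ face_type F0 D.
Proof.
move=> aw FE [z [az gz Fz]]; have [v [av [H1 H2 _]]] := affine_face az gz.
exists (v @` F); split; split; rewrite ?Fz //; [by exists v|exists (v \o w)].
  exact: affine_comp.
by rewrite -Fz FE image_comp.
Qed.

Lemma conj_pair_affine x y x0 y0 : conj_pair x y x0 y0 ->
  exists w, [/\ affine_weyl w, x = w x0 & y = w y0].
Proof.
move=> [w [q [Ww Qq -> ->]]]; exists (fun x => w x + q); split=> //.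
by apply/affine_weylP; exists w, q.
Qed.

Lemma vertex_face_type x y x0 y0 : cell x y -> conj_pair x y x0 y0 ->
  (exists D, face_type [set x] D /\ face_type [set x0] D) /\
  (exists D, face_type [set y] D /\ face_type [set y0] D).
Proof.
move=> c /conj_pair_affine [w [aw xE yE]].
have H a b a0 : cell a b -> a = w a0 -> exists D, face_type [set a] D /\ face_type [set a0] D.
  move=> cab aE; apply: (same_face_type (w := w)) => //; first by rewrite aE image_set1.
  have va := cell_vertex cab; exists a; split; [exact: vertex_apartment|exact: cell_grid cab|].
  by move/is_vertexP: va.
by split; [apply: H c xE|apply: H (cell_sym c) yE].
Qed.

Lemma edge_face_type x y x0 y0 : cell x y -> conj_pair x y x0 y0 ->
  exists D, face_type (segment x y) D /\ face_type (segment x0 y0) D.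
Proof.
move=> c /conj_pair_affine [w [aw xE yE]]; apply: (same_face_type (w := w)) => //.
  by rewrite affine_segment // xE yE.
exact: cell_carrier.
Qed.

Lemma word_tableau_path w T : good_word w -> word_tableau w T ->
  let l := tableau_steps T in let l0 := tableau_steps (ref_tableau w) in
  [/\ size l = size l0, special_pt (\sum_(v <- l) v) &
      forall k, (k < size l)%N ->
        cell (partial_sum l k) (partial_sum l k.+1) /\
        conj_pair (partial_sum l k) (partial_sum l k.+1)
                  (partial_sum l0 k) (partial_sum l0 k.+1)].
Proof.
move=> gw wT l l0.
have [|ss sp H] := word_tableau_cells gw wT special_pt0 special_pt0.
  by rewrite subrr; apply: QV0.
split=> //; first by move: sp; rewrite add0r.
by move=> k kl; have := H k kl; rewrite !add0r.
Qed.

Lemma path_is_gallery w T : good_word w -> word_tableau w T ->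
  is_gallery (path_gallery (tableau_steps T)).
Proof.
move=> gw wT; have [ss sp H] := word_tableau_path gw wT.
set l := tableau_steps T in ss sp H *.
have vert k : (k <= size l)%N -> is_vertex (partial_sum l k).
  rewrite leq_eqVlt => /orP[/eqP ->|kl]; last by have [c _] := H k kl; apply: cell_vertex c.
  by rewrite partial_sum_size; apply: special_vertex.
split=> //.
- by apply/specialP/special_pt0.
- by rewrite target_path; apply/specialP.
- by move=> k; rewrite size_path => kl; rewrite vertex_path //; apply: vert.
- move=> k; rewrite size_path => kl; rewrite edge_path // !vertex_path ?(ltnW kl) //.
  have [c _] := H k kl; split; [exact: cell_edge|exact: segment_left|exact: segment_right].
Qed.

Lemma path_same_type w T : good_word w -> word_tableau w T ->
  same_type (path_gallery (tableau_steps T)) (path_gallery (tableau_steps (ref_tableau w))).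
Proof.
move=> gw wT; have [ss sp H] := word_tableau_path gw wT.
set l := tableau_steps T in ss sp H *; set l0 := tableau_steps _ in ss sp H *.
split; rewrite !size_path //.
- move=> k kl; rewrite !vertex_path -?ss //.
  case: k kl => [|k] kl; last by have [c cp] := H k kl; have [_] := vertex_face_type c cp.
  rewrite !partial_sum0.
  apply: (same_face_type (w := id)); [by constructor|by rewrite image_id|].
  exists 0; split; [exact: apartment0| |].
    by move=> j; rewrite mxE mulr0 rpred0.
  by have /is_vertexP := special_vertex special_pt0.
- move=> k kl; rewrite !edge_path -?ss //.
  by have [c cp] := H k kl; apply: edge_face_type.
Qed.

Lemma block_gamma i : (0 < i <= n)%N ->
  is_gamma_omega i (path_gallery (tableau_steps (ref_block i))).
Proof.
move=> i_n; have gw : good_word [:: i] by rewrite /good_word /= i_n.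
have rE : ref_tableau [:: i] = ref_block i by rewrite /ref_tableau /= cats0.
have wT := ref_word_tableau gw; rewrite rE in wT.
split; first exact: path_is_gallery gw wT.
have [sF _ _ _] := first_letters_column (ltac:(lia) : (i <= n)%N).
have main (b : nat -> R) l : b 0%N = 0 -> b (size l) = 1 ->
    (forall k, (k < size l)%N -> b k < b k.+1) ->
    (forall k, (k < size l)%N -> nth 0 l k = (b k.+1 - b k) *: omega i) ->
    exists breaks : nat -> R,
    [/\ breaks 0%N = 0, breaks (size (steps (path_gallery l))) = 1,
        (forall k, (k < size (steps (path_gallery l)))%N -> breaks k < breaks k.+1),
        (forall k, (k <= size (steps (path_gallery l)))%N ->
           vertex_at (path_gallery l) k = breaks k *: omega i) &
        (forall k, (k < size (steps (path_gallery l)))%N ->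
           edge_at (path_gallery l) k =
           segment (breaks k *: omega i) (breaks k.+1 *: omega i))].
  move=> b0 b1 binc bl; exists b.
  have ps k : (k <= size l)%N -> partial_sum l k = b k *: omega i.
    elim: k => [|k IH] kl; first by rewrite partial_sum0 b0 scale0r.
    by rewrite partial_sumS // IH ?(ltnW kl) // bl // -scalerDl addrC subrK.
  split; rewrite ?size_path //.
    by move=> k kl; rewrite vertex_path // ps.
  by move=> k kl; rewrite edge_path // !ps ?(ltnW kl).
rewrite /ref_block; have [m|m] := boolP (is_min i).
  have -> : tableau_steps [:: first_letters i] = [:: step_vec i (first_letters i)].
    by rewrite /tableau_steps /= sF.
  apply: (main (fun k => k%:R)) => //.
    by move=> k _; rewrite ltr_nat.
  by move=> [|k] //= _; rewrite subr0 scale1r step_min // omegaE.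
have -> : tableau_steps [:: first_letters i; first_letters i] =
    [:: step_vec i (first_letters i); step_vec i (first_letters i)].
  by rewrite /tableau_steps /= sF.
apply: (main (fun k => k%:R / 2%:R)) => /=.
- by rewrite mul0r.
- by rewrite divff // pnatr_eq0.
- by move=> k _; rewrite ltr_pM2r ?invr_gt0 ?ltr0n // ltr_nat.
- move=> k k2; have -> : nth 0 [:: step_vec i (first_letters i); step_vec i (first_letters i)] k =
    step_vec i (first_letters i) by case: k k2 => [|[|k]].
  rewrite step_nmin // omegaE weight_scale_nmin // scale1r; congr (_ *: _).
  by rewrite -mulrBl -natrB // subSn // subnn mul1r.
Qed.

Lemma tableau_steps_cat T T' : tableau_steps (T ++ T') = tableau_steps T ++ tableau_steps T'.
Proof. exact: map_cat. Qed.

Lemma ref_gamma w : good_word w -> is_gamma_word w (path_gallery (tableau_steps (ref_tableau w))).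
Proof.
elim: w => [|i w IH] //= /andP[i_n gw].
exists (path_gallery (tableau_steps (ref_block i))), (path_gallery (tableau_steps (ref_tableau w))).
split; [exact: block_gamma|exact: IH|].
by rewrite concat_path -tableau_steps_cat.
Qed.

(** A root takes the values 0 and 2 at the two ends, so that one of its walls
    cuts the segment. *)
Lemma not_edge_omega i : (0 < i <= n)%N -> ~~ is_min i ->
  ~ is_edge (segment 0 (omega i)).
Proof.
move=> i_n m [[x ax E] _]; have i_n' : (i <= n)%N by lia.
have col := first_letters_column i_n'.
have [alpha ra fa] := root_step_one col i_n.
have oE : dot alpha (omega i) = 2%:R.
  have -> : omega i = step_vec i (first_letters i) + step_vec i (first_letters i).
    rewrite step_nmin // omegaE weight_scale_nmin // scale1r.
    by apply/rowP => j; rewrite !mxE -mulrDr half_double.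
  by rewrite dotDr fa.
have [_ C0] : carrier x 0 by rewrite -E; apply: segment_left.
have [_ C1] : carrier x (omega i) by rewrite -E; apply: segment_right.
have [a1|a1] := lerP 1 (dot alpha x).
  by have := C0 alpha (-1) ra; rewrite dot0r intrN => /(_ ltac:(lra)); lra.
by have := C1 (- alpha) 1 (rootsN ra); rewrite !dotNl oE => /(_ ltac:(lra)); lra.
Qed.

(** The vertices of gamma_(omega_i) are vertices on the segment from 0 to
    omega_i. By [edge_vertex] these are the two ends and, if omega_i is not
    minuscule, the midpoint; in that case [not_edge_omega] excludes that the
    midpoint is left out. *)
Lemma gamma_block i g : (0 < i <= n)%N -> is_gamma_omega i g ->
  g = path_gallery (tableau_steps (ref_block i)).
Proof.
move=> i_n [[g0 _ _ Hv He] [b [b0 b1 binc bv be]]].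
have i_n' : (i <= n)%N by lia.
have col := first_letters_column i_n'; have [sF _ _ _] := col.
have ef := step_edge_vec col i_n; have [af f0 _] := ef.
set m := size (steps g) in b1 binc bv be Hv He *.
have mono k l : (k < l)%N -> (l <= m)%N -> b k < b l.
  move=> kl; elim: l kl => // l IH; rewrite ltnS leq_eqVlt => /orP[/eqP <-|kl] lm.
    exact: binc.
  by apply: lt_trans (IH kl _) (binc _ _); lia.
have m0 : (0 < m)%N.
  by rewrite lt0n; apply/eqP => m0; move: b1; rewrite m0 b0 => /eqP; rewrite eq_sym oner_eq0.
have bpos k : (0 < k <= m)%N -> 0 < b k <= 1.
  move=> km; rewrite -{1}b0 mono //; try lia.
  have [km'|km'] := eqVneq k m; first by rewrite km' b1 lexx.
  by rewrite -b1 ltW // mono //; lia.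
have sg : [seq b k.+1 *: omega i - b k *: omega i | k <- iota 0 m] =
    tableau_steps (ref_block i) -> g = path_gallery (tableau_steps (ref_block i)).
  move=> <-; apply: (@path_of_vertices g (fun k => b k *: omega i)) => //.
  by rewrite b0 scale0r.
apply: sg.
set f := step_vec i (first_letters i) in ef af f0.
have inj (r s : R) : r *: f = s *: f -> r = s.
  by move/eqP; rewrite -subr_eq0 -scalerBl scaler_eq0 (negPf f0) orbF subr_eq0 => /eqP.
rewrite /ref_block; have [mi|mi] := boolP (is_min i).
  have oE : omega i = f by rewrite /f step_min // omegaE.
  have v1 : is_vertex (b 1%N *: f) by rewrite -oE -bv //; apply: Hv.
  have /andP[p1 q1] := bpos 1%N m0.
  have b11 : b 1%N = 1.
    have [|E|E] := @edge_vertex 0 f (b 1%N *: f) special_pt0 ef _ v1.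
    - by apply/segmentP; exists (b 1%N); split; [lra|rewrite add0r subr0 add0r].
    - by have := inj (b 1%N) 0; rewrite E scale0r => /(_ erefl); lra.
    - by apply: inj; rewrite E add0r scale1r.
  have -> : m = 1%N.
    apply/eqP; rewrite eqn_leq m0 andbT leqNgt; apply/negP => m1.
    by have := mono 1%N m m1 (leqnn m); rewrite b11 b1 ltxx.
  by rewrite /= b11 b0 scale0r subr0 scale1r oE /tableau_steps /= sF.
have oE : omega i = f + f.
  rewrite /f step_nmin // omegaE weight_scale_nmin // scale1r.
  by apply/rowP => j; rewrite !mxE -mulrDr half_double.
have so : special_pt (f + f) by rewrite -oE; apply: omega_special.
have dbl (r : R) : r *: (f + f) = (r + r) *: f by rewrite scalerDr scalerDl.
have half k : (0 < k <= m)%N -> b k = 2%:R^-1 \/ b k = 1.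
  move=> km; have /andP[p1 q1] := bpos k km.
  have vk : is_vertex ((b k + b k) *: f) by rewrite -dbl -oE -bv //; [apply: Hv|]; lia.
  have [h|h] := lerP (b k + b k) 1.
    have [|E|E] := @edge_vertex 0 f _ special_pt0 ef _ vk.
    - by apply/segmentP; exists (b k + b k); split; [lra|rewrite add0r subr0 add0r].
    - by have := inj (b k + b k) 0; rewrite E scale0r => /(_ erefl); lra.
    - by have := inj (b k + b k) 1; rewrite E add0r scale1r => /(_ erefl); left; lra.
  have [|E|E] := @edge_vertex (f + f) (- f) _ so (edge_vecN ef) _ vk.
  - apply/segmentP; exists (2%:R - (b k + b k)); split; first by lra.
    by move: (b k) (f) => r v; apply/rowP => j; rewrite !mxE; ring.
  - by have := inj (b k + b k) 2%:R; rewrite E scaler_nat => /(_ erefl); right; lra.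
  - by have := inj (b k + b k) 1; rewrite E addrK scale1r => /(_ erefl); left; lra.
have b1h : b 1%N = 2%:R^-1.
  have [//|b11] := half 1%N m0.
  have m1 : m = 1%N.
    apply/eqP; rewrite eqn_leq m0 andbT leqNgt; apply/negP => m1.
    by have := mono 1%N m m1 (leqnn m); rewrite b11 b1 ltxx.
  have [e _ _] := He 0%N m0; move: e; rewrite be // b0 scale0r b11 scale1r.
  by move/(not_edge_omega i_n mi).
have m2 : (1 < m)%N.
  rewrite ltnNge; apply/negP => m1; have m1' : m = 1%N by lia.
  by move: b1; rewrite m1' b1h; lra.
have b21 : b 2%N = 1.
  have [b2|//] := half 2%N m2; have := mono 1%N 2%N isT m2; rewrite b1h b2 ltxx.
  by [].
have -> : m = 2%N.
  apply/eqP; rewrite eqn_leq m2 andbT leqNgt; apply/negP => m3.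
  by have := mono 2%N m m3 (leqnn m); rewrite b21 b1 ltxx.
rewrite /= b21 b1h b0 scale0r subr0 scale1r oE dbl /tableau_steps /= sF -/f.
have -> : 2%:R^-1 + 2%:R^-1 = 1 :> R by lra.
by rewrite scale1r addrK.
Qed.

Lemma gamma_word w g : good_word w -> is_gamma_word w g ->
  g = path_gallery (tableau_steps (ref_tableau w)).
Proof.
elim: w g => [|i w IH] g //= /andP[i_n gw] [g1 [g2 [h1 h2 ->]]].
by rewrite (gamma_block i_n h1) (IH _ gw h2) concat_path -tableau_steps_cat.
Qed.

(** * Every gallery of the given type runs along a tableau *)

(** An element of the affine Weyl group moves a special point by a vector of the
    coroot lattice. *)
Lemma cell_noconj w x y : cell x y -> affine_weyl w -> w x <> y.
Proof.
move=> [U [g [sU [eg nq] s2 v E]]] aw wE.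
have key f : affine_weyl f -> f U <> U + g.
  move=> /affine_weylP [w0 [q [W0 Qq ->]]] H; apply: nq.
  have -> : g = (w0 U - U) + q by rewrite addrAC H addrC addKr.
  by apply: QVD => //; apply: weyl_sub_QV.
have [w' [aw' wK w'K]] := affine_inv aw.
case: E => -[xE yE]; first by apply: (key w aw); rewrite -yE -xE.
by apply: (key w' aw'); rewrite -xE -yE -wE wK.
Qed.

Lemma same_face_affine F F0 D : face_type F D -> face_type F0 D ->
  exists w, affine_weyl w /\ F = w @` F0.
Proof.
move=> [_ _ [w aw DE]] [_ _ [w0 aw0 DE0]]; have [w' [aw' wK w'K]] := affine_inv aw.
exists (w' \o w0); split; first exact: affine_comp.
rewrite -image_comp -DE0 DE image_comp.
have -> : w' \o w = id by apply/funext => x /=; rewrite wK.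
by rewrite image_id.
Qed.

Lemma same_vertex_affine v v0 D : face_type [set v] D -> face_type [set v0] D ->
  exists w, affine_weyl w /\ v = w v0.
Proof.
move=> h h0; have [w [aw E]] := same_face_affine h h0; exists w; split=> //.
by have : [set v] v by []; rewrite E image_set1.
Qed.

(** An edge with the type of a cell is an image of the cell. Vertices go to
    vertices, and the types of x and y decide which of the two ends of the cell
    goes to which, because the ends are not conjugate to each other. *)
Lemma cell_match x0 y0 E x y : cell x0 y0 -> is_vertex x -> is_vertex y -> E x -> E y ->
  (exists D, face_type E D /\ face_type (segment x0 y0) D) ->
  (exists D, face_type [set x] D /\ face_type [set x0] D) ->
  (exists D, face_type [set y] D /\ face_type [set y0] D) ->
  E = segment x y /\ conj_pair x y x0 y0.
Proof.
move=> c vx vy Ex Ey [D [h h0]] [Dx [hx hx0]] [Dy [hy hy0]].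
have [w [aw EE]] := same_face_affine h h0.
have [u [au xE]] := same_vertex_affine hx hx0.
have [v [av yE]] := same_vertex_affine hy hy0.
have [w' [aw' wK w'K]] := affine_inv aw.
have ends z : is_vertex z -> E z -> z = w x0 \/ z = w y0.
  move=> vz; rewrite EE => -[z' sz' zE]; rewrite -zE in vz *.
  have [->|->] := cell_edge_vertex c sz' (iffLR (affine_vertex z' aw) vz); by auto.
have xw : x = w x0.
  have [//|xy] := ends x vx Ex; exfalso.
  apply: (@cell_noconj (w' \o u) _ _ c); first exact: affine_comp.
  by rewrite /= -xE xy wK.
have yw : y = w y0.
  have [yx|//] := ends y vy Ey; exfalso.
  apply: (@cell_noconj (w' \o v) _ _ (cell_sym c)); first exact: affine_comp.
  by rewrite /= -yE yx wK.
split; first by rewrite EE affine_segment // -xw -yw.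
have [w0 [q [W0 Qq wE]]] := iffLR (affine_weylP w) aw.
by exists w0, q; rewrite xw yw wE.
Qed.

Lemma gallery_cells w g : good_word w -> is_gallery g ->
  same_type g (path_gallery (tableau_steps (ref_tableau w))) ->
  let l0 := tableau_steps (ref_tableau w) in
  size (steps g) = size l0 /\ forall k, (k < size l0)%N ->
   edge_at g k = segment (vertex_at g k) (vertex_at g k.+1) /\
   conj_pair (vertex_at g k) (vertex_at g k.+1) (partial_sum l0 k) (partial_sum l0 k.+1).
Proof.
move=> gw [g0 _ _ Hv He] [ss tv te] l0; rewrite size_path -/l0 in ss; split=> // k kl.
have [_ _ /(_ k kl) [c _]] := word_tableau_path gw (ref_word_tableau gw).
have kl' := kl; rewrite -ss in kl'; have [e1 e2 e3] := He k kl'.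
apply: cell_match c _ _ e2 e3 _ _ _.
- by apply: Hv; apply: ltnW.
- exact: Hv.
- by have := te k kl'; rewrite edge_path.
- by have := tv k (ltnW kl'); rewrite vertex_path // ltnW.
- by have := tv k.+1 kl'; rewrite vertex_path.
Qed.

Lemma weyl_column i w : (i <= n)%N -> weyl w -> exists C, is_column i C /\
  w (step_vec i (first_letters i)) = step_vec i C.
Proof.
move=> i_n Ww; have [s A] := weyl_acts Ww; exists (sort letter_le (images s i)).
split; first exact: images_column A i_n.
rewrite /step_vec (actsZ _ _ A) (acts_cvec A); last by case: (first_letters_column i_n).
have -> : map s (first_letters i) = images s i by rewrite /first_letters -map_comp.
by congr (_ *: _); apply: cvec_perm; rewrite perm_sym perm_sort.
Qed.

(** Each step of the gallery is a Weyl image of the reference step, hence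
    belongs to a column. At the middle vertex of a block the two conjugating
    elements agree on the reference position, which yields the condition on the
    two columns. *)
Lemma conj_pairs_tableau w (x : nat -> V) U0 : good_word w -> special_pt U0 ->
  let l0 := tableau_steps (ref_tableau w) in
  (forall k, (k < size l0)%N ->
    conj_pair (x k) (x k.+1) (U0 + partial_sum l0 k) (U0 + partial_sum l0 k.+1)) ->
  exists T, [/\ word_tableau w T, size T = size l0 &
    forall k, (k <= size l0)%N -> x k = x 0%N + partial_sum (tableau_steps T) k].
Proof.
elim: w x U0 => [|i w IH] x U0.
  move=> _ _ l0 _; exists [::]; split=> // k; rewrite leqn0 => /eqP ->.
  by rewrite partial_sum0 addr0.
move=> /= /andP[i_n gw] sU0; rewrite /ref_tableau /= -/(ref_tableau w).
have i_n' : (i <= n)%N by lia.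
have col0 := first_letters_column i_n'; have [sF _ _ _] := col0.
have diff a b c f : conj_pair a b c (c + f) -> exists w (q : V), [/\ weyl w, QV q, a = w c + q & b = a + w f].
  move=> [v [q [Wv Qq -> ->]]]; exists v, q; split=> //; have [s A] := weyl_acts Wv.
  by rewrite (actsD _ _ A) addrAC.
rewrite /ref_block; have [m|m] := boolP (is_min i) => /=.
  rewrite /tableau_steps /= sF -/(tableau_steps (ref_tableau w)).
  set f := step_vec i (first_letters i); set l := tableau_steps _ => H.
  have sU1 : special_pt (U0 + f).
    by apply: special_ptD => //; rewrite /f step_min //; apply: column_special.
  have [|T [wT sT xT]] := IH (fun k => x k.+1) (U0 + f) gw sU1.
    by move=> k kl; have := H k.+1 kl; rewrite !partial_sum_cons !addrA.
  have := H 0%N isT; rewrite partial_sum_cons !partial_sum0 !addr0 => /diff [v [q [Wv Qq x0 x1]]].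
  have [C [col vE]] := weyl_column i_n' Wv; have [sC _ _ _] := col.
  exists (C :: T); split; [by exists C, T|by rewrite /= sT|].
  move=> [|k] kl; first by rewrite partial_sum0 addr0.
  by rewrite /= partial_sum_cons sC addrA -vE -x1; apply: xT.
rewrite /tableau_steps /= sF -/(tableau_steps (ref_tableau w)).
set f := step_vec i (first_letters i); set l := tableau_steps _ => H.
have sU1 : special_pt (U0 + f + f) by rewrite -addrA; apply: special_ptD => //; apply: column_step_special.
have [|T [wT sT xT]] := IH (fun k => x k.+2) (U0 + f + f) gw sU1.
  by move=> k kl; have := H k.+2 kl; rewrite !partial_sum_cons !addrA.
have := H 0%N isT; rewrite partial_sum_cons !partial_sum0 !addr0 => /diff [v [q [Wv Qq x0 x1]]].
have := H 1%N isT; rewrite !partial_sum_cons !partial_sum0 !addr0 !addrA.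
move=> /diff [v' [q' [Wv' Qq' x1' x2]]].
have [C [col vE]] := weyl_column i_n' Wv; have [sC _ _ _] := col.
have [C' [col' vE']] := weyl_column i_n' Wv'; have [sC' _ _ _] := col'.
have [s A] := weyl_acts Wv; have [s' A'] := weyl_acts Wv'.
have lk : linked C C'.
  rewrite /linked scalerBr -(step_nmin C m) -(step_nmin C' m) -vE -vE' -/f.
  have -> : v f - v' f = (v' U0 - U0) - (v U0 - U0) + (q' - q).
    have : v U0 + q + v f = v' U0 + v' f + q' by rewrite -x0 -x1 x1' (actsD _ _ A').
    move: (v U0) (v' U0) (v f) (v' f) => a b c d E.
    have -> : c = b + d + q' - (a + q) by rewrite -E addrC addKr.
    by apply/rowP => j; rewrite !mxE; ring.
  by apply: QVD; apply: QVB => //; apply: weyl_sub_QV.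
exists (C :: C' :: T); split; [by exists C, C', T|by rewrite /= sT|].
move=> [|[|k]] kl; first by rewrite partial_sum0 addr0.
  by rewrite /= partial_sum_cons partial_sum0 addr0 sC -vE -x1.
by rewrite /= !partial_sum_cons sC sC' !addrA -vE -x1 -vE' -x2; apply: xT.
Qed.

Lemma gallery_word_tableau w g : good_word w ->
  (is_gallery g /\ exists2 g0, is_gamma_word w g0 & same_type g g0) <->
  (exists T, word_tableau w T /\ g = path_gallery (tableau_steps T)).
Proof.
move=> gw; split=> [[gg [g0 /(gamma_word gw) -> st]]|[T [wT ->]]]; last first.
  split; first exact: path_is_gallery gw wT.
  by exists (path_gallery (tableau_steps (ref_tableau w))); [exact: ref_gamma|exact: path_same_type].
have [ss H] := gallery_cells gw gg st; have [g00 _ _ _ _] := gg.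
have [|T [wT sT xT]] := conj_pairs_tableau (x := vertex_at g) gw special_pt0.
  by move=> k kl; rewrite !add0r; apply: (H k kl).2.
exists T; split=> //.
have v0 : vertex_at g 0 = 0 by rewrite /vertex_at /= g00.
have sT' : size (tableau_steps T) = size (steps g) by rewrite size_map sT ss.
apply: gallery_ext; rewrite ?size_path ?sT' // => k kg.
  by rewrite xT ?v0 ?add0r ?vertex_path ?sT' // -ss.
have kl : (k < size (tableau_steps (ref_tableau w)))%N by rewrite -ss.
have kT : (k < size (tableau_steps T))%N by rewrite sT'.
rewrite (H k kl).1 (edge_path kT) (xT k (ltnW kl)) (xT k.+1 kl) v0 !add0r.
by [].
Qed.

(** * The two columns of a block *)

Local Notation minuscule := (minuscule R t n).
Local Notation weyl_integral := (weyl_integral R t n).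
Local Notation encodes := (encodes R t n).
Local Notation block := (block R t n).
Local Notation tableau_of_word := (tableau_of_word R t n).

Lemma omega_steps i : ~~ is_min i -> omega i = step_vec i (first_letters i) + step_vec i (first_letters i).
Proof.
move=> m; rewrite step_nmin // omegaE weight_scale_nmin // scale1r.
by apply/rowP => j; rewrite !mxE -mulrDr half_double.
Qed.

(** Some root takes the value 1 on a step, hence the value 2 on a coweight made
    of two equal steps. *)
Lemma minusculeP i : (0 < i <= n)%N -> minuscule i <-> is_min i.
Proof.
move=> i_n; have i_n' : (i <= n)%N by lia.
have col := first_letters_column i_n'; split=> [M|m alpha ra].
  apply/negPn/negP => m; have [alpha ra fa] := root_step_one col i_n.
  by have := M alpha ra; rewrite omega_steps // dotDr fa ger0_norm; lra.
have -> : omega i = step_vec i (first_letters i) by rewrite step_min // omegaE.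
by apply: (root_step_small col) => //; lia.
Qed.

Lemma weyl_integral_QV v s : weyl_integral v s -> weyl s /\ QV (s v - v).
Proof.
elim=> [|f g [alpha [m [/rootsP [p [q [lp lq pq ->]]] vm ->]]] _ [Wg IH]].
  by split; [constructor|rewrite subrr; apply: QV0].
have Wr := weyl_refl lp lq pq; have A := acts_refl lp lq pq.
split; first exact: weyl_comp.
have -> : (rf p q \o g) v - v = rf p q (g v - v) + (rf p q v - v).
  by rewrite /= (actsB _ _ A) addrA subrK.
apply: QVD; first exact: weyl_QV.
rewrite refl_root0 // addrC addKr vm; exact/QVN/QVZ/QV_coroot.
Qed.

Lemma weight_scale_neq0 i : weight_scale i != 0.
Proof. by rewrite /weight_scale; case: ifP => _; rewrite ?oner_neq0 // invr_eq0 pnatr_eq0. Qed.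

(** A point in the orbit of omega_i is the weight of a column without opposite
    entries. As weights determine columns, the encoding column has no opposite
    entries either. *)
Lemma encodes_column i C w : (i <= n)%N -> weyl w -> encodes i C (w (omega i)) ->
  is_column i C /\ w (step_vec i (first_letters i)) = step_vec i C.
Proof.
move=> i_n Ww [sC lC soC E]; have [C0 [col wE]] := weyl_column i_n Ww.
have [s A] := weyl_acts Ww.
have cE : w (cvec (first_letters i)) = cvec C.
  by move: E; rewrite omegaE (actsZ _ _ A) => /(scalerI (weight_scale_neq0 i)).
have CC0 : C = C0.
  apply: (cvec_inj col) => //; rewrite -cE; apply/esym.
  by move: wE; rewrite /step_vec (actsZ _ _ A) => /scalerI <- //; rewrite gt_eqF ?step_scale_gt0.
by rewrite CC0.
Qed.

Lemma column_encodes i C w : is_column i C -> weyl w -> w (cvec (first_letters i)) = cvec C ->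
  encodes i C (w (omega i)).
Proof.
move=> [sC lC soC nC] Ww E; split=> //; have [s A] := weyl_acts Ww.
by rewrite omegaE (actsZ _ _ A) E.
Qed.

Lemma image_segment w x y : weyl w -> w @` segment x y = segment (w x) (w y).
Proof. by move=> Ww; apply/affine_segment/weyl_affine. Qed.

Definition exchanged (C C' : seq int) : Prop :=
  exists2 S : pred int, (t = TypeC -> ~~ odd (count S C)) & exchange S C C'.

Lemma exchange_half S C C' : exchange S C C' ->
  2%:R^-1 *: (cvec C - cvec C') = \sum_(p <- C | S p) eps p.
Proof.
move=> /cvec_perm ->; rewrite /cvec big_map -sumrB scaler_sumr [RHS]big_mkcond /=.
apply: eq_bigr => p _; case: (S p); last by rewrite subrr scaler0.
by rewrite epsN opprK; move: (eps p) => v; apply/rowP => j; rewrite !mxE half_double.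
Qed.

Lemma sum_sgz (S : pred int) C : all letter C ->
  \sum_(p <- C | S p) (sgz p)%:~R = (count S C)%:R - 2%:R * (count (fun p => S p && (p < 0)) C)%:R :> R.
Proof.
elim: C => [|p C IH] /=; first by rewrite big_nil mulr0 subr0.
move=> /andP[/letter_neq0 p0 lC]; rewrite big_cons IH //; case: (S p) => //=.
rewrite !natrD; case: (sgzP p) p0 => // _ _ /=; ring.
Qed.

(** The exchanged entries p are those for which - p is in C'. Half the
    difference of the two weights is the sum of the eps p over them: an integral
    vector, whose coordinate sum has the parity of the number of exchanged
    entries. *)
Lemma linkedP k C C' : t <> TypeA -> is_column k C -> is_column k C' ->
  linked C C' <-> exchanged C C'.
Proof.
move=> tA col col'; have [sC lC soC nC] := col; have [sC' lC' soC' nC'] := col'.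
have uC := column_uniq col; have uC' := column_uniq col'.
have parity S : exchange S C C' -> \sum_j (2%:R^-1 *: (cvec C - cvec C')) 0 j =
    (count S C)%:R - 2%:R * (count (fun p => S p && (p < 0)) C)%:R :> R.
  move=> ex; rewrite (exchange_half ex) -sum_sgz //.
  rewrite (eq_bigr (fun j => \sum_(p <- C | S p) (eps p) 0 j)) => [|j _]; last by rewrite summxE.
  rewrite exchange_big /= big_seq_cond [RHS]big_seq_cond.
  by apply: eq_bigr => p /andP[pC _]; rewrite sum_eps // (allP lC).
have half_nat m : 2%:R^-1 * (m%:R) \is a @Num.int R -> ~~ odd m.
  move=> /intrP [z zE]; have : (m%:R : R) = (2 * z)%:~R by rewrite intrM -zE mulrA mulfV ?mul1r // pnatr_eq0.
  by rewrite -[m%:R]/(m%:Z%:~R) => /intr_inj; lia.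
split=> [lk|[S ev ex]].
- pose S p := - p \in C'.
  have flip p : p \in C -> (if S p then - p else p) \in C'.
    move=> pC; have lp := allP lC p pC; have [j pj sp] := letter_ord lp.
    have [al il _] := lk; have : dot (eps p) (2%:R^-1 *: (cvec C - cvec C')) \is a Num.int.
      by rewrite (dot_eps_ord al pj) rpredM ?intr_int.
    rewrite dotZr dotBr !dot_eps_cvec // sC sC' (mult_column col pC) /mult /S.
    case: (boolP (- p \in C')) => [//|np]; case: (boolP (p \in C')) => [//|pn] H; exfalso.
    by apply: (int_gap H); rewrite /= subrr sub0r opprK subrK; lra.
  have ex : exchange S C C'.
    rewrite /exchange; set C2 := map _ C.
    have uC2 : uniq C2.
      rewrite map_inj_in_uniq // => p q pC qC; have := nC p pC; have := nC q qC.
      case: (S p); case: (S q) => // nq np E.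
      - lia.
      - by move: np; rewrite E qC.
      - by move: nq; rewrite -E pC.
    rewrite perm_sym; apply: uniq_perm => //; apply: (uniq_min_size uC2 _ _).2.
      by move=> x /mapP [p pC ->]; apply: flip.
    by rewrite sC' size_map sC.
  exists S => // tC; apply: half_nat; have [_ _ /(_ tC)] := lk.
  rewrite (parity S ex) mulrBr mulrA mulVf ?pnatr_eq0 // mul1r => H.
  rewrite -(subrK (count (fun p => S p && (p < 0)) C)%:R (2%:R^-1 * _)).
  by rewrite rpredD ?rpred_nat.
- split.
  + by apply/apartmentZ/apartmentB; apply: apartment_cvec.
  + move=> j; rewrite (exchange_half ex) summxE rpred_sum // => p _; exact: eps_coord_int.
  + move=> tC; rewrite (parity S ex) mulrBr mulrA mulVf ?pnatr_eq0 // mul1r.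
    rewrite rpredB ?rpred_nat //; have := ev tC => /even_halfK.
    by rewrite -mul2n => <-; rewrite natrM mulrA mulVf ?pnatr_eq0 // mul1r rpred_nat.
Qed.

(** * The tableau attached to a gallery *)

(** Signs of entries of the half weight are changed by reflections in roots that
    take the value 1 on it: in type B the root 2 eps j changes the sign of the
    single entry j, in type C the root eps j + eps k changes two signs at a
    time. *)
Lemma integral_flip i (J : seq nat) : ~~ is_min i -> (0 < i <= n)%N -> uniq J ->
  (forall j, j \in J -> (0 < j <= i)%N) -> (t = TypeC -> ~~ odd (size J)) ->
  let h := step_vec i (first_letters i) in
  exists2 s, weyl_integral h s & s h = h - \sum_(j <- J) eps j%:Z.
Proof.
move=> m i_n uJ JI ev h; have i_n' : (i <= n)%N by lia.
have tA : t <> TypeA by move=> tA; move: m; rewrite /is_min tA.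
have col := first_letters_column i_n'.
have hE : h = 2%:R^-1 *: cvec (first_letters i) by apply: step_nmin.
have lJ (j : nat) : (0 < j <= i)%N -> letter j.
  by move=> ji; move: tA; case: (t) => //= _; lia.
have mh (j : nat) : (0 < j <= i)%N -> mult j (first_letters i) = 1.
  move=> ji; apply: (mult_column col); apply/mapP; exists j => //.
  by rewrite mem_iota; lia.
have rootJ (K : seq nat) p q : letter p -> letter q -> (forall j : nat, j \in K -> (0 < j <= i)%N) ->
    (forall j : nat, j \in K -> [/\ p != j, p != - j%:Z, q != j & q != - j%:Z]) ->
    dot (root_of p q) (\sum_(j <- K) eps j%:Z) = 0.
  move=> lp lq KI H; rewrite dot_sumr big_seq big1 // => j jK.
  have [/negPf h1 /negPf h2 /negPf h3 /negPf h4] := H j jK.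
  by rewrite dotZl dot_epsB ?lJ ?KI // h1 h2 h3 h4 !subrr mulr0.
(* A root that takes the value 1 on h and does not involve the letters of K
   changes s h by its coroot. *)
have one (K : seq nat) p q s : letter p -> letter q -> p != q ->
    (forall j : nat, j \in K -> (0 < j <= i)%N) ->
    (forall j : nat, j \in K -> [/\ p != j, p != - j%:Z, q != j & q != - j%:Z]) ->
    dot (root_of p q) h = 1 -> weyl_integral h s -> s h = h - \sum_(j <- K) eps j%:Z ->
    weyl_integral h (rf p q \o s) /\
    (rf p q \o s) h = h - \sum_(j <- K) eps j%:Z - coroot_of p q.
  move=> lp lq pq KI H rh Ws sh; split.
    apply: generated_comp Ws; exists (root_of p q), 1; split=> //.
    by apply/rootsP; exists p, q.
  by rewrite /= sh refl_root0 // dotBr rh (rootJ K) // subr0 scale1r.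
have [tB|tC] := typeBC tA.
  elim: J uJ JI {ev} => [|j J IH] /=.
    by move=> _ _; exists id; [constructor|rewrite big_nil subr0].
  move=> /andP[jJ uJ] JI; have [s Ws sh] := IH uJ (fun k kJ => JI k (mem_behead (s := j :: J) kJ)).
  have ji := JI j (mem_head j J); have lj := lJ j ji.
  have lNj : letter (- j%:Z) by rewrite letterN.
  have JI' k : k \in J -> (0 < k <= i)%N by move=> kJ; apply: JI; rewrite inE kJ orbT.
  have [|||W E] := one J j (- j%:Z) s lj lNj _ JI' _ _ Ws sh.
  - lia.
  - move=> k kJ; have := JI' k kJ; have kj : k != j by apply: contra jJ => /eqP <-.
    by move: kj; split; lia.
  - rewrite hE dotZr dot_root_cvec ?(column_uniq col) //; last by case: col.
    by rewrite multN mh // root_scaleB // mul1r opprK half_double.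
  exists (rf j (- j%:Z) \o s) => //; rewrite E big_cons.
  have -> : coroot_of j (- j%:Z) = eps j.
    rewrite /coroot_of /coroot_scale eqxx; have -> (a : R) : match t with TypeC => 1 | _ => a end = a by rewrite tB.
    by rewrite epsN opprK; move: (eps j) => v; apply/rowP => k; rewrite !mxE half_double.
  by rewrite [eps j + _]addrC opprD addrA.
have {}ev := ev tC; have [N sN] := ubnP (size J); elim: N J uJ JI ev sN => // N IH [|j [|k J]] //=.
  by move=> _ _ _ _; exists id; [constructor|rewrite big_nil subr0].
rewrite !inE negb_or => /and3P[/andP[jk jJ] kJ uJ] JI; rewrite negbK => odJ sN.
have JI' l : l \in J -> (0 < l <= i)%N by move=> lJ'; apply: JI; rewrite !inE lJ' !orbT.
have [|s Ws sh] := IH J uJ JI' odJ; first by lia.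
have ji : (0 < j <= i)%N by apply: JI; rewrite inE eqxx.
have ki : (0 < k <= i)%N by apply: JI; rewrite !inE eqxx orbT.
have lNk : letter (- k%:Z) by rewrite letterN // lJ.
have [|||W E] := one J j (- k%:Z) s (lJ j ji) lNk _ JI' _ _ Ws sh.
- lia.
- move=> l lJ'; have := JI' l lJ'.
  have lj : l != j by apply: contra jJ => /eqP <-.
  have lk : l != k by apply: contra kJ => /eqP <-.
  by move: lj lk; split; lia.
- rewrite hE dotZr dot_root_cvec ?(column_uniq col) ?lJ //; last by case: col.
  by rewrite multN !mh // root_scale1 ?mul1r ?opprK ?half_double ?mulVf ?pnatr_eq0 //; lia.
exists (rf j (- k%:Z) \o s) => //; rewrite E !big_cons.
have -> : coroot_of j (- k%:Z) = eps j + eps k.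
  rewrite /coroot_of /coroot_scale; have -> (a : R) : match t with TypeC => 1 | _ => a end = 1 by rewrite tC.
  by rewrite scale1r epsN opprK.
move: (h) (\sum_(l <- J) eps l%:Z) (eps j) (eps k) => a b c d.
by apply/rowP => l; rewrite !mxE; ring.
Qed.

Lemma half_omega i : ~~ is_min i -> 2%:R^-1 *: omega i = step_vec i (first_letters i).
Proof. by move=> m; rewrite step_nmin // omegaE weight_scale_nmin // scale1r. Qed.

(** The sign changes that lead from C to C' are realized on the first i letters,
    before tau is applied. *)
Lemma linked_weyl i C C' : (0 < i <= n)%N -> ~~ is_min i -> is_column i C -> is_column i C' ->
  linked C C' -> exists tau s, [/\ weyl tau, weyl_integral (2%:R^-1 *: omega i) s,
    tau (cvec (first_letters i)) = cvec C & tau (s (cvec (first_letters i))) = cvec C'].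
Proof.
move=> i_n m col col' lk; have i_n' : (i <= n)%N by lia.
have tA : t <> TypeA by move=> tA; move: m; rewrite /is_min tA.
have [sC lC soC nC] := col; have uC := column_uniq col.
have [S ev ex] := iffLR (linkedP tA col col') lk.
have [tau [r [Wt A tE rE]]] := column_weyl i_n' col.
have CE : C = [seq r j%:Z | j <- iota 1 i] by rewrite -(images_entry sC rE).
pose J := [seq j <- iota 1 i | S (r j%:Z)].
have hE : 2%:R^-1 *: omega i = step_vec i (first_letters i).
  exact: half_omega.
have [||tC|s Ws sh] := @integral_flip i J m i_n.
- by rewrite filter_uniq // iota_uniq.
- by move=> j; rewrite mem_filter mem_iota => /andP[_]; lia.
- by move: (ev tC); rewrite {1}CE count_map size_filter.
exists tau, s; rewrite hE; split=> //.
have [rs As] := weyl_acts (weyl_integral_QV Ws).1.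
have sc : step_vec i (first_letters i) = 2%:R^-1 *: cvec (first_letters i) by apply: step_nmin.
have two (v : V) : 2%:R *: (2%:R^-1 *: v) = v by rewrite scalerA mulfV ?scale1r // pnatr_eq0.
rewrite -[in LHS](two (cvec (first_letters i))) -sc (actsZ _ _ As) (actsZ _ _ A) sh.
rewrite (actsB _ _ A) sc (actsZ _ _ A) tE.
have -> : tau (\sum_(j <- J) eps j%:Z) = \sum_(p <- C | S p) eps p.
  rewrite CE big_map -big_filter -/J.
  have := @acts_cvec tau r [seq j%:Z | j <- J] A.
  rewrite /cvec !big_map; apply; apply/allP => p /mapP [j]; rewrite mem_filter => /andP[_ jI] ->.
  exact: letter_nat jI i_n'.
by rewrite -(exchange_half ex) scalerBr !two opprB addrC subrK.
Qed.

(** The encoding of a block by tau and sigma, expressed by the columns. *)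
Lemma block_path i g T : (0 < i <= n)%N -> block i g T <->
  (if is_min i then exists C, T = [:: C] /\ is_column i C
   else exists C C', [/\ T = [:: C; C'], is_column i C, is_column i C' & linked C C']) /\
  g = path_gallery (tableau_steps T).
Proof.
move=> i_n; have i_n' : (i <= n)%N by lia.
have col0 := first_letters_column i_n'.
rewrite /block; have M := minusculeP i_n; have [m|m] := boolP (is_min i).
  have oE : omega i = step_vec i (first_letters i) by rewrite step_min // omegaE.
  split=> [[[_ [w [C [Ww -> -> enc]]]]|[nM]]|[[C [-> col]] ->]]; last first.
  - left; split; first exact/M.
    have [w [s [Ww A wE _]]] := column_weyl i_n' col; exists w, C; split=> //.
      have [sC _ _ _] := col; rewrite /path_gallery /= sC add0r image_segment // (acts0 A).
      by rewrite oE (step_weyl Ww wE).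
    exact: column_encodes.
  - by case: nM; apply/M.
  - have [col wE] := encodes_column i_n' Ww enc; split; first by exists C.
    have [sC _ _ _] := col; have [s A] := weyl_acts Ww.
    by rewrite /path_gallery /= sC add0r image_segment // (acts0 A) oE wE.
have nM : ~ minuscule i by move/M; rewrite (negPf m).
have hE : 2%:R^-1 *: omega i = step_vec i (first_letters i).
  exact: half_omega.
(* The block given by tau and s is the path with the steps of C and C'. *)
have shape tau s C C' : weyl tau -> weyl_integral (2%:R^-1 *: omega i) s ->
    is_column i C -> is_column i C' ->
    tau (step_vec i (first_letters i)) = step_vec i C ->
    tau (s (step_vec i (first_letters i))) = step_vec i C' ->
    Gallery 0 [:: (tau @` segment 0 (2%:R^-1 *: omega i), 2%:R^-1 *: tau (omega i));
               ([set tau (s x) + 2%:R^-1 *: tau (omega i) | x in segment 0 (2%:R^-1 *: omega i)],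
                2%:R^-1 *: (tau (omega i) + tau (s (omega i))))] =
    path_gallery (tableau_steps [:: C; C']).
  move=> Wt Ws [sC _ _ _] [sC' _ _ _] E E'; have [r A] := weyl_acts Wt.
  have Ws' := (weyl_integral_QV Ws).1; have [r' A'] := weyl_acts Ws'.
  have AA := acts_comp A A'.
  have W2 : weyl (tau \o s) by apply: weyl_comp.
  rewrite scalerDr -!(actsZ _ _ A) -(actsZ _ _ A') hE E E'.
  rewrite /path_gallery /= sC sC' add0r; congr (Gallery _ [:: (_, _); (_, _)]).
    by rewrite image_segment // (acts0 A) E.
  have -> : [set tau (s x) + step_vec i C | x in segment 0 (step_vec i (first_letters i))] =
      [set step_vec i C + z | z in (tau \o s) @` segment 0 (step_vec i (first_letters i))].
    rewrite image_comp; congr image; apply/funext => x /=; exact: addrC.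
  by rewrite image_segment // -segment_shift (acts0 AA) /= E' addr0.
split=> [[[/nM //]|[_ [tau [s [C [C' [[Wt Ws] -> -> [enc enc']]]]]]]]|[[C [C' [-> col col' lk]]] ->]].
- have [Ws' Qs] := weyl_integral_QV Ws; have W2 : weyl (tau \o s) by apply: weyl_comp.
  have [col E] := encodes_column i_n' Wt enc.
  have [col' E'] := encodes_column i_n' W2 enc'; rewrite /= in E'.
  split; last exact: shape.
  exists C, C'; split=> //; rewrite /linked scalerBr -(step_nmin C m) -(step_nmin C' m) -E -E'.
  have [r A] := weyl_acts Wt; rewrite -(actsB _ _ A); apply: weyl_QV => //.
  by rewrite -opprB; apply: QVN; rewrite -hE.
- right; split=> //; have [tau [s [Wt Ws E E']]] := linked_weyl i_n m col col' lk.
  have [Ws' _] := weyl_integral_QV Ws; have W2 : weyl (tau \o s) by apply: weyl_comp.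
  exists tau, s, C, C'; split=> //.
    apply/esym/shape => //; first exact: step_weyl.
    exact: (step_weyl W2).
  split; first exact: column_encodes.
  exact: (@column_encodes i C' (tau \o s)).
Qed.

Lemma tableau_of_wordP w g T : good_word w -> tableau_of_word w g T <->
  word_tableau w T /\ g = path_gallery (tableau_steps T).
Proof.
elim: w g T => [|i w IH] g T /=.
  by move=> _; split=> [[-> ->]|[-> ->]].
move=> /andP[i_n gw]; split.
  move=> [g1 [T1 [g2 [T2 [/(block_path _ _ i_n) [H ->] /(IH _ _ gw) [wT ->] -> ->]]]]].
  rewrite concat_path -tableau_steps_cat; split=> //; move: H; case: (is_min i).
    by move=> [C [-> col]]; exists C, T2.
  by move=> [C [C' [-> col col' lk]]]; exists C, C', T2.
move=> [H ->].
have [T1 [T2 [TE wT bl]]] : exists T1 T2, [/\ T = T1 ++ T2, word_tableau w T2 &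
    block i (path_gallery (tableau_steps T1)) T1].
  move: H; have [m|m] := boolP (is_min i).
    move=> [C [T2 [-> col wT]]]; exists [:: C], T2; split=> //.
    by apply/block_path => //; rewrite m; split=> //; exists C.
  move=> [C [C' [T2 [-> col col' lk wT]]]]; exists [:: C; C'], T2; split=> //.
  by apply/block_path => //; rewrite (negPf m); split=> //; exists C, C'.
exists (path_gallery (tableau_steps T1)), T1, (path_gallery (tableau_steps T2)), T2.
split=> //; first by apply/IH.
by rewrite concat_path TE tableau_steps_cat.
Qed.

(** * Young tableaux, block by block *)

(** The column lengths of a diagram with m i columns of length i, from right to
    left. *)
Definition column_sizes (m : nat -> nat) (N : nat) : seq nat :=
  flatten [seq nseq (m i) i | i <- iota 1 N].

Definition row_sum (m : nat -> nat) (N i : nat) : nat := (\sum_(i <= j < N.+1) m j)%N.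

Lemma iota1S N : iota 1 N.+1 = iota 1 N ++ [:: N.+1].
Proof. by rewrite -{1}(addn1 N) iotaD add1n. Qed.

Lemma column_sizesS m N : column_sizes m N.+1 = column_sizes m N ++ nseq (m N.+1) N.+1.
Proof. by rewrite /column_sizes iota1S map_cat flatten_cat /= cats0. Qed.

Lemma row_sumS m N i : (i <= N.+1)%N -> row_sum m N.+1 i = (row_sum m N i + m N.+1)%N.
Proof. by move=> iN; rewrite /row_sum big_nat_recr. Qed.

Lemma size_column_sizes m N : size (column_sizes m N) = row_sum m N 1.
Proof.
elim: N => [|N IH]; first by rewrite /column_sizes /row_sum big_geq.
by rewrite column_sizesS size_cat size_nseq IH row_sumS.
Qed.

(** A partition and its transpose, compared by an induction on the maximal
    column length. *)
Lemma nth_column_sizes m N j : (0 < j <= row_sum m N 1)%N ->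
  nth 0%N (column_sizes m N) j.-1 =
  count (fun i => row_sum m N 1 + 1 - j <= row_sum m N i)%N (iota 1 N).
Proof.
elim: N j => [|N IH] j; first by rewrite /row_sum big_geq //; lia.
rewrite row_sumS // => jN; rewrite column_sizesS nth_cat size_column_sizes.
have cE : count (fun i => row_sum m N 1 + m N.+1 + 1 - j <= row_sum m N.+1 i)%N (iota 1 N.+1) =
    (count (fun i => row_sum m N 1 + m N.+1 + 1 - j <= row_sum m N i + m N.+1)%N (iota 1 N) +
    (row_sum m N 1 + m N.+1 + 1 - j <= m N.+1))%N.
  rewrite iota1S count_cat /= addn0; congr (_ + _)%N.
    by apply: eq_in_count => i; rewrite mem_iota => iN; rewrite row_sumS //; lia.
  by rewrite /row_sum big_nat1.
rewrite cE; case: ltnP => jp.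
  rewrite IH; last by lia.
  have -> : (row_sum m N 1 + m N.+1 + 1 - j <= m N.+1)%N = false by lia.
  by rewrite addn0; apply: eq_count => i; lia.
rewrite nth_nseq; have -> : (j.-1 - row_sum m N 1 < m N.+1)%N by lia.
have -> : (row_sum m N 1 + m N.+1 + 1 - j <= m N.+1)%N by lia.
rewrite (eq_count (a2 := predT)) => [|i]; last by rewrite /=; lia.
by rewrite count_predT size_iota addn1.
Qed.

Lemma has_shapeP (p : nat -> nat) m T : (0 < n)%N ->
  (forall i, (0 < i <= n)%N -> p i = row_sum m n i) ->
  has_shape n p T <-> [seq size C | C <- T] = column_sizes m n.
Proof.
move=> n0 pE; rewrite /has_shape (pE 1%N); last by lia.
have E j : (0 < j <= row_sum m n 1)%N ->
    count (fun i => row_sum m n 1 + 1 - j <= p i)%N (iota 1 n) = nth 0%N (column_sizes m n) j.-1.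
  move=> jn; rewrite nth_column_sizes //; apply: eq_in_count => i; rewrite mem_iota => i_n.
  by rewrite pE //; lia.
split=> [[sT H]|TE].
  apply: (eq_from_nth (x0 := 0%N)); first by rewrite size_map sT size_column_sizes.
  move=> j; rewrite size_map sT => jT; rewrite (nth_map [::]) ?sT //.
  by have := H j.+1 jT; rewrite E.
have sT : size T = row_sum m n 1 by rewrite -size_column_sizes -TE size_map.
split=> // j jn; rewrite E // -TE (nth_map [::]) // sT; lia.
Qed.

(** The number of columns of length i in a tableau for lambda. *)
Definition multiplicity (a : nat -> nat) (i : nat) : nat :=
  if is_min i then a i else (2 * a i)%N.

Lemma row_lengthE a i : (0 < i <= n)%N -> row_length t n a i = row_sum (multiplicity a) n i.
Proof.
move=> i_n; rewrite /row_length /row_sum /multiplicity /is_min; case: (t).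
- by [].
- rewrite big_nat_recr /=; last by lia.
  rewrite eqxx; congr (_ + _)%N; apply: eq_big_nat => j jn.
  by have -> : (j == n) = false by lia.
- case: eqP => [->|i1].
    rewrite [RHS]big_ltn /=; last by lia.
    congr (_ + _)%N; apply: eq_big_nat => j jn.
    by have -> : (j == 1%N) = false by lia.
  apply: eq_big_nat => j jn.
  by have -> : (j == 1%N) = false by lia.
Qed.

Definition word_sizes (w : seq nat) : seq nat :=
  flatten [seq (if is_min i then [:: i] else [:: i; i]) | i <- w].

Lemma word_sizes_cat w1 w2 : word_sizes (w1 ++ w2) = word_sizes w1 ++ word_sizes w2.
Proof. by rewrite /word_sizes map_cat flatten_cat. Qed.

Lemma word_sizes_nseq k i : word_sizes (nseq k i) = nseq (if is_min i then k else 2 * k)%N i.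
Proof.
elim: k => [|k IH]; first by case: (is_min i).
have -> : word_sizes (nseq k.+1 i) =
  (if is_min i then [:: i] else [:: i; i]) ++ word_sizes (nseq k i) by [].
by rewrite IH; case: (is_min i); rewrite // mulnS.
Qed.

Lemma word_sizes_lambda a : word_sizes (lambda_word n a) = column_sizes (multiplicity a) n.
Proof.
rewrite /lambda_word /column_sizes; elim: (iota 1 n) => //= i s IH.
by rewrite word_sizes_cat IH word_sizes_nseq.
Qed.

Lemma good_lambda_word a : good_word (lambda_word n a).
Proof.
apply/allP => i /flattenP [s /mapP [j]]; rewrite mem_iota => jn ->.
by move=> /nseqP [->]; lia.
Qed.

Definition columns (T : tableau) : Prop := forall C, C \in T -> is_column (size C) C.

Lemma word_tableau_cat w1 w2 T : word_tableau (w1 ++ w2) T <->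
  exists T1 T2, [/\ T = T1 ++ T2, word_tableau w1 T1 & word_tableau w2 T2].
Proof.
elim: w1 T => [|i w IH] T /=.
  by split=> [H|[T1 [T2 [-> ->]]]] //; exists [::], T.
case: (is_min i); split.
- by move=> [C [T' [-> col /IH [T1 [T2 [-> h1 h2]]]]]]; exists (C :: T1), T2; split=> //; exists C, T1.
- move=> [T1 [T2 [-> [C [T' [-> col h1]]] h2]]]; exists C, (T' ++ T2); split=> //.
  by apply/IH; exists T', T2.
- move=> [C [C' [T' [-> col col' lk /IH [T1 [T2 [-> h1 h2]]]]]]]; exists (C :: C' :: T1), T2.
  by split=> //; exists C, C', T1.
- move=> [T1 [T2 [-> [C [C' [T' [-> col col' lk h1]]]] h2]]]; exists C, C', (T' ++ T2); split=> //.
  by apply/IH; exists T', T2.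
Qed.

Lemma word_tableau_sizes w T : word_tableau w T ->
  [seq size C | C <- T] = word_sizes w /\ columns T.
Proof.
elim: w T => [|i w IH] T /=; first by move=> ->.
case m: (is_min i).
  move=> [C [T' [-> col /IH [E cT]]]]; have [sC _ _ _] := col.
  rewrite /word_sizes /= m /= sC E; split=> // D; rewrite inE => /orP[/eqP ->|]; last exact: cT.
  by rewrite sC.
move=> [C [C' [T' [-> col col' lk /IH [E cT]]]]]; have [sC _ _ _] := col; have [sC' _ _ _] := col'.
rewrite /word_sizes /= m /= sC sC' E; split=> // D; rewrite !inE => /or3P[/eqP ->|/eqP ->|]; last exact: cT.
  by rewrite sC.
by rewrite sC'.
Qed.

Lemma word_tableau_min w T : all is_min w ->
  word_tableau w T <-> [seq size C | C <- T] = word_sizes w /\ columns T.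
Proof.
move=> mw; split; first exact: word_tableau_sizes.
elim: w T mw => [|i w IH] T; first by case: T => // C T _ [].
move=> /= /andP[m mw] []; rewrite m /word_sizes /= m /= -/(word_sizes w).
case: T => [|C T] //= [sC E] cT.
exists C, T; split=> //; first by rewrite -sC; apply: cT; rewrite mem_head.
by apply: IH => //; split=> // D DT; apply: cT; rewrite inE DT orbT.
Qed.

(** The pairs of columns of the non-minuscule blocks are the columns in the
    positions 2 j and 2 j + 1, counted from 0. *)
Lemma word_tableau_nmin w T : all (predC is_min) w ->
  word_tableau w T <-> [/\ [seq size C | C <- T] = word_sizes w, columns T &
    forall j, (j < size w)%N -> exchanged (nth [::] T (2 * j)) (nth [::] T (2 * j).+1)].
Proof.
have nA i : ~~ is_min i -> t <> TypeA by move=> m tA; move: m; rewrite /is_min tA.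
move=> mw; split.
  move=> wT; have [E cT] := word_tableau_sizes wT; split=> //.
  elim: w T mw wT {E cT} => [|i w IH] T //= /andP[m mw]; rewrite (negPf m).
  move=> [C [C' [T' [-> col col' lk wT]]]] [|j] jw.
    exact/(linkedP (nA i m) col col').
  by rewrite mulnS /=; apply: IH.
elim: w T mw => [|i w IH] T /= mw [].
  by case: T.
move: mw => /andP[m mw]; rewrite /word_sizes /= (negPf m) /= -/(word_sizes w).
case: T => [|C [|C' T]] //= [sC sC' E] cT lk; exists C, C', T.
have col : is_column i C by rewrite -sC; apply: cT; rewrite mem_head.
have col' : is_column i C' by rewrite -sC'; apply: cT; rewrite !inE eqxx orbT.
split=> //; first exact/(linkedP (nA i m) col col')/(lk 0%N isT).
apply: IH => //; split=> // [D DT|j jw]; first by apply: cT; rewrite !inE DT !orbT.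
  by have := lk j.+1 jw; rewrite mulnS.
Qed.

Lemma young_columns a T : young_tableaux t n a T <->
  [/\ has_shape n (row_length t n a) T, columns T & pair_condition t n a T].
Proof.
split=> [[H1 H2 H3 H4]|[H1 H2 H3]]; split=> //.
- move=> C CT; have /andP[lC soC] := H2 C CT; split=> // p; exact: H3.
- by move=> C /H2 [_ -> ->].
- by move=> C p /H2 [_ _ _ nC] /nC.
Qed.

Lemma size_lambda_part (a : nat -> nat) i k :
  size (flatten [seq nseq (a j) j | j <- iota i k]) = (\sum_(i <= j < i + k) a j)%N.
Proof.
rewrite size_flatten /shape -map_comp sumnE big_map /index_iota addKn.
by apply: eq_bigr => j _ /=; rewrite size_nseq.
Qed.

Lemma word_tableau_split w1 w2 T : word_tableau (w1 ++ w2) T <->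
  word_tableau w1 (take (size (word_sizes w1)) T) /\
  word_tableau w2 (drop (size (word_sizes w1)) T).
Proof.
rewrite word_tableau_cat; split=> [[T1 [T2 [-> h1 h2]]]|[h1 h2]].
  have [E _] := word_tableau_sizes h1; rewrite -E size_map.
  by rewrite take_size_cat // drop_size_cat.
by exists (take (size (word_sizes w1)) T), (drop (size (word_sizes w1)) T); rewrite cat_take_drop.
Qed.

Lemma columns_split k (T : tableau) : columns T <-> columns (take k T) /\ columns (drop k T).
Proof.
split=> [H|[H1 H2] C]; first by split=> C CT; apply: H; rewrite -(cat_take_drop k T) mem_cat CT ?orbT.
by rewrite -(cat_take_drop k T) mem_cat => /orP[/H1|/H2].
Qed.

Lemma sizes_split w1 w2 (T : tableau) : [seq size C | C <- T] = word_sizes (w1 ++ w2) <->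
  [seq size C | C <- take (size (word_sizes w1)) T] = word_sizes w1 /\
  [seq size C | C <- drop (size (word_sizes w1)) T] = word_sizes w2.
Proof.
rewrite word_sizes_cat map_take map_drop; split=> [->|[E1 E2]].
  by rewrite take_size_cat // drop_size_cat.
by rewrite -[LHS](cat_take_drop (size (word_sizes w1))) E1 E2.
Qed.

(** The minuscule blocks are at the end of the word in type B and at its
    beginning in type C; so the word is cut into its minuscule and its
    non-minuscule part, and the conditions of a Young tableau are cut
    accordingly. *)
Lemma young_word_tableau a T : (0 < n)%N ->
  young_tableaux t n a T <-> word_tableau (lambda_word n a) T.
Proof.
move=> n0; rewrite young_columns.
have sh := has_shapeP T n0 (fun i => @row_lengthE a i); rewrite -word_sizes_lambda in sh.
have all_part (P : pred nat) i k : (forall j, (i <= j < i + k)%N -> P j) ->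
    all P (flatten [seq nseq (a j) j | j <- iota i k]).
  by move=> H; apply/allP => x /flattenP [s /mapP [j]]; rewrite mem_iota => /H Pj -> /nseqP [->].
have nth_part k (S : tableau) j : (j < k)%N -> nth [::] (take k S) j = nth [::] S j.
  by move=> jk; rewrite nth_take.
have : (t = TypeA) \/ (t = TypeB \/ t = TypeC) by have [|/typeBC] := typeA_dec t; auto.
case=> [tA|[tB|tC]].
- have mw : all is_min (lambda_word n a) by apply: all_part => j _; rewrite /is_min tA.
  rewrite word_tableau_min //; split=> [[/sh E cT _]|[/sh H cT]] //.
  by split=> //; rewrite /pair_condition tA.
- have lE : lambda_word n a = flatten [seq nseq (a j) j | j <- iota 1 n.-1] ++ nseq (a n) n.
    by rewrite /lambda_word -{1}(prednK n0) iota1S map_cat flatten_cat /= cats0 prednK.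
  set w1 := flatten _ in lE; set w2 := nseq _ _ in lE.
  have m1 : all (predC is_min) w1 by apply: all_part => j jn; rewrite /= /is_min tB; lia.
  have m2 : all is_min w2 by apply/allP => j /nseqP [-> _]; rewrite /is_min tB.
  have s1 : size w1 = (\sum_(1 <= i < n) a i)%N by rewrite size_lambda_part add1n prednK.
  have k1 : size (word_sizes w1) = (2 * size w1)%N.
    by elim: w1 m1 {lE s1} => //= i w IH /andP[/negPf m mw]; rewrite /word_sizes /= m /= IH // mulnS.
  have pE : pair_condition t n a T <-> forall j, (j < size w1)%N ->
      exchanged (nth [::] (take (2 * size w1) T) (2 * j)) (nth [::] (take (2 * size w1) T) (2 * j).+1).
    rewrite /pair_condition tB s1; split=> H j jn.
      have [S ex] := H j.+1 jn; rewrite !nth_part; [|lia|lia].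
      exists S; first by rewrite tB.
      have e1 : (2 * j)%N = (2 * j.+1 - 1).-1 by lia.
      have e2 : (2 * j).+1 = (2 * j.+1).-1 by lia.
      by rewrite e2 e1.
    have [S _ ex] := H j.-1 ltac:(lia); exists S; move: ex; rewrite !nth_part; [|lia|lia].
    have -> : (2 * j.-1)%N = (2 * j - 1).-1 by lia.
    by have -> : (2 * j - 1).-1.+1 = (2 * j).-1 by lia.
  rewrite (propext sh) (propext pE) lE (propext (word_tableau_split _ _ _)) k1.
  rewrite (propext (word_tableau_nmin _ m1)) (propext (word_tableau_min _ m2)).
  rewrite (propext (columns_split (2 * size w1) T)) (propext (sizes_split _ _ _)) k1.
  split=> [[[e1 e2] [c1 c2] p]|[[e1 c1 p] [e2 c2]]]; by [].
- have n1 : n.-1.+1 = n by rewrite prednK.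
  have lE : lambda_word n a = nseq (a 1%N) 1%N ++ flatten [seq nseq (a j) j | j <- iota 2 n.-1].
    by rewrite /lambda_word -{1}n1.
  set w2 := flatten _ in lE; set w1 := nseq _ _ in lE.
  have m2 : all (predC is_min) w2 by apply: all_part => j jn; rewrite /= /is_min tC; lia.
  have m1 : all is_min w1 by apply/allP => j /nseqP [-> _]; rewrite /is_min tC.
  have s2 : size w2 = (\sum_(2 <= i < n.+1) a i)%N by rewrite size_lambda_part add2n n1.
  have k1 : size (word_sizes w1) = a 1%N by rewrite word_sizes_nseq size_nseq /is_min tC.
  have pE : pair_condition t n a T <-> forall j, (j < size w2)%N ->
      exchanged (nth [::] (drop (a 1%N) T) (2 * j)) (nth [::] (drop (a 1%N) T) (2 * j).+1).
    rewrite /pair_condition tC s2; set A := a 1%N.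
    have e1 j : (A + 2 * j)%N = (A + 2 * j.+1 - 1).-1 by clearbody A; lia.
    have e2 j : (A + (2 * j).+1)%N = (A + 2 * j.+1).-1 by clearbody A; lia.
    split=> H j jn.
      have [S ev ex] := H j.+1 jn; rewrite !nth_drop e1 e2.
      by exists S.
    have [S ev ex] := H j.-1 ltac:(lia); move: ev ex; rewrite !nth_drop e1 e2.
    have -> : j.-1.+1 = j by lia.
    by move=> ev ex; exists S => //; apply: ev.
  rewrite (propext sh) (propext pE) lE (propext (word_tableau_split _ _ _)) k1.
  rewrite (propext (word_tableau_nmin _ m2)) (propext (word_tableau_min _ m1)).
  rewrite (propext (columns_split (a 1%N) T)) (propext (sizes_split _ _ _)) k1.
  split=> [[[e1 e2] [c1 c2] p]|[[e1 c1] [e2 c2 p]]]; by [].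
Qed.

(** * Positively folded galleries have semistandard tableaux *)

Local Notation dominant_chamber := (dominant_chamber R t n).
Local Notation sector := (sector R t n).
Local Notation positively_folded := (positively_folded R t n).
Local Notation positively_folded_at := (positively_folded_at R t n).
Local Notation positive_folding := (positive_folding R t n).
Local Notation minimal_at := (minimal_at R t n).

(** A step is dominant only if its letters are the k smallest ones: otherwise
    the root of a missing p and a present q > p would be negative on it. *)
Lemma dominant_set k D : uniq D -> all letter D -> size D = k -> (k <= n)%N ->
  (forall p, p \in D -> - p \notin D) ->
  (forall alpha, pos_roots alpha -> 0 <= dot alpha (step_vec k D)) ->
  perm_eq D (first_letters k).
Proof.
move=> uD lD sD kn nD dom; have col := first_letters_column kn; have [sF lF _ _] := col.
have uF := column_uniq col.
suff sub : {subset first_letters k <= D}.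
  rewrite perm_sym; apply: uniq_perm => //; apply: (uniq_min_size uF sub _).2.
  by rewrite sD sF.
move=> p pF; apply/negPn/negP => pD; have lp := allP lF p pF.
have [q qD qF] : exists2 q, q \in D & q \notin first_letters k.
  case: (pselect (exists2 q, q \in D & q \notin first_letters k)) => // no; exfalso.
  have sub : {subset D <= first_letters k}.
    by move=> q qD; apply/negPn/negP => qF; apply: no; exists q.
  have [_ E] := uniq_min_size uD sub ltac:(by rewrite sD sF).
  by rewrite E pF in pD.
have lq := allP lD q qD.
have pq : letter_lt p q by move: pF qF; rewrite letter_ltE !mem_first_letters; have := letter_neq0 lq; lia.
have := dom (root_of p q) _; rewrite dotZr dot_root_cvec // => H.
have {}H : 0 <= step_scale k * (root_scale p q * (mult p D - mult q D)).
  by apply: H; apply/pos_rootsP; exists p, q.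
move: H; rewrite pmulr_rge0 ?step_scale_gt0 // pmulr_rge0 ?root_scale_gt0 //.
rewrite /mult (negPf pD) qD (negPf (nD q qD)) subr0 sub0r.
by case: (- p \in D) => /=; lra.
Qed.

(** The inverse of tau takes the step into the dominant chamber. *)
Lemma sector_column x tau s k C : weyl tau -> acts tau s -> is_column k C -> (k <= n)%N ->
  segment x (x + step_vec k C) `<=` sector x tau -> perm_eq C (images s k).
Proof.
move=> Wt A col kn sub; have [sC lC soC nC] := col; have uC := column_uniq col.
have [t' [Wt' tK t'K]] := weyl_inv Wt; have [s' A'] := weyl_acts Wt'.
have [c [ac dc] cE] := sub _ (segment_right _ _).
have {}cE : tau c = step_vec k C by apply: (addrI x).
have cE' : c = step_vec k (map s' C).
  by rewrite -(tK c) cE /step_vec (actsZ _ _ A') (acts_cvec A').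
have ss' p : letter p -> s (s' p) = p.
  move=> lp; have AA := acts_comp A A'.
  have E : tau \o t' = id by apply/funext => y /=; rewrite t'K.
  by rewrite E in AA; apply: (acts_uniq AA acts_id lp).
have P : perm_eq (map s' C) (first_letters k).
  apply: dominant_set; rewrite ?size_map //.
  - by rewrite map_inj_uniq //; apply: acts_inj A'.
  - by rewrite all_map; apply/allP => p pC /=; rewrite (acts_letter A') (allP lC).
  - move=> p /mapP [q qC ->]; rewrite -(acts_opp A') ?(letter_neq0 (allP lC q qC)) //.
    by rewrite (mem_map (acts_inj A')) nC.
  - by move=> alpha pa; rewrite -cE'; apply: dc.
have := perm_map s P; rewrite -map_comp /first_letters -map_comp.
have -> : [seq (s \o s') i | i <- C] = C; last by [].
by rewrite -[RHS]map_id; apply/eq_in_map => p pC /=; rewrite ss' // (allP lC).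
Qed.

Lemma count_images_prefix (s : int -> int) k k' (P : pred int) : (k <= k')%N ->
  (count P (images s k) <= count P (images s k'))%N.
Proof.
by move=> kk; rewrite /images -(subnKC kk) iotaD map_cat count_cat leq_addr.
Qed.

(** The comparison of two columns by counting, translated into a comparison of
    entries. *)
Lemma count_nth_le k k' C D i : is_column k C -> is_column k' D -> (i < k)%N -> (i < k')%N ->
  (forall z, count (letter_le^~ z) C <= count (letter_le^~ z) D)%N ->
  letter_le (nth 0 D i) (nth 0 C i).
Proof.
move=> colC colD ik ik' H; have [sC _ soC _] := colC; have [sD _ soD _] := colD.
set z := nth 0 C i; apply/negPn/negP => Dz.
have c1 : (i < count (letter_le^~ z) C)%N.
  rewrite -(cat_take_drop i.+1 C) count_cat; apply: leq_trans (leq_addr _ _).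
  have st : size (take i.+1 C) = i.+1 by rewrite size_takel // sC.
  rewrite -{1}st; apply: eq_leq; apply/esym/eqP; rewrite -all_count; apply/(all_nthP 0) => j.
  rewrite st => ji; rewrite nth_take // /z.
  have [->|ji'] := eqVneq j i; first by rewrite /letter_le eqxx.
  by rewrite /letter_le (column_nth_lt colC) ?orbT //; lia.
have c2 : (count (letter_le^~ z) D <= i)%N.
  rewrite -(cat_take_drop i D) count_cat [X in (_ + X)%N](_ : _ = 0%N) ?addn0.
    by apply: leq_trans (count_size _ _) _; rewrite size_takel // sD ltnW.
  apply/eqP; rewrite -leqn0 leqNgt -has_count; apply/negP => /(has_nthP 0) [j].
  rewrite size_drop nth_drop sD => jD le_z.
  move: Dz; have [j0|j0] := posnP j; first by rewrite -{1}(addn0 i) -{1}j0 le_z.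
  have : letter_lt (nth 0 D i) (nth 0 D (i + j)) by apply: (column_nth_lt colD); lia.
  by move: le_z; rewrite /letter_le !letter_ltE; lia.
by have := leq_trans c1 (leq_trans (H z) c2); rewrite ltnn.
Qed.

Lemma word_tableau_nth w T j : good_word w -> word_tableau w T -> (j < size T)%N ->
  is_column (size (nth [::] T j)) (nth [::] T j) /\ (0 < size (nth [::] T j) <= n)%N.
Proof.
move=> gw wT jT; have [E cT] := word_tableau_sizes wT.
have mem : nth [::] T j \in T by rewrite mem_nth.
split; first exact: cT.
have : size (nth [::] T j) \in word_sizes w by rewrite -E; apply: map_f.
move=> /flattenP [s /mapP [i iw ->]]; have := allP gw i iw.
by case: (is_min i); rewrite !inE => h /=; [move/eqP ->|move/orP => [] /eqP ->].
Qed.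

Lemma word_sizes_sorted w : sorted leq w -> sorted leq (word_sizes w).
Proof.
move=> sw; rewrite sorted_pairwise; last exact: leq_trans.
move: sw; rewrite sorted_pairwise; last exact: leq_trans.
elim: w => //= i w IH /andP[/allP iw pw]; have {}IH := IH pw.
have all_i : all (leq i) (word_sizes w).
  apply/allP => j /flattenP [s /mapP [k kw ->]]; have := iw k kw.
  by case: (is_min k); rewrite !inE => h /=; [move/eqP ->|move/orP => [] /eqP ->].
by rewrite /word_sizes /=; case: (is_min i) => /=; rewrite -/(word_sizes w) ?leqnn ?all_i IH.
Qed.

Lemma lambda_word_sorted a : sorted leq (lambda_word n a).
Proof.
rewrite sorted_pairwise; last exact: leq_trans.
have : pairwise leq (iota 1 n) by rewrite -sorted_pairwise ?iota_sorted //; exact: leq_trans.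
rewrite /lambda_word; elim: (iota 1 n) => //= i s IH /andP[/allP h ps].
rewrite pairwise_cat IH // andbT; apply/andP; split.
  apply/allrelP => x y /nseqP [-> _] /flattenP [r /mapP [j js ->]] /nseqP [-> _]; exact: h.
by elim: (a i) => //= k ->; rewrite andbT; apply/allP => x /nseqP [-> _].
Qed.

Lemma tableau_size_mono w T j : sorted leq w -> word_tableau w T -> (j.+1 < size T)%N ->
  (size (nth [::] T j) <= size (nth [::] T j.+1))%N.
Proof.
move=> sw wT jT; have [E _] := word_tableau_sizes wT.
have := word_sizes_sorted sw; rewrite -E => /(sortedP 0%N) /(_ j).
by rewrite size_map !(nth_map [::]) ?(ltnW jT) //; apply.
Qed.

Lemma nth_tableau_steps T k : (k < size T)%N ->
  nth 0 (tableau_steps T) k = step_vec (size (nth [::] T k)) (nth [::] T k).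
Proof. by move=> kT; rewrite (nth_map [::]). Qed.

Lemma folded_semistandard w T : good_word w -> sorted leq w -> word_tableau w T ->
  positively_folded (path_gallery (tableau_steps T)) -> semistandard T.
Proof.
move=> gw sw wT [_ [tau [Wt sub br]]] j i jT ij ij'.
rewrite size_path size_map in Wt sub br.
have jT' := ltnW jT.
have [colC kC] := word_tableau_nth gw wT jT'; have [colD kD] := word_tableau_nth gw wT jT.
set C := nth _ _ j in ij colC kC *; set D := nth _ _ j.+1 in ij' colD kD *.
have kk : (size C <= size D)%N := tableau_size_mono sw wT jT.
have [s A] := weyl_acts (Wt j jT'); have [s' A'] := weyl_acts (Wt j.+1 jT).
have seg k (kT : (k < size T)%N) : edge_at (path_gallery (tableau_steps T)) k =
    segment (vertex_at (path_gallery (tableau_steps T)) k)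
            (vertex_at (path_gallery (tableau_steps T)) k +
             step_vec (size (nth [::] T k)) (nth [::] T k)).
  have kT' : (k < size (tableau_steps T))%N by rewrite size_map.
  by rewrite edge_path // vertex_path ?(ltnW kT') // partial_sumS // nth_tableau_steps.
have PC : perm_eq C (images s (size C)).
  apply: sector_column (Wt j jT') A colC _ _; first by lia.
  by have := sub j jT'; rewrite seg //; apply.
have PD : perm_eq D (images s' (size D)).
  apply: sector_column (Wt j.+1 jT) A' colD _ _; first by lia.
  by have := sub j.+1 jT; rewrite seg //; apply.
apply: (count_nth_le colC colD ij ij') => z.
rewrite (permP PC) (permP PD).
have [_ H] := bruhat_le_count (Wt j.+1 jT) (br j jT).
apply: leq_trans (H s' s _ z A' A _) _; first by lia.
exact: count_images_prefix.
Qed.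

(** * Sectors and foldings at special vertices *)

(** The increasing order of the images, beyond the set that they form, is what
    allows to lift a further column above tau. *)
Definition lifts (tau : V -> V) (C : seq int) : Prop :=
  weyl tau /\ exists s, acts tau s /\ forall j : nat, (0 < j <= size C)%N -> s j = entry C j.

Lemma lifts_step tau C : (size C <= n)%N -> lifts tau C ->
  tau (step_vec (size C) (first_letters (size C))) = step_vec (size C) C.
Proof.
move=> kn [Wt [s [A sE]]]; rewrite /step_vec (actsZ _ _ A) (acts_cvec A); last first.
  by case: (first_letters_column kn).
have -> // : map s (first_letters (size C)) = C.
by rewrite /first_letters -map_comp; apply: (images_entry (s := s) erefl sE).
Qed.

(** The leftmost column comes last in T. Each column is lifted to an element
    above the one chosen for the column on its left, which maps the initial
    letters to entries that the row condition bounds. *)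
Lemma lift_chain (T : tableau) :
  (forall j, (j < size T)%N -> is_column (size (nth [::] T j)) (nth [::] T j) /\
     (0 < size (nth [::] T j) <= n)%N) ->
  (forall j, (j.+1 < size T)%N -> (size (nth [::] T j) <= size (nth [::] T j.+1))%N) ->
  semistandard T ->
  exists tau : nat -> V -> V, (forall j, (j < size T)%N -> lifts (tau j) (nth [::] T j)) /\
    forall j, (j.+1 < size T)%N -> bruhat_le (tau j.+1) (tau j).
Proof.
elim: T => [|C T IH] cols mono ss; first by exists (fun=> id).
have [|||tau [lt br]] := IH.
- by move=> j jT; apply: (cols j.+1).
- by move=> j jT; apply: (mono j.+1).
- by move=> j i jT; apply: (ss j.+1).
have [colC kC] := cols 0%N isT; rewrite /= in colC kC.
have [w [Lw brw]] : exists w, lifts w C /\ ((0 < size T)%N -> bruhat_le (tau 0%N) w).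
  have [T0|T0] := posnP (size T).
    have [w [s [Ww A sE]]] := column_exists_weyl (ltac:(lia) : (size C <= n)%N) colC.
    by exists w; split=> //; split=> //; exists s.
  have [Wu [s [A sE]]] := lt 0%N T0; have [colD kD] := cols 1%N T0; rewrite /= in colD kD.
  have CD : (size C <= size (nth [::] T 0))%N := mono 0%N T0.
  have [|||w [s' [Ww A' uw s'E]]] := column_lift Wu A colC CD _ _ _.
  - by lia.
  - by move=> i j i0 ij; rewrite !sE; [apply: (column_nth_lt colD)|..]; lia.
  - move=> j jC; rewrite sE; last by lia.
    by apply: (ss 0%N j.-1 T0); rewrite /=; lia.
  - by exists w; split=> //; split=> //; exists s'.
exists (fun j => if j is j'.+1 then tau j' else w); split=> [[|j] jT|[|j] jT] //.
- exact: lt.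
- exact: brw.
- exact: br.
Qed.

Lemma first_step_dominant k alpha : (0 < k <= n)%N -> pos_roots alpha ->
  0 <= dot alpha (step_vec k (first_letters k)).
Proof.
move=> kn /pos_rootsP [p [q [lp lq pq ->]]]; have col := first_letters_column (ltac:(lia) : (k <= n)%N).
rewrite dot_root_step // pmulr_rge0 ?step_scale_gt0 // pmulr_rge0 ?root_scale_gt0 //.
rewrite /mult !mem_first_letters; have p0 := letter_neq0 lp; have q0 := letter_neq0 lq.
move: pq; rewrite letter_ltE.
case: (boolP (0 < p <= k%:Z)) => a; case: (boolP (0 < - p <= k%:Z)) => b;
  case: (boolP (0 < q <= k%:Z)) => c; case: (boolP (0 < - q <= k%:Z)) => d pq /=;
  try (exfalso; lia); lra.
Qed.

Lemma first_step_in_chamber k : (0 < k <= n)%N -> dominant_chamber (step_vec k (first_letters k)).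
Proof.
move=> kn; split; last by move=> alpha; apply: first_step_dominant.
have [_ lF _ _] := first_letters_column (ltac:(lia) : (k <= n)%N).
exact/apartmentZ/apartment_cvec.
Qed.

Lemma dominantZ a c : 0 <= a -> dominant_chamber c -> dominant_chamber (a *: c).
Proof.
move=> a0 [ac dc]; split; first exact: apartmentZ.
by move=> alpha pa; rewrite dotZr mulr_ge0 ?dc.
Qed.

Lemma segment_sector x w c : weyl w -> dominant_chamber c ->
  segment x (x + w c) `<=` sector x w.
Proof.
move=> Ww dc y /segmentP [r [/andP[r0 r1] ->]]; have [s A] := weyl_acts Ww.
by exists (r *: c); [exact: dominantZ|rewrite (actsZ _ _ A) [x + w c]addrC addrK].
Qed.

Lemma dominant_sign alpha w : weyl w -> pos_roots alpha -> exists gamma, roots gamma /\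
  forall y, dot alpha (w y) = dot gamma y.
Proof.
move=> Ww pa; have [w' [Ww' wK w'K]] := weyl_inv Ww.
have [s A] := weyl_acts Ww; have [s' A'] := weyl_acts Ww'.
exists (w' alpha); split; first by apply: weyl_roots A' _; left.
by move=> y; rewrite -{1}(w'K alpha) (acts_dot A).
Qed.

(** The opposite of w c + w c' is taken into the dominant chamber by some v. A
    root has the same weak sign on w c and on w c', which lie in a common
    chamber; so v takes both into the antidominant chamber, and the inverse of v
    is the class of the sector sought. *)
Lemma minimal_common x w c c' : weyl w -> dominant_chamber c -> dominant_chamber c' ->
  grid (- (w c + w c')) -> minimal_at (segment (x - w c) x) x (segment x (x + w c')).
Proof.
move=> Ww dc dc' g; have [s A] := weyl_acts Ww; have [ac _] := dc; have [ac' _] := dc'.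
have [|v Wv [av dv]] := dominant_conj _ g.
  by apply/apartmentN/apartmentD; apply: acts_apartment A _ _.
have [s' A'] := weyl_acts Wv; have [tau [Wt vK tK]] := weyl_inv Wv.
have W2 : weyl (v \o w) by apply: weyl_comp.
have key alpha : pos_roots alpha -> dot alpha (v (w c)) <= 0 /\ dot alpha (v (w c')) <= 0.
  move=> pa; have := dv alpha pa; have [gamma [rg gE]] := dominant_sign W2 pa.
  rewrite (actsN _ A') (actsD _ _ A') dotNr dotDr.
  have := gE c; have := gE c'; rewrite /= => -> ->.
  case: rg => pg; first by have := dc.2 _ pg; have := dc'.2 _ pg; lra.
  by have := dc.2 _ pg; have := dc'.2 _ pg; rewrite !dotNl; lra.
have [r At] := weyl_acts Wt.
have opp y : dominant_chamber y -> (forall alpha, pos_roots alpha -> dot alpha (v (w y)) <= 0) ->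
    dominant_chamber (- v (w y)).
  move=> [ay _] H; split; first by apply/apartmentN/(acts_apartment A')/(acts_apartment A).
  by move=> alpha pa; rewrite dotNr oppr_ge0 H.
exists tau => //; split=> y.
- rewrite segmentC => /segmentP [a [/andP[a0 a1] ->]].
  exists (a *: (- v (w c))); first by apply/dominantZ/opp => // alpha /key [].
  rewrite (actsZ _ _ At) (actsN _ At) vK; congr (_ + _ *: _).
  by rewrite addrC addKr.
- move=> /segmentP [a [/andP[a0 a1] ->]].
  exists (a *: (- v (w c'))); first by apply/dominantZ/opp => // alpha /key [].
  rewrite (actsZ _ _ At) (actsN _ At) vK scalerN opprK; congr (_ + _ *: _).
  by rewrite addrC addKr.
Qed.

(** The wall for the positive root of p < q through v has the antidominant
    sector and the reflected edge on its negative side, and the edge itself on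
    the positive side. *)
Lemma folding_up v p q f : is_vertex v -> letter p -> letter q -> letter_lt p q ->
  dot (root_of p q) v \is a Num.int -> 0 < dot (root_of p q) f ->
  positive_folding v (segment v (v + rf p q f)) (segment v (v + f)).
Proof.
move=> vv lp lq pq /intrP [m vm] fpos; have npq := letter_lt_neq pq.
have A := acts_refl lp lq npq.
have av := vertex_apartment vv.
have rb : roots (root_of p q) by apply/rootsP; exists p, q.
have pb : pos_roots (root_of p q) by apply/pos_rootsP; exists p, q.
have sh (b : R) : m%:~R + b + (- m)%:~R = b by rewrite intrN addrAC subrr add0r.
have reflv y : refl (root_of p q) (- m) (v + y) = v + rf p q y.
  rewrite reflE // refl_root0 // dotDr vm sh.
  by rewrite addrA.
have brf y : dot (root_of p q) (rf p q y) = - dot (root_of p q) y.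
  by rewrite refl_root0 // dotBr dotZr dot_root_coroot //; ring.
exists (root_of p q), (- m); split=> //.
- by split=> //; rewrite vm intrN subrr.
- apply/seteqP; split=> y.
    move=> /segmentP [a [a01 ->]]; exists (v + a *: rf p q f).
      by apply/segmentP; exists a; split=> //; rewrite [v + rf p q f]addrC addrK.
    by rewrite reflv (actsZ _ _ A) reflK // [v + f]addrC addrK.
  move=> [_ /segmentP [a [a01 ->]] <-]; apply/segmentP; exists a; split=> //.
  by rewrite [v + rf p q f]addrC addrK reflv (actsZ _ _ A) reflK // [v + f]addrC addrK.
- left; split.
  + move=> y [/segmentP [a [/andP[a0 a1] ->]]|[c dc <-]].
      rewrite [v + rf p q f]addrC addrK dotDr dotZr brf vm sh.
      by rewrite mulrN oppr_le0 mulr_ge0 // ltW.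
    by rewrite dotBr vm sh oppr_le0; apply: dc.2.
  + move=> y [/segmentP [a [/andP[a0 a1] ->]] E].
    have yE : v + a *: (v + f - v) = v + a *: f by rewrite [v + f]addrC addrK.
    rewrite yE in E *.
    rewrite dotDr dotZr vm sh mulr_gt0 //.
    rewrite lt_neqAle a0 andbT; apply/eqP => a00; move: E; rewrite -a00 scale0r addr0.
    have /is_vertexP -> := vv => E.
    have : segment v (v + f) (v + f) by apply: segment_right.
    rewrite -E /= => /eqP; rewrite -subr_eq0 addrC addKr => /eqP f0.
    by move: fpos; rewrite f0 dot0r ltxx.
Qed.

(** If u is below its product with a reflection, then the image of c under this
    product is reflected to u c in a positive root that takes a value at least 0
    on u c. *)
Lemma bruhat_foldings v u w c : special_pt v -> weyl u -> bruhat_le u w -> dominant_chamber c ->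
  clos_refl_trans (set V) (positive_folding v) (segment v (v + w c)) (segment v (v + u c)).
Proof.
move=> sv Wu uw dc; have vv := special_vertex sv.
elim: uw Wu => {u w}[u w uw|u|u x w ux IH1 xw IH2] Wu; last first.
- have [Wx _] := bruhat_le_count Wu ux; apply: rt_trans (IH2 Wx) (IH1 Wu).
- exact: rt_refl.
have [s A] := weyl_acts Wu; have [p [q [lp lq pq spq ->]]] := bruhat_stepP Wu A uw.
have npq := letter_lt_neq pq.
have lsp : letter (s p) by rewrite (acts_letter A).
have lsq : letter (s q) by rewrite (acts_letter A).
have E : (u \o rf p q) c = rf (s p) (s q) (u c) by rewrite (acts_conj A lp lq npq).
rewrite E; have : 0 <= dot (root_of p q) c by apply: dc.2; apply/pos_rootsP; exists p, q.
rewrite -(acts_dot A) (acts_root A) // le_eqVlt => /orP[/eqP d0|d0].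
  by rewrite refl_root0 ?letter_lt_neq // -d0 scale0r subr0; apply: rt_refl.
apply: rt_step; apply: folding_up => //; apply: sv.2.
by apply/rootsP; exists (s p), (s q); split=> //; apply: letter_lt_neq.
Qed.

Lemma step_grid k k' C C' : (0 < k <= n)%N -> (0 < k' <= n)%N -> is_column k C -> is_column k' C' ->
  grid (- (step_vec k C + step_vec k' C')).
Proof.
move=> kn kn' col col'; set f := step_vec k C; set f' := step_vec k' C'.
have s1 : special_pt (f + f) by apply: column_step_special.
have s2 : special_pt (f' + f') by apply: column_step_special.
have -> : - (f + f') = 4%:R^-1 *: (- ((f + f + (f + f)) + (f' + f' + (f' + f')))).
  by move: (f) (f') => a b; apply/rowP => j; rewrite !mxE; field.
by apply/special_grid/special_ptN/special_ptD; apply: special_ptD.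
Qed.

(** The edge that continues in the direction of w, without a fold, is minimal as
    it lies in the sector of the preceding edge, up to translation; the Bruhat
    chain from u to w folds it to the actual edge. *)
Lemma special_local x w u C D : (0 < size C <= n)%N -> (0 < size D <= n)%N ->
  is_column (size C) C -> is_column (size D) D -> special_pt x ->
  lifts w C -> lifts u D -> bruhat_le u w ->
  positively_folded_at (segment (x - step_vec (size C) C) x) x
                       (segment x (x + step_vec (size D) D)).
Proof.
move=> kC kD colC colD sx Lw Lu uw; have [Ww _] := Lw; have [Wu _] := Lu.
have [D' [colD' wE]] := weyl_column (ltac:(lia) : (size D <= n)%N) Ww.
have dC := first_step_in_chamber kC; have dD := first_step_in_chamber kD.
exists (segment x (x + step_vec (size D) D')); split.
- by apply: is_edge_seg => //; apply: step_edge_vec.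
- exact: segment_left.
- rewrite -wE -(lifts_step _ Lw); last by lia.
  apply: minimal_common => //; rewrite wE (lifts_step _ Lw); last by lia.
  exact: step_grid.
- rewrite -wE -(lifts_step _ Lu); last by lia.
  exact: bruhat_foldings.
Qed.

(** * Foldings at the middle vertex of a block *)

Lemma count_add (A : seq int) (P : pred int) m : uniq A -> m \in A -> ~~ P m ->
  count (fun x => P x || (x == m)) A = (count P A).+1.
Proof.
move=> uA mA Pm; have := count_predUI P (pred1 m) A.
rewrite (count_uniq_mem m uA) mA addn1 => <-.
have -> : count (predI P (pred1 m)) A = 0%N; last by rewrite addn0.
by apply/eqP; rewrite -leqn0 leqNgt -has_count; apply/hasPn => x _ /=; case: eqP => [->|]; rewrite ?andbT ?andbF.
Qed.

Lemma count_remove (A : seq int) (P : pred int) r : uniq A -> r \in A -> P r ->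
  (count (fun x => P x && (x != r)) A).+1 = count P A.
Proof.
move=> uA rA Pr; rewrite -(@count_add A (fun x => P x && (x != r)) r) ?eqxx ?andbF //.
by apply: eq_count => x /=; case: eqP => [->|]; rewrite ?Pr ?andbT ?orbF ?orbT.
Qed.

Lemma count_strict (T : eqType) (P Q : pred T) (A : seq T) m : {in A, subpred P Q} -> m \in A ->
  ~~ P m -> Q m -> (count P A < count Q A)%N.
Proof.
elim: A => //= x A IH sub; rewrite inE => /orP[/eqP <-|mA] Pm Qm.
  rewrite (negPf Pm) Qm add0n add1n ltnS; apply: sub_in_count => y yA.
  by apply: sub; rewrite inE yA orbT.
have {}IH := IH (fun y yA => sub y (mem_behead (s := x :: A) yA)) mA Pm Qm.
apply: leq_trans (_ : P x + (count P A).+1 <= _)%N; first by rewrite addnS.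
apply: leq_add => //; have := sub x (mem_head x A); case: (P x) => // /(_ isT) ->.
by [].
Qed.

(** The column with the absolute values A and bars on the entries in X, up to
    the order of the entries. *)
Definition signed_seq (X : pred int) (A : seq int) : seq int := [seq if X m then - m else m | m <- A].
Definition signed_vec (X : pred int) (A : seq int) : V := 2%:R^-1 *: cvec (signed_seq X A).

Lemma signed_vecE X A : signed_vec X A = 2%:R^-1 *: cvec A - \sum_(m <- A | X m) eps m.
Proof.
rewrite /signed_vec /cvec big_map [\sum_(m <- A | X m) _]big_mkcond /= !scaler_sumr -sumrB.
apply: eq_bigr => m _; case: (X m); last by rewrite subr0.
by rewrite epsN; move: (eps m) => u; apply/rowP => j; rewrite !mxE; field.
Qed.

Lemma sum_add A (X : pred int) m : uniq A -> m \in A -> ~~ X m ->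
  \sum_(x <- A | X x || (x == m)) eps x = \sum_(x <- A | X x) eps x + eps m.
Proof.
move=> + + Xm; elim: A => //= x A IH /andP[xA uA]; rewrite !big_cons inE.
move=> /orP[/eqP mx|mA].
  rewrite -mx (negPf Xm) eqxx /= addrC; congr (_ + _).
  rewrite big_seq_cond [RHS]big_seq_cond; apply: eq_bigl => y.
  by case: (boolP (y \in A)) => // yA /=; case: eqP => [ym|_]; rewrite ?orbF //; move: xA; rewrite -mx -ym yA.
have -> : (x == m) = false by apply/negP => /eqP xm; move: xA; rewrite xm mA.
by rewrite orbF IH //; case: (X x); rewrite // addrA.
Qed.

Lemma sum_remove A (X : pred int) r : uniq A -> r \in A -> X r ->
  \sum_(x <- A | X x && (x != r)) eps x = \sum_(x <- A | X x) eps x - eps r.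
Proof.
move=> uA rA Xr; apply/eqP; rewrite eq_sym subr_eq -(@sum_add A (fun x => X x && (x != r)) r) ?eqxx ?andbF //.
apply/eqP/eq_bigl => x; case: eqP => [->|]; rewrite ?Xr ?andbT ?orbF ?orbT //.
Qed.

Lemma mult_signed X A m : uniq A -> {in A, forall x : int, 0 < x} -> m \in A ->
  mult m (signed_seq X A) = if X m then -1 else 1.
Proof.
move=> uA posA mA; have m0 := posA m mA.
have h1 : (m \in signed_seq X A) = ~~ X m.
  apply/mapP/idP => [[x xA]|Xm]; last by exists m; rewrite // (negPf Xm).
  have := posA x xA; case: ifP => Xx x0 E; first by exfalso; lia.
  by rewrite E Xx.
have h2 : (- m \in signed_seq X A) = X m.
  apply/mapP/idP => [[x xA]|Xm]; last by exists m; rewrite // Xm.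
  have := posA x xA; case: ifP => Xx x0 E; last by exfalso; lia.
  by have -> : m = x by lia.
by rewrite /mult h1 h2; case: (X m); rewrite ?sub0r ?subr0.
Qed.

Lemma signed_seq_uniq X A : uniq A -> {in A, forall x : int, 0 < x} -> uniq (signed_seq X A).
Proof.
move=> uA posA; rewrite map_inj_in_uniq // => x y xA yA; have := posA x xA; have := posA y yA.
by case: (X x); case: (X y); lia.
Qed.

Lemma pos_pair (m r : int) : 0 < m -> m < r -> [/\ letter_lt m r, m != r & (r == - m) = false].
Proof. by rewrite letter_ltE => m0 mr; split; lia. Qed.

Lemma neg_pair (m r : int) : 0 < m -> 0 < r -> letter_lt m (- r) /\ m != - r.
Proof. by rewrite letter_ltE => m0 r0; split; lia. Qed.

(** At v there are walls for the roots of two distinct letters with absolute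
    values in A; in type C the two absolute values have to be distinct. By
    induction on the number of signs to be corrected, the last folding of a
    chain from Y to X is found. If some r is barred in X only, then, for the
    least such r, counting yields an m < r that is barred in Y only, and the
    last folding moves the bar from m to r. If all bars of X are bars of Y, it
    removes one bar in type B, and two bars in type C, where a second one exists
    by parity. *)
Lemma sign_foldings v A : t <> TypeA -> is_vertex v -> uniq A -> {in A, forall x : int, 0 < x} ->
  all letter A ->
  (forall p q : int, `|p|%N%:Z \in A -> `|q|%N%:Z \in A -> p != q -> (t = TypeC -> q != - p) ->
     dot (root_of p q) v \is a Num.int) ->
  forall X Y : pred int,
  (forall z : int, count (fun m => X m && (m <= z)%R) A <= count (fun m => Y m && (m <= z)%R) A)%N ->
  (t = TypeC -> odd (count X A) = odd (count Y A)) ->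
  clos_refl_trans (set V) (positive_folding v)
    (segment v (v + signed_vec Y A)) (segment v (v + signed_vec X A)).
Proof.
move=> tA vv uA posA lA vint X Y.
have abs m : m \in A -> `|m|%N%:Z = m by move=> /posA; lia.
have lett m : m \in A -> letter m by move=> mA; apply: (allP lA).
have dotS X' p q : letter p -> letter q -> dot (root_of p q) (signed_vec X' A) =
    2%:R^-1 * (root_scale p q * (mult p (signed_seq X' A) - mult q (signed_seq X' A))).
  move=> lp lq; rewrite dotZr dot_root_cvec //; first exact: signed_seq_uniq.
  rewrite all_map; apply/allP => m mA /=; case: (X' m); rewrite ?letterN //; exact: lett.
(* The last folding of the chain: it is positive, since the root is positive and
   takes a positive value on the direction reached. *)
have move1 X1 X2 p q : letter p -> letter q -> letter_lt p q ->
    dot (root_of p q) v \is a Num.int -> dot (root_of p q) (signed_vec X1 A) = 1 ->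
    signed_vec X2 A = signed_vec X1 A - coroot_of p q ->
    clos_refl_trans (set V) (positive_folding v)
      (segment v (v + signed_vec Y A)) (segment v (v + signed_vec X2 A)) ->
    clos_refl_trans (set V) (positive_folding v)
      (segment v (v + signed_vec Y A)) (segment v (v + signed_vec X1 A)).
  move=> lp lq pq iv d1 E ch; apply: rt_trans ch _; apply: rt_step.
  have -> : signed_vec X2 A = rf p q (signed_vec X1 A).
    by rewrite refl_root0 ?letter_lt_neq // d1 scale1r E.
  by apply: folding_up => //; rewrite d1 ltr01.
(* The induction is on the number of signs in which X and Y differ. *)
have [N] := ubnP (count (fun m => X m != Y m) A); elim: N X => // N IH X.
rewrite ltnS => lN ord par.
have [/hasP [r0 r0A bad0]|/hasPn none] := boolP (has (fun r => X r && ~~ Y r) A).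
  have ex : exists k : nat, (k%:Z \in A) && (X k%:Z && ~~ Y k%:Z).
    by exists `|r0|%N; rewrite abs // r0A.
  case: (ex_minnP ex) => rn /andP[rA /andP[Xr Yr]] rmin; set r := rn%:Z in rA Xr Yr.
  have below x : x \in A -> x < r -> X x -> Y x.
    move=> xA xr Xx; apply/negPn/negP => Yx; have := rmin `|x|%N.
    rewrite abs // xA Xx Yx => /(_ isT).
    by rewrite leqNgt -ltz_nat abs // xr.
  have [m mA [mr Ym Xm]] : exists2 m, m \in A & [/\ m < r, Y m & ~~ X m].
    case: (pselect (exists2 m, m \in A & [/\ m < r, Y m & ~~ X m])) => // no; exfalso.
    have := ord r; rewrite leqNgt => /negP; apply.
    apply: (count_strict (m := r)) => //; last by rewrite Xr lexx.
      move=> x xA /andP[Yx xr]; rewrite xr andbT; apply/negPn/negP => Xx.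
      apply: no; exists x => //; split=> //; rewrite lt_neqAle xr andbT.
      by apply: contraNneq Yr => <-.
    by rewrite (negPf Yr).
  have [lmr nmr rNm] := pos_pair (posA m mA) mr.
  (* X' is X before the folding that moves the bar from m to r. *)
  pose X' x := (X x && (x != r)) || (x == m).
  have X'm : ~~ (X m && (m != r)) by rewrite (negPf Xm).
  apply: (move1 X X' m r); [exact: lett|exact: lett|exact: lmr| | | |].
  - by apply: vint; rewrite ?abs ?rNm.
  - rewrite dotS ?lett // !mult_signed // (negPf Xm) Xr root_scale1 ?rNm //.
    by rewrite mul1r opprK half_double.
  - rewrite !signed_vecE (sum_add uA mA X'm) (sum_remove uA rA Xr).
    have -> : coroot_of m r = eps m - eps r.
      rewrite /coroot_of /coroot_scale; rewrite rNm.
      by case: (t); rewrite scale1r.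
    move: (_ *: cvec A) (\sum_(x <- A | X x) eps x) (eps m) (eps r) => a b c d.
    by apply/rowP => j; rewrite !mxE; ring.
  apply: IH.
  - apply: leq_trans lN; apply: (count_strict (m := m)) => //.
    + move=> x xA; rewrite /X'; have [->|xm] := eqVneq x m; first by rewrite orbT Ym.
      by rewrite orbF; have [->|xr] := eqVneq x r; rewrite ?andbF ?(negPf Yr) ?andbT.
    + by rewrite /X' eqxx orbT Ym.
    + by rewrite (negPf Xm) Ym.
  - move=> z; have [zr|zr] := ltP z r.
      have [zm|zm] := ltP z m.
        apply: leq_trans (ord z); apply: sub_in_count => x xA /andP[+ xz].
        by rewrite /X' xz andbT => /orP[/andP[]//|/eqP xm]; move: xz; rewrite xm leNgt zm.
      have : (count (fun x => X x && (x <= z)%R) A < count (fun x => Y x && (x <= z)%R) A)%N.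
        apply: (count_strict (m := m)) => //; last by rewrite Ym.
          by move=> x xA /andP[Xx xz]; rewrite xz andbT; apply: below => //; apply: le_lt_trans zr.
        by rewrite (negPf Xm).
      apply: leq_trans.
      rewrite -(@count_add A (fun x => X x && (x <= z)) m) ?(negPf Xm) //.
      apply: sub_in_count => x xA /andP[/orP[/andP[-> _]|->] xz]; rewrite ?xz ?orbT //.
    apply: leq_trans (ord z); rewrite -ltnS.
    rewrite -(@count_remove A (fun x => X x && (x <= z)) r) ?Xr //.
    rewrite ltnS -(@count_add A (fun x => X x && (x <= z) && (x != r)) m) ?(negPf Xm) //.
    apply: sub_in_count => x xA; rewrite /X' => /andP[/orP[/andP[-> ->]|->] xz]; rewrite ?xz ?orbT //.
  - move=> tC; rewrite (count_add uA mA X'm) -(par tC) -(count_remove uA rA Xr) //.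
have [/hasP [m mA /andP[Ym Xm]]|/hasPn none2] := boolP (has (fun r => Y r && ~~ X r) A); last first.
  have -> : signed_vec X A = signed_vec Y A.
    congr (_ *: cvec _); apply/eq_in_map => m mA; have := none m mA; have := none2 m mA.
    by case: (X m); case: (Y m).
  exact: rt_refl.
have XY x : x \in A -> X x -> Y x by move=> xA Xx; have := none x xA; rewrite Xx negbK.
have m0 := posA m mA.
have [lmm nmm] := neg_pair m0 m0.
have [tB|tC] := typeBC tA.
  pose X' x := X x || (x == m).
  have X'Y x : x \in A -> X' x -> Y x by move=> xA /orP[/XY|/eqP ->] //; apply.
  apply: (move1 X X' m (- m)); rewrite ?letterN ?lett //.
  - by apply: vint; rewrite ?abszN ?abs ?tB.
  - rewrite dotS ?letterN ?lett // multN !mult_signed // (negPf Xm) root_scaleB // mul1r opprK.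
    by rewrite half_double.
  - rewrite !signed_vecE (sum_add uA mA Xm) opprD addrA; congr (_ - _).
    rewrite /coroot_of /coroot_scale eqxx; have -> (a : R) : match t with TypeC => 1 | _ => a end = a by rewrite tB.
    by rewrite epsN opprK; move: (eps m) => u; apply/rowP => j; rewrite !mxE half_double.
  apply: IH; last by rewrite tB.
    apply: leq_trans lN; apply: (count_strict (m := m)) => //; rewrite /X'.
    + by move=> x xA; have [->|xm] := eqVneq x m; rewrite ?orbT ?orbF ?Ym.
    + by rewrite eqxx orbT Ym.
    + by rewrite (negPf Xm) Ym.
  by move=> z; apply: sub_in_count => x xA /andP[/(X'Y x xA) -> ->].
have [m' m'A [m'm Ym' Xm']] : exists2 m', m' \in A & [/\ m' != m, Y m' & ~~ X m'].
  case: (pselect (exists2 m', m' \in A & [/\ m' != m, Y m' & ~~ X m'])) => // no; exfalso.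
  have : count Y A = (count X A).+1.
    rewrite -(count_add uA mA Xm); apply: eq_in_count => x xA.
    have [->|xm] := eqVneq x m; first by rewrite Ym orbT.
    rewrite orbF; apply/idP/idP => [Yx|]; last exact: XY.
    by apply/negPn/negP => Xx; apply: no; exists x.
  by move=> E; have := par tC; rewrite E /=; case: (odd _).
have m'0 := posA m' m'A; have [lmm' nmm'] := neg_pair m0 m'0.
have nmN : (- m' == - m) = false by rewrite (inj_eq oppr_inj) (negPf m'm).
pose X1 x := X x || (x == m); pose X' x := X1 x || (x == m').
have X1m' : ~~ X1 m' by rewrite /X1 (negPf Xm') (negPf m'm).
have X'Y x : x \in A -> X' x -> Y x by move=> xA /orP[/orP[/XY|/eqP ->]|/eqP ->] //; apply.
apply: (move1 X X' m (- m')); rewrite ?letterN ?lett //.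
- by apply: vint; rewrite ?abszN ?abs ?nmN.
- rewrite dotS ?letterN ?lett // multN !mult_signed // (negPf Xm) (negPf Xm') root_scale1 ?nmN //.
  by rewrite mul1r opprK half_double.
- rewrite !signed_vecE (sum_add uA m'A X1m') (sum_add uA mA Xm).
  rewrite /coroot_of /coroot_scale ?nmN; have -> (a : R) : match t with TypeC => 1 | _ => a end = 1 by rewrite tC.
  rewrite scale1r epsN opprK.
  move: (_ *: cvec A) (\sum_(x <- A | X x) eps x) (eps m) (eps m') => a b c d.
  by apply/rowP => j; rewrite !mxE; ring.
apply: IH.
- apply: leq_trans lN; apply: (count_strict (m := m)) => //; rewrite /X' /X1.
  + move=> x xA; have [->|xm] := eqVneq x m; first by rewrite orbT Ym.
    by have [->|xm'] := eqVneq x m'; rewrite ?orbT ?orbF ?Ym' // (negPf Xm').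
  + by rewrite eqxx orbT Ym.
  + by rewrite (negPf Xm) Ym.
- by move=> z; apply: sub_in_count => x xA /andP[/(X'Y x xA) -> ->].
- by move=> _; rewrite (count_add uA m'A X1m') (count_add uA mA Xm) /= negbK; apply: par.
Qed.

Lemma count_pointwise (P : pred int) D C : size D = size C ->
  (forall i, (i < size C)%N -> P (nth 0 D i) -> P (nth 0 C i)) -> (count P D <= count P C)%N.
Proof.
elim: C D => [|c C IH] [|d D] //= [sD] H; apply: leq_add.
  by have := H 0%N isT; rewrite /=; case: (P d) => // ->.
by apply: IH => // i iC; apply: (H i.+1).
Qed.

Lemma odd_count_xor (P S : pred int) C :
  odd (count (fun p => P p (+) S p) C) = odd (count P C) (+) odd (count S C).
Proof.
elim: C => //= p C IH; rewrite !oddD IH.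
by case: (P p); case: (S p); case: (odd (count P C)); case: (odd (count S C)).
Qed.

Definition abs_letters (C : seq int) : seq int := [seq `|p|%N%:Z | p <- C].
(** The absolute values that carry a bar in C. *)
Definition barred (C : seq int) : pred int := fun m => - m \in C.
Definition barred_upto (z p : int) : bool := (p < 0) && (- p <= z).

(** The letters counted here are all those from the letter - z upwards. *)
Lemma barred_upto_mono z p q : letter p -> letter q -> letter_le p q ->
  barred_upto z p -> barred_upto z q.
Proof.
by rewrite /letter_le /barred_upto letter_ltE => /letter_neq0 p0 /letter_neq0 q0; lia.
Qed.

Lemma barred_abs k D p : is_column k D -> p \in D -> barred D `|p|%N%:Z = (p < 0).
Proof.
move=> [_ lD _ nD] pD; have p0 := letter_neq0 (allP lD p pD); rewrite /barred.
have [pn|pp|E] := ltgtP p 0; last by rewrite E in p0.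
  by have -> : - `|p|%N%:Z = p by lia.
have -> : `|p|%N%:Z = p by lia.
exact: negPf (nD p pD).
Qed.

Lemma column_signed k D A : is_column k D -> perm_eq (abs_letters D) A ->
  perm_eq D (signed_seq (barred D) A).
Proof.
move=> col P; have [_ lD _ nD] := col; have := perm_map (fun m => if barred D m then - m else m) P.
rewrite -map_comp; congr perm_eq; rewrite -[RHS]map_id; apply/eq_in_map => p pD /=.
rewrite (barred_abs col pD); have := letter_neq0 (allP lD p pD).
by case: ifP; lia.
Qed.

Lemma count_barred k D A z : is_column k D -> perm_eq (abs_letters D) A ->
  count (fun m => barred D m && (m <= z)) A = count (barred_upto z) D.
Proof.
move=> col /permP P; rewrite -P count_map; apply: eq_in_count => p pD /=.
by rewrite (barred_abs col pD) /barred_upto; case: ltP => //= p0; congr (_ <= _); lia.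
Qed.

Lemma count_barred_all k D A : is_column k D -> perm_eq (abs_letters D) A ->
  count (barred D) A = count (fun p => p < 0) D.
Proof.
move=> col /permP P; rewrite -P count_map; apply: eq_in_count => p pD /=.
exact: barred_abs col pD.
Qed.

Lemma exchange_abs S C C' : exchange S C C' -> perm_eq (abs_letters C') (abs_letters C).
Proof.
move=> /(perm_map (fun p => `|p|%N%:Z)); rewrite -map_comp; congr perm_eq.
by apply/eq_map => p /=; case: (S p); rewrite ?abszN.
Qed.

Lemma exchange_parity S C C' : all letter C -> exchange S C C' ->
  odd (count (fun p => p < 0) C') = odd (count (fun p => p < 0) C) (+) odd (count S C).
Proof.
move=> lC /permP ->; rewrite count_map -odd_count_xor; congr odd.
apply: eq_in_count => p pC /=; have := letter_neq0 (allP lC p pC).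
by case: (S p); rewrite ?addbF ?addbT; lia.
Qed.

(** The first half step prolonged beyond the middle vertex is minimal, and the
    second half step differs from it by signs of entries only. *)
Lemma middle_local k U C C' w : (0 < k <= n)%N -> ~~ is_min k -> is_column k C -> is_column k C' ->
  linked C C' -> special_pt U -> lifts w C ->
  (forall i, (i < k)%N -> letter_le (nth 0 C' i) (nth 0 C i)) ->
  let v := U + step_vec k C in
  positively_folded_at (segment (v - step_vec k C) v) v (segment v (v + step_vec k C')).
Proof.
move=> kn m col col' lk sU Lw le v; have [sC lC _ nC] := col; have [sC' lC' _ _] := col'.
have tA : t <> TypeA by move=> tA; move: m; rewrite /is_min tA.
have [S par ex] := (linkedP tA col col').1 lk.
have sc : step_scale k = 2%:R^-1 by rewrite /step_scale (negPf m) weight_scale_nmin // mulr1.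
have sv : special_pt (v + step_vec k C).
  by rewrite /v -addrA; apply/special_ptD/column_step_special.
have vv : is_vertex v by apply: vertex_shift => //; apply: mid_vertex.
have [Ww _] := Lw.
set A := abs_letters C.
have PC : perm_eq (abs_letters C) A by apply: perm_refl.
have PC' : perm_eq (abs_letters C') A := exchange_abs ex.
have stepE D : is_column k D -> perm_eq (abs_letters D) A -> step_vec k D = signed_vec (barred D) A.
  by move=> cD PD; rewrite step_nmin // /signed_vec -(cvec_perm (column_signed cD PD)).
exists (segment v (v + step_vec k C)); split.
- have := is_edge_seg sv (edge_vecN (step_edge_vec col kn)).
  by rewrite addrK segmentC.
- exact: segment_left.
- rewrite -{1 2}sC -(lifts_step _ Lw); last by rewrite sC; lia.
  have dc : dominant_chamber (step_vec (size C) (first_letters (size C))).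
    by apply: first_step_in_chamber; rewrite sC.
  apply: minimal_common => //; rewrite (lifts_step _ Lw) sC; last by lia.
  exact: step_grid.
rewrite (stepE C) // (stepE C') //.
have mem p : `|p|%N%:Z \in A -> letter p /\ (mult p C = 1 \/ mult p C = - 1).
  move=> /mapP [q qC E]; have lq := allP lC q qC.
  have [->|->] : p = q \/ p = - q by lia.
    by split=> //; left; apply: mult_column col qC.
  by rewrite letterN // multN (mult_column col qC); split=> //; right.
apply: sign_foldings => //.
- rewrite map_inj_in_uniq; first exact: column_uniq col.
  move=> p q pC qC E; have [//|pq] : p = q \/ p = - q by lia.
  by have := nC q qC; rewrite -pq pC.
- by move=> x /mapP [p pC ->]; have := letter_neq0 (allP lC p pC); lia.
- apply/allP => x xA; have [|//] := mem x; move: (xA) => /mapP [p pC E].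
  by have -> : `|x|%N%:Z = x by lia.
- move=> p q /mem [lp mp] /mem [lq mq] pq qp.
  have rs : root_scale p q = 1.
    have [E|] := eqVneq q (- p); last exact: root_scale1.
    by have [tB|tC] := typeBC tA; [apply: root_scaleB|have := qp tC; rewrite E eqxx].
  rewrite /v dotDr rpredD ?sU.2 //; first by apply/rootsP; exists p, q.
  rewrite dot_root_step // sc rs mul1r.
  have neg : 2%:R^-1 * (-1 - 1) = -1 :> R by field.
  by case: mp => ->; case: mq => ->; rewrite ?subrr ?mulr0 ?rpred0 ?opprK ?half_double ?neg ?rpredN ?rpred1.
- move=> z; rewrite (count_barred _ col PC) (count_barred _ col' PC').
  apply: count_pointwise => [|i iC]; first by rewrite sC sC'.
  rewrite sC in iC; apply: barred_upto_mono; last exact: le.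
    by apply: (allP lC'); rewrite mem_nth ?sC'.
  by apply: (allP lC); rewrite mem_nth ?sC.
- move=> tC; rewrite (count_barred_all col PC) (count_barred_all col' PC') (exchange_parity lC ex).
  by rewrite (negPf (par tC)) addbF.
Qed.

(** * Semistandard tableaux come from positively folded galleries *)

(** Two successive steps meet in a special vertex, or they are the two halves of
    one block. *)
Lemma word_tableau_joint w T U k : good_word w -> word_tableau w T -> special_pt U ->
  (k.+1 < size T)%N ->
  let x := U + partial_sum (tableau_steps T) k.+1 in
  let C := nth [::] T k in let C' := nth [::] T k.+1 in
  special_pt x \/ exists i U', [/\ special_pt U', x = U' + step_vec i C, (0 < i <= n)%N /\ ~~ is_min i,
    is_column i C /\ is_column i C' & linked C C'].
Proof.
elim: w T U k => [|i w IH] T U k /=; first by move=> _ ->.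
move=> /andP[i_n gw]; have [m|m] := boolP (is_min i).
  move=> [C [T' [-> col wT]]] sU; have [sC _ _ _] := col.
  have [_ _ s1 _ _] := min_block i_n m col sU sU ltac:(by rewrite subrr; apply: QV0).
  rewrite /tableau_steps /= sC -/(tableau_steps T') partial_sum_cons addrA => kT.
  case: k kT => [|k] kT; first by left; rewrite partial_sum0 addr0.
  exact: IH.
move=> [C [C' [T' [-> col col' lk wT]]]] sU; have [sC _ _ _] := col; have [sC' _ _ _] := col'.
have [_ _ s1 _ _] := nmin_block i_n m col col' lk sU sU ltac:(by rewrite subrr; apply: QV0).
rewrite /tableau_steps /= sC sC' -/(tableau_steps T') partial_sum_cons => kT.
case: k kT => [|k] kT.
  by right; exists i, U; split=> //=; rewrite partial_sum0 addr0.
rewrite partial_sum_cons !addrA.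
case: k kT => [|k] kT; first by left; rewrite partial_sum0 addr0.
exact: IH.
Qed.

Lemma semistandard_folded w T : good_word w -> sorted leq w -> word_tableau w T ->
  semistandard T -> positively_folded (path_gallery (tableau_steps T)).
Proof.
move=> gw sw wT ss; have [|j jT|tau [lt br]] := lift_chain _ _ ss.
- by move=> j; apply: word_tableau_nth gw wT.
- exact: tableau_size_mono sw wT jT.
have sz : size (tableau_steps T) = size T by rewrite size_map.
have stepE k : (k < size T)%N -> partial_sum (tableau_steps T) k.+1 =
    partial_sum (tableau_steps T) k + step_vec (size (nth [::] T k)) (nth [::] T k).
  by move=> kT; rewrite partial_sumS ?sz // nth_tableau_steps.
split; rewrite ?size_path ?sz.
  move=> k kT; have kT' := ltnW kT.
  rewrite !edge_path ?sz // vertex_path ?sz //.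
  have -> : partial_sum (tableau_steps T) k = partial_sum (tableau_steps T) k.+1 -
      step_vec (size (nth [::] T k)) (nth [::] T k) by rewrite stepE // addrK.
  rewrite (stepE k.+1) //.
  have [colC kC] := word_tableau_nth gw wT kT'; have [colD kD] := word_tableau_nth gw wT kT.
  have := word_tableau_joint gw wT special_pt0 kT; rewrite /= add0r.
  move=> [sx|[i [U [sU -> [i_n m] [coli coli'] lk]]]].
    exact: special_local sx (lt k kT') (lt k.+1 kT) (br k kT).
  have [si _ _ _] := coli; have [si' _ _ _] := coli'; rewrite si si'.
  apply: middle_local (lt k kT') _ => // j ji; apply: (ss k j) => //; rewrite ?si ?si' //.
exists tau; split=> // k kT; first by have [] := lt k kT.
rewrite edge_path ?sz // vertex_path ?sz ?(ltnW kT) // stepE //.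
have [colC kC] := word_tableau_nth gw wT kT; have [Wk _] := lt k kT.
rewrite -(lifts_step _ (lt k kT)); last by lia.
by apply: segment_sector => //; apply: first_step_in_chamber.
Qed.

Lemma tableau_steps_inj w T T' : good_word w -> word_tableau w T -> word_tableau w T' ->
  tableau_steps T = tableau_steps T' -> T = T'.
Proof.
move=> gw wT wT' E; have sT : size T = size T' by move: (congr1 size E); rewrite !size_map.
have [zT _] := word_tableau_sizes wT; have [zT' _] := word_tableau_sizes wT'.
apply: (eq_from_nth (x0 := [::])) => // k kT; have kT' : (k < size T')%N by rewrite -sT.
have [colC _] := word_tableau_nth gw wT kT; have [[_ lD soD _] _] := word_tableau_nth gw wT' kT'.
have ss : size (nth [::] T k) = size (nth [::] T' k).
  by rewrite -!(nth_map _ 0%N size) // zT zT'.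
apply/esym/(cvec_inj colC) => //.
have := congr1 (nth 0 ^~ k) E; rewrite !nth_tableau_steps // /step_vec ss.
by move=> /scalerI <- //; rewrite gt_eqF ?step_scale_gt0.
Qed.

End Vectors.

Theorem proposition10 (R : realType) (t : cartan_type) (n : nat)
    (n_gt0 : (0 < n)%N) (a : nat -> nat) :
  exists T : gallery R t n -> tableau,
    [/\ (forall g, galleries R t n a g ->
           forall Y, tableau_of R t n a g Y <-> Y = T g),
        set_bij (galleries R t n a) (young_tableaux t n a) T &
        set_bij (galleries R t n a `&` [set g | positively_folded R t n g])
                (young_tableaux t n a `&` [set Y | semistandard Y]) T].
Proof.
pose w := lambda_word n a; have gw : good_word n w := good_lambda_word n a.
have sw : sorted leq w := lambda_word_sorted n a.
pose gal Y := path_gallery (tableau_steps R t n Y).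
have galP g : galleries R t n a g <-> exists Y, word_tableau R t n w Y /\ g = gal Y.
  exact: gallery_word_tableau gw.
have inj Y Y' : word_tableau R t n w Y -> word_tableau R t n w Y' -> gal Y = gal Y' -> Y = Y'.
  by move=> wY wY' /path_gallery_inj; apply: tableau_steps_inj gw wY wY'.
pose T g := if pselect (exists Y, word_tableau R t n w Y /\ g = gal Y) is left e
            then projT1 (cid e) else [::].
have TP g : galleries R t n a g -> word_tableau R t n w (T g) /\ g = gal (T g).
  by move=> /galP; rewrite /T; case: pselect => // e _; case: (cid e).
have youngP Y : young_tableaux t n a Y <-> word_tableau R t n w Y by apply: young_word_tableau.
have Tgal Y : word_tableau R t n w Y -> galleries R t n a (gal Y) /\ T (gal Y) = Y.
  move=> wY; have gY : galleries R t n a (gal Y) by apply/galP; exists Y.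
  by split=> //; have [wT E] := TP _ gY; apply: inj.
exists T; split.
- move=> g gg Y; have [wT E] := TP g gg; rewrite [tableau_of _ _ _ _ _ _](tableau_of_wordP _ _ gw).
  by split=> [[wY gY]|->] //; apply: inj => //; apply: etrans (esym gY) E.
- split.
  + by move=> g /TP [wT _]; apply/youngP.
  + by move=> g g'; rewrite !inE => /TP [_ gE] /TP [_ gE'] E; rewrite gE gE' E.
  + by move=> Y /youngP /Tgal [gY TY]; exists (gal Y).
- split.
  + move=> g [/TP [wT gE] pf]; split; first exact/youngP.
    by apply: folded_semistandard gw sw wT _; rewrite -/(gal (T g)) -gE.
  + by move=> g g'; rewrite !inE => -[/TP [_ gE] _] [/TP [_ gE'] _] E; rewrite gE gE' E.
  + move=> Y [/youngP wY ss]; have [gY TY] := Tgal Y wY; exists (gal Y) => //; split=> //.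
    exact: semistandard_folded gw sw wY ss.
Qed.
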